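(* Suppose that $\Gamma$ is a nonuniform lattice in $\mathrm U(2,1)$. If $\Gamma$ contains a complex reflection of order $5$ or of order at least $7$, then $\Gamma$ is nonarithmetic.
   Context: Let $V$ be a 3-dimensional complex vector space with a hermitian form $h$ of signature $(2,1)$, and $\mathrm U(2,1)$ its unitary group. A complex reflection is a finite-order diagonalizable $R\in\mathrm U(2,1)$ with eigenvalue $1$ of multiplicity $2$ and third eigenvalue a root of unity $\eta\neq1$, whose $\eta$-eigenspace is an $h$-positive line (so $R$ fixes pointwise a complex hyperbolic line in the complex hyperbolic plane $\mathbf H_{\mathbb C}^2$ of $h$-negative lines). A lattice is nonuniform if it is not cocompact. Arithmeticity. Let $F$ be a totally real number field, $E$ a totally imaginary quadratic extension of $F$, and $\mathcal D$ either $E$ ($d=1$) or a cubic division algebra with center $E$ ($d=3$), with an involution $\tau$ restricting to the Galois involution of $E/F$ on $E$. Put $r=3/d$ and let $h'$ be a $\tau$-hermitian form on $\mathcal D^r$ such that, for exactly one real embedding $\iota$ of $F$, the unitary group $\mathrm U(\iota(h'))$ is noncompact, and this group is isomorphic to $\mathrm U(2,1)$. For an order $\mathcal O$ of $\mathcal D$, let $\Gamma_{\mathcal O}$ be the subgroup of $\mathrm{GL}_r(\mathcal O)$ preserving $h'$. A lattice in $\mathrm{PU}(2,1)$ is arithmetic if it is commensurable with the image of some such $\Gamma_{\mathcal O}$; a lattice in $\mathrm U(2,1)$ is arithmetic if its image in $\mathrm{PU}(2,1)$ is, and nonarithmetic otherwise. *)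

(* Defs.v *)
From HB Require Import structures.
From mathcomp Require Import all_boot all_order all_algebra all_field.
From mathcomp Require Import complex.
From mathcomp Require Import all_classical all_reals all_analysis.

Set Implicit Arguments.
Unset Strict Implicit.
Unset Printing Implicit Defensive.

Import Order.TTheory GRing.Theory Num.Theory.
Import numFieldNormedType.Exports.

Local Open Scope classical_set_scope.
Local Open Scope ring_scope.

(* Packed as a numClosedFieldType because the topology of the modulus is
   inferred from that structure and not from the bare type R[i]. *)
Definition CC (R : realType) : numClosedFieldType := R[i]%C.

(* The matrix K encodes the theta-hermitian form
     h(u, v) = u K theta(v)^T
   on the left A-module of row vectors A^n. A matrix X acts on the right by
   u |-> u X, which is also the convention of [eigenspace]; X preserves h iff
   X K theta(X)^T = K. *)
Definition hermitian_mx (A : pzRingType) (theta : A -> A) n (K : 'M[A]_n) :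
  Prop := (map_mx theta K)^T = K.

Definition isometry_group (A : pzRingType) (theta : A -> A) n (K : 'M[A]_n) :
    set 'M[A]_n :=
  [set X | (exists Y, X *m Y = 1%:M /\ Y *m X = 1%:M)
           /\ X *m K *m (map_mx theta X)^T = K].

Section UnitaryGroup.
Variables (R : realType) (n : nat) (H : 'M[CC R]_n).

Definition unitary_group : Type := set_type (isometry_group Num.conj H).

HB.instance Definition _ := Topological.on unitary_group.

Implicit Types g : unitary_group.

Definition mx_of g : 'M[CC R]_n := set_val g.

Lemma mx_of_inj : injective mx_of.
Proof. exact: val_inj. Qed.

Lemma mx_ofP g : isometry_group Num.conj H (mx_of g).
Proof. exact: set_valP. Qed.

Lemma mx_of_unit g : mx_of g \in unitmx.
Proof. by have [[Y [XY _]] _] := mx_ofP g; case/mulmx1_unit: XY. Qed.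

Fact unitary_one_subproof : isometry_group Num.conj H (1%:M : 'M[CC R]_n).
Proof.
split; first by exists 1%:M; rewrite mulmx1.
by rewrite mul1mx map_mx1 trmx1 mulmx1.
Qed.

Fact unitary_mul_subproof g1 g2 :
  isometry_group Num.conj H (mx_of g1 *m mx_of g2).
Proof.
have [_ e1] := mx_ofP g1; have [_ e2] := mx_ofP g2.
have u : mx_of g1 *m mx_of g2 \in unitmx.
  by rewrite unitmx_mul !mx_of_unit.
split; first by exists (invmx (mx_of g1 *m mx_of g2)); rewrite mulmxV ?mulVmx.
rewrite map_mxM trmx_mul !mulmxA.
by rewrite -(mulmxA (mx_of g1)) -(mulmxA (mx_of g1)) e2 e1.
Qed.

Fact unitary_inv_subproof g : isometry_group Num.conj H (invmx (mx_of g)).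
Proof.
have [_ e] := mx_ofP g; have u := mx_of_unit g.
split; first by exists (mx_of g); rewrite mulmxV ?mulVmx.
have uT : (map_mx Num.conj (mx_of g))^T \in unitmx.
  by rewrite unitmx_tr map_unitmx.
rewrite map_invmx trmx_inv; apply: (can_inj (mulmxK uT)).
by rewrite mulmxKV// -{1}e -!mulmxA mulKmx.
Qed.

Definition unitary_one : unitary_group :=
  exist _ 1%:M (mem_set unitary_one_subproof).
Definition unitary_mul g1 g2 : unitary_group :=
  exist _ (mx_of g1 *m mx_of g2) (mem_set (unitary_mul_subproof g1 g2)).
Definition unitary_inv g : unitary_group :=
  exist _ (invmx (mx_of g)) (mem_set (unitary_inv_subproof g)).

Fact unitary_mulA : associative unitary_mul.
Proof. by move=> x y z; apply: mx_of_inj; exact: mulmxA. Qed.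

Fact unitary_mul1g : left_id unitary_one unitary_mul.
Proof. by move=> x; apply: mx_of_inj; exact: mul1mx. Qed.

Fact unitary_mulg1 : right_id unitary_one unitary_mul.
Proof. by move=> x; apply: mx_of_inj; exact: mulmx1. Qed.

Fact unitary_mulVg : left_inverse unitary_one unitary_inv unitary_mul.
Proof. by move=> x; apply: mx_of_inj; exact/mulVmx/mx_of_unit. Qed.

Fact unitary_mulgV : right_inverse unitary_one unitary_inv unitary_mul.
Proof. by move=> x; apply: mx_of_inj; exact/mulmxV/mx_of_unit. Qed.

HB.instance Definition _ := isGroup.Build unitary_group
  unitary_mulA unitary_mul1g unitary_mulg1 unitary_mulVg unitary_mulgV.

HB.instance Definition _ := isPointed.Build unitary_group unitary_one.

End UnitaryGroup.

Section LeftCosets.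
Local Open Scope group_scope.
Variables (G : groupType) (Delta : groupClosed G).

Definition coset_rel : rel G := fun x y => x^-1 * y \in Delta.

Fact coset_rel_refl : reflexive coset_rel.
Proof. by move=> x; rewrite /coset_rel mulVg gpred1. Qed.

Fact coset_rel_sym : symmetric coset_rel.
Proof. by move=> x y; rewrite /coset_rel -gpredV invgM invgK. Qed.

Fact coset_rel_trans : transitive coset_rel.
Proof.
move=> y x z xy yz; rewrite /coset_rel.
by have := gpredM _ _ xy yz; rewrite mulgA mulgK.
Qed.

Canonical coset_equiv :=
  EquivRel coset_rel coset_rel_refl coset_rel_sym coset_rel_trans.

Definition left_cosets : Type := {eq_quot coset_equiv}%qT.

HB.instance Definition _ := EqQuotient.on left_cosets.
HB.instance Definition _ := Choice.on left_cosets.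

End LeftCosets.

Definition finite_index (G : groupType) (A B : set G) : Prop :=
  finite_set [set [set (a * b)%g | b in B] | a in A].

Definition commensurable (G : groupType) (A B : set G) : Prop :=
  finite_index A (A `&` B) /\ finite_index B (A `&` B).

Definition has_order (G : groupType) (g : G) (n : nat) : Prop :=
  [/\ (0 < n)%N, (g ^+ n)%g = 1%g
    & forall m, (0 < m < n)%N -> (g ^+ m)%g <> 1%g].

Section Lattices.
Variables (R : realType) (n : nat) (H : 'M[CC R]_n).
Local Notation G := (unitary_group H).
Variable Gamma : groupClosed G.

Definition homogeneous_space : Type := quotient_topology (left_cosets Gamma).

HB.instance Definition _ := PointedTopological.on homogeneous_space.

(* g . (x Gamma) = (g x) Gamma; the choice of the representative is
   irrelevant. *)
Definition left_translation (g : G) (q : homogeneous_space) :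
  homogeneous_space := (\pi_homogeneous_space (g * repr q)%g)%qT.

Definition borel_homogeneous_space :=
  g_sigma_algebraType (@open homogeneous_space).

Definition has_finite_invariant_measure : Prop :=
  exists mu : {measure set borel_homogeneous_space -> \bar R},
    [/\ mu setT != 0%E, (mu setT < +oo)%E
      & forall (g : G) (A : set borel_homogeneous_space), measurable A ->
          mu (left_translation g @^-1` A) = mu A].

Definition is_lattice : Prop :=
  (forall g : set_type [set` Gamma], open [set g])
  /\ has_finite_invariant_measure.

Definition is_cocompact : Prop := compact [set: homogeneous_space].

End Lattices.

Section ProjectiveUnitaryGroup.
Local Open Scope group_scope.
Variables (R : realType) (n : nat) (H : 'M[CC R]_n).
Local Notation G := (unitary_group H).
Implicit Types g : G.

Lemma mx_of1 : mx_of (1 : G) = 1%:M. Proof. by []. Qed.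

Lemma mx_ofM g1 g2 : mx_of (g1 * g2) = mx_of g1 *m mx_of g2.
Proof. by []. Qed.

Lemma mx_ofV g : mx_of g^-1 = invmx (mx_of g). Proof. by []. Qed.

Definition scalar_unitary : {pred G} := [pred g | is_scalar_mx (mx_of g)].

Fact scalar_unitary1 : 1 \in scalar_unitary.
Proof. exact: scalar_mx_is_scalar. Qed.

Fact scalar_unitaryM : mulg_closed scalar_unitary.
Proof.
move=> x y /is_scalar_mxP[a xa] /is_scalar_mxP[b yb].
apply/is_scalar_mxP; exists (a * b)%R.
by rewrite mx_ofM xa yb scalar_mxM.
Qed.

Fact scalar_unitaryV : invg_closed scalar_unitary.
Proof.
move=> x /is_scalar_mxP[a xa]; apply/is_scalar_mxP; exists (a^-1)%R.
by rewrite mx_ofV xa invmx_scalar.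
Qed.

HB.instance Definition _ :=
  isInvClosed.Build G scalar_unitary scalar_unitaryV.
HB.instance Definition _ :=
  isMulClosed.Build G scalar_unitary scalar_unitaryM.
HB.instance Definition _ :=
  isMul1Closed.Build G scalar_unitary scalar_unitary1.

Lemma scalar_unitaryC x y : y \in scalar_unitary -> x * y = y * x.
Proof.
move=> /is_scalar_mxP[a ya]; apply: mx_of_inj.
by rewrite !mx_ofM ya scalar_mxC.
Qed.

Definition unitary_center : groupClosed G :=
  [the groupClosed G of scalar_unitary].

Definition projective_unitary_group : Type := left_cosets unitary_center.
Local Notation PG := projective_unitary_group.

HB.instance Definition _ := Choice.on PG.

Definition to_projective (g : G) : PG :=
  (\pi_(left_cosets unitary_center) g)%qT.

Lemma to_projectiveK (p : PG) : to_projective (repr (p : left_cosets _)) = p.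
Proof. exact: reprK. Qed.

Lemma to_projectiveP x y :
  reflect (to_projective x = to_projective y) (x^-1 * y \in scalar_unitary).
Proof.
exact: (@eqmodP _ (coset_equiv unitary_center) x y).
Qed.

Definition projective_one : PG := to_projective 1.
Definition projective_mul (p q : PG) : PG :=
  to_projective (repr (p : left_cosets _) * repr (q : left_cosets _)).
Definition projective_inv (p : PG) : PG :=
  to_projective (repr (p : left_cosets _))^-1.

Lemma to_projectiveM x y :
  to_projective (x * y) = projective_mul (to_projective x) (to_projective y).
Proof.
rewrite /projective_mul; set x' := repr _; set y' := repr _.
have /to_projectiveP xx' : to_projective x = to_projective x'.
  by rewrite to_projectiveK.
have /to_projectiveP yy' : to_projective y = to_projective y'.
  by rewrite to_projectiveK.
apply/to_projectiveP.
have -> : (x * y)^-1 * (x' * y') = (x^-1 * x') * (y^-1 * y').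
  by rewrite invgM [RHS]mulgA -(scalar_unitaryC _ xx') !mulgA.
exact: scalar_unitaryM xx' yy'.
Qed.

Lemma to_projectiveV x :
  to_projective x^-1 = projective_inv (to_projective x).
Proof.
rewrite /projective_inv; set x' := repr _.
have /to_projectiveP xx' : to_projective x = to_projective x'.
  by rewrite to_projectiveK.
apply/to_projectiveP; have zV := scalar_unitaryV xx'.
suff -> : x^-1^-1 * x'^-1 = (x^-1 * x')^-1 by [].
apply: (mulIg x); rewrite -[RHS](scalar_unitaryC _ zV) !invgM !invgK.
by rewrite -mulgA.
Qed.

Fact projective_mulA : associative projective_mul.
Proof.
move=> p q r; rewrite -[p]to_projectiveK -[q]to_projectiveK -[r]to_projectiveK.
by rewrite -!to_projectiveM mulgA.
Qed.

Fact projective_mul1g : left_id projective_one projective_mul.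
Proof. by move=> p; rewrite -[p]to_projectiveK -to_projectiveM mul1g. Qed.

Fact projective_mulg1 : right_id projective_one projective_mul.
Proof. by move=> p; rewrite -[p]to_projectiveK -to_projectiveM mulg1. Qed.

Fact projective_mulVg : left_inverse projective_one projective_inv projective_mul.
Proof.
by move=> p; rewrite -[p]to_projectiveK -to_projectiveV -to_projectiveM mulVg.
Qed.

Fact projective_mulgV : right_inverse projective_one projective_inv projective_mul.
Proof.
by move=> p; rewrite -[p]to_projectiveK -to_projectiveV -to_projectiveM mulgV.
Qed.

HB.instance Definition _ := isGroup.Build PG
  projective_mulA projective_mul1g projective_mulg1
  projective_mulVg projective_mulgV.

End ProjectiveUnitaryGroup.

Definition signature_2_1 (R : realType) (H : 'M[CC R]_3) : Prop :=
  hermitian_mx Num.conj H /\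
  exists2 P : 'M[CC R]_3, P \in unitmx &
    P *m H *m (map_mx Num.conj P)^T
    = diag_mx (\row_(i < 3) (if (i == 2 :> nat)%N then -1 else 1)).

Definition is_complex_reflection (R : realType) (H : 'M[CC R]_3)
    (g : unitary_group H) : Prop :=
  let M := mx_of g in
  [/\ exists n, has_order g n, diagonalizable M, \rank (eigenspace M 1) = 2%N
    & exists eta : CC R,
        [/\ eta != 1, exists2 n, (0 < n)%N & n.-unity_root eta, eigenvalue M eta
          & forall v : 'rV[CC R]_3, v != 0 -> (v <= eigenspace M eta)%MS ->
              0 < (v *m H *m (map_mx Num.conj v)^T) 0 0]].

Definition totally_real (R : realType) (F : fieldExtType rat) : Prop :=
  forall (sigma : {rmorphism F -> CC R}) x, sigma x \is Num.real.

Definition totally_imaginary (R : realType) (E : pzRingType) : Prop :=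
  forall sigma : {rmorphism E -> CC R}, ~ forall x, sigma x \is Num.real.

Section ArithmeticData.
Variables (F : fieldExtType rat) (E : fieldExtType F) (D : falgType E).

Definition quadratic_extension : Prop := \dim {: E} = 2%N.

(* For d = 1 this says that D = E, for d = 3 that D is a cubic division
   algebra with center E. *)
Definition central_division_algebra (d : nat) : Prop :=
  [/\ forall x : D, x != 0 -> x \is a GRing.unit,
      forall x : D, (forall y, x * y = y * x) -> exists a : E, x = a%:A
    & \dim {: D} = (d ^ 2)%N].

Definition involution_over_galois (tau : D -> D) : Prop :=
  [/\ {morph tau : x y / x + y}, forall x y, tau (x * y) = tau y * tau x,
      involutive tau
    & exists2 c : {lrmorphism E -> E},
        (exists a, c a != a) & forall a : E, tau a%:A = (c a)%:A].

Definition is_order (O : set D) : Prop :=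
  [/\ O 1, forall x y, O x -> O y -> O (x - y) /\ O (x * y),
      exists (n : nat) (b : 'I_n -> D),
        forall x, O x <-> exists a : 'I_n -> int, x = \sum_i b i *~ a i
    & forall x : D, exists2 n : nat, (0 < n)%N & O (x *+ n)].

Definition order_GL (O : set D) r : set 'M[D]_r :=
  [set X | exists Y, [/\ X *m Y = 1%:M, Y *m X = 1%:M
                       & forall i j, O (X i j) /\ O (Y i j)]].

Definition order_isometries (O : set D) (tau : D -> D) r (K : 'M[D]_r) :
    set 'M[D]_r := @order_GL O r `&` isometry_group tau K.

End ArithmeticData.

(* phi and tau' identify (D, tau) (x)_{F, iota} R with the real algebra M_d(C)
   endowed with the involution tau': phi is a ring morphism extending iota, the real
   span of its image is all of M_d(C) (hence D (x)_{F, iota} R -> M_d(C) is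
   bijective, both sides having real dimension 2 d^2), and tau' is the
   R-linear extension of tau. Such a completion exists for every iota and is
   unique up to isomorphism, because E is totally imaginary and D is central
   simple over E. If K is the matrix of h', the group U(iota(h')) is then
   isometry_group tau' (map_mx phi K), a set of r x r matrices with entries
   in M_d(C). *)
Definition real_completion (R : realType) (F : fieldExtType rat)
    (E : fieldExtType F) (D : falgType E) (tau : D -> D)
    (iota : {rmorphism F -> R}) d (phi : {rmorphism D -> 'M[CC R]_d})
    (tau' : 'M[CC R]_d -> 'M[CC R]_d) : Prop :=
  let real (t : R) : CC R := t%:C%C in
  [/\ forall a : F, phi (a%:A : E)%:A = (real (iota a))%:M,
      forall M, exists (n : nat) (t : 'I_n -> R) (x : 'I_n -> D),
        M = \sum_i real (t i) *: phi (x i),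
      forall (t : R) M N, tau' (real t *: M + N) = real t *: tau' M + tau' N
    & forall x, tau' (phi x) = phi (tau x)].

Definition topological_iso (R : realType) d (tau : 'M[CC R]_d -> 'M[CC R]_d)
    r (K : 'M['M[CC R]_d]_r) (H : 'M[CC R]_3)
    (f : set_type (isometry_group tau K) -> unitary_group H) : Prop :=
  [/\ forall X Y Z : set_type (isometry_group tau K),
        set_val Z = set_val X *m set_val Y -> f Z = (f X * f Y)%g,
      continuous f
    & exists g, [/\ continuous g, cancel f g & cancel g f]].

(* iota is the unique real embedding of F at which U(iota(h')) is noncompact,
   f is the isomorphism of this group with U(2,1), and O is the order. *)
Definition is_arithmetic (R : realType) (H : 'M[CC R]_3)
    (Gamma : groupClosed (unitary_group H)) : Prop :=
  exists (F : fieldExtType rat) (E : fieldExtType F) (D : falgType E)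
         (d : nat) (tau : D -> D) (K : 'M[D]_(3 %/ d)%N) (O : set D)
         (iota : {rmorphism F -> R}) (phi : {rmorphism D -> 'M[CC R]_d})
         (tau' : 'M[CC R]_d -> 'M[CC R]_d)
         (f : set_type (isometry_group tau' (map_mx phi K)) -> unitary_group H),
    [/\ totally_real R F, quadratic_extension E & totally_imaginary R E] /\
    [/\ d = 1%N \/ d = 3%N, central_division_algebra D d,
        involution_over_galois tau, hermitian_mx tau K & is_order O] /\
    [/\ real_completion tau iota phi tau',
        ~ compact (isometry_group tau' (map_mx phi K)),
        forall iota1 : {rmorphism F -> R}, ~ iota1 =1 iota ->
          exists (phi1 : {rmorphism D -> 'M[CC R]_d}) tau1',
            real_completion tau iota1 phi1 tau1' /\
            compact (isometry_group tau1' (map_mx phi1 K))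
      & topological_iso f] /\
    commensurable
      [set to_projective g | g in [set` Gamma]]
      [set to_projective (f X) | X in
         [set X : set_type (isometry_group tau' (map_mx phi K)) |
           exists2 Y, order_isometries O tau K Y & set_val X = map_mx phi Y]].

(* Main.v *)
From HB Require Import structures.
Require Import Defs.
From mathcomp Require Import all_boot all_order all_algebra all_field.
From mathcomp Require Import complex.
From mathcomp Require Import all_classical all_reals all_analysis.
From mathcomp Require Import ring lra zify.

Set Implicit Arguments.
Unset Strict Implicit.
Unset Printing Implicit Defensive.

Import Order.TTheory GRing.Theory Num.Theory.
Import numFieldNormedType.Exports.

Local Open Scope classical_set_scope.
Local Open Scope ring_scope.

(** Suppose that [Gamma] is arithmetic, given by a form [h'] of matrix [K] over
    [D] with center [E], by an embedding [iota] of the real field [F] and by an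
    order. At [iota] the algebra [M_r(D)] acts on [C^3] through a morphism [rho],
    and the isometries of [h'] become the unitary group of a hermitian matrix
    [J] ([model_exists]). This group is isomorphic to [U(2,1)] only as a
    topological group, and [K] might be singular; still, the isomorphism
    forces [J] to be invertible ([transported_form_unit]). There are two cases.

    If [F] is not the field of rational numbers, it has a second real embedding
    ([second_embedding]). The unitary group is compact there, so [h'] has no
    isotropic vector ([anisotropic_sesqui]), and Godement's criterion makes
    [Gamma] cocompact. It is proved by reduction theory. Every isometry [x] at
    [iota] extends, by the identity at the other places, to an operator on the
    real vector space [V (x) R], where [V = M_r(D)], that preserves the form
    [X K tau(X)^T] ([extension_operator]). The squared lengths of the images of
    the nonzero points of a lattice of [V] are bounded below, because the values of the
    form there have bounded denominators and do not vanish. By Hermite reduction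
    ([hermite_reduction]) the lattice has a basis whose image is bounded, and
    there are finitely many Gram matrices for such bases. Two bases with the
    same Gram matrix differ by right multiplication by an isometry with entries
    in the order, which moves [x] into a fixed bounded set
    ([uniform_reduction]).

    If [F] is the field of rational numbers, the finiteness of the volume gives,
    by Poincare recurrence applied to a hyperbolic element, a weak form of the
    Borel density theorem: for each exponent [N > 0], no nonzero matrix is
    orthogonal under the trace to the [N]-th powers of all elements of [Gamma]
    ([trace_separation]). Some power of every element of [Gamma] is a scalar
    multiple of an element of [rho (M_r(D))], and the expression
    [W^3 / det W] removes the scalar. So the elements of [Gamma] act by
    conjugation on an [E]-form of the algebra of matrices, and [tr g tr g^-1],
    the trace of this action, lies in [E] ([adjoint_trace]).

    A complex reflection has a noncommutative centralizer
    ([reflection_centralizer]), and this property passes through the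
    isomorphism. Hence its transport has eigenvalues [a, a, b], and the trace
    above is [5 + 2 (z + z^-1)] with [z = b / a] a root of unity. It is real,
    hence rational, and then [z] has order 1, 2, 3, 4 or 6
    ([rational_cosine_order]). If [z^k = 1], the [k]-th power of the reflection
    is scalar, and it is the identity because it fixes a vector
    ([reflection_order]). This excludes the order 5 and the orders from 7
    on. *)

(** * Linear algebra *)

Lemma additive0 (U V : zmodType) (S : U -> V) : {morph S : x y / x + y} -> S 0 = 0.
Proof. by move=> SD; apply: (addrI (S 0)); rewrite -SD !addr0. Qed.

Lemma left_null_vector (K : fieldType) m n (A : 'M[K]_(m, n)) : (\rank A < m)%N ->
  exists2 u : 'rV[K]_m, u *m A = 0 & u != 0.
Proof.
move=> rA; have /rowV0Pn[u /sub_kermxP uA u0] : kermx A != 0.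
  by rewrite -mxrank_eq0 mxrank_ker -lt0n subn_gt0.
by exists u.
Qed.

Lemma right_null_vector (K : fieldType) m n (A : 'M[K]_(m, n)) : (\rank A < n)%N ->
  exists2 c : 'cV[K]_n, A *m c = 0 & c != 0.
Proof.
rewrite -mxrank_tr => /left_null_vector[u uA u0]; exists u^T.
  by apply: trmx_inj; rewrite trmx_mul trmxK uA linear0.
by apply: contra_neq u0 => /(congr1 trmx); rewrite trmxK linear0.
Qed.

(** * Hermite reduction of positive quadratic forms over the integers *)

Section Reduction.
Variable R : realType.

Definition qform n (S : 'M[R]_n) (a : 'rV[R]_n) : R := (a *m S *m a^T) 0 0.

Notation intv := (map_mx (intr : int -> R)).

Lemma qformZ n (S : 'M[R]_n) c a : qform S (c *: a) = c ^+ 2 * qform S a.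
Proof.
by rewrite /qform linearZ /= -!scalemxAl -scalemxAr !mxE expr2 mulrA.
Qed.

Lemma qform_conj n m (S : 'M[R]_n) (G : 'M[R]_(m, n)) a :
  qform (G *m S *m G^T) a = qform S (a *m G).
Proof. by rewrite /qform trmx_mul !mulmxA. Qed.

Lemma qform_row n m (S : 'M[R]_n) (G : 'M[R]_(m, n)) i :
  qform S (row i G) = (G *m S *m G^T) i i.
Proof.
rewrite /qform !mxE; apply: eq_bigr => k _; rewrite !mxE; congr (_ * _).
by apply: eq_bigr => l _; rewrite !mxE.
Qed.

Lemma unit_row_neq0 (n : nat) (g : 'M[int]_n) i : g \in unitmx -> row i g != 0.
Proof.
move=> gu; apply/eqP => r0.
have : row i g *m invmx g = 0 by rewrite r0 mul0mx.
rewrite -row_mul mulmxV// => /rowP/(_ i); rewrite !mxE eqxx => /eqP.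
by rewrite oner_eq0.
Qed.

(** While some nonzero vector has less than half the value of the current one,
    pass to it. All values are at least [d], so a value below [2 ^+ k * d] can
    be halved at most [k] times. Being minimal up to the factor 2 is enough
    for the reduction. *)
Lemma nearly_minimal_vector n (S : 'M[R]_n) (d : R) : (0 < n)%N -> 0 < d ->
  (forall a : 'rV[int]_n, a != 0 -> d <= qform S (intv a)) ->
  exists2 a : 'rV[int]_n, a != 0 &
    forall b : 'rV[int]_n, b != 0 -> qform S (intv a) <= 2 * qform S (intv b).
Proof.
case: n S => // n S _ d0 Sd.
suff main k (a : 'rV[int]_n.+1) : a != 0 -> qform S (intv a) <= 2 ^+ k * d ->
    exists2 a : 'rV[int]_n.+1, a != 0 & forall b : 'rV[int]_n.+1, b != 0 ->
      qform S (intv a) <= 2 * qform S (intv b).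
  pose a : 'rV[int]_n.+1 := delta_mx 0 0.
  have a0 : a != 0.
    by apply/eqP => /rowP/(_ 0); rewrite !mxE !eqxx => /eqP; rewrite oner_eq0.
  have [k kP] : exists k, qform S (intv a) <= 2 ^+ k * d.
    exists (Num.bound `|qform S (intv a) / d|).
    rewrite -ler_pdivrMr//; apply: le_trans (ler_norm _) _.
    apply/ltW/(lt_le_trans (archi_boundP _)) => //.
    by rewrite -natrX ler_nat; exact/ltnW/ltn_expl.
  exact: main a0 kP.
elim: k a => [|k IH] a a0 ale.
  exists a => // b /Sd bd; rewrite expr0 mul1r in ale.
  apply: (le_trans ale); lra.
have [[b [b0 bP]]|nb] := pselect (exists b : 'rV[int]_n.+1,
    b != 0 /\ 2 * qform S (intv b) < qform S (intv a)).
  apply: (IH b b0); move: ale bP; rewrite exprS; lra.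
by exists a => // b b0; rewrite leNgt; apply/negP => ?; apply: nb; exists b.
Qed.

(** The Smith normal form of a single row has one nonzero entry, its content;
    dividing by it leaves a row that extends to a basis. *)
Lemma row_of_unimodular n (a : 'rV[int]_n.+1) : a != 0 ->
  exists2 G : 'M[int]_n.+1, G \in unitmx & exists2 c : int, c != 0 &
    a = c *: row 0 G.
Proof.
move=> a0; have [L Lu [G Gu [d _ aE]]] := int_Smith_normal_form a.
exists G => //.
set D := \matrix_(i, j) _ in aE.
have DE : D = (d`_0) *: delta_mx 0 0.
  apply/matrixP => i j; rewrite !mxE ord1 /= (eq_sym j 0).
  have -> : (0%N == j :> nat) = (0 == j) by [].
  by rewrite mulr_natr.
have aE' : a = (L 0 0 * d`_0) *: row 0 G.
  rewrite aE DE [L]mx11_scalar mul_scalar_mx scalerA -scalemxAl.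
  by rewrite mxE eqxx mulr1n -rowE.
exists (L 0 0 * d`_0) => //.
by apply: contra_neq a0 => c0; rewrite aE' c0 scale0r.
Qed.

Lemma nearest_integer (x : R) : exists m : int, (m%:~R - x) ^+ 2 <= 4^-1.
Proof.
exists (Num.floor (x + 2^-1)).
have := floor_itv (x + 2^-1); rewrite intrD => /andP[].
set m := (_%:~R); move=> h1 h2.
have h : `|m - x| <= 2^-1 by rewrite ler_norml; apply/andP; split; lra.
rewrite -real_normK ?num_real//.
have -> : 4^-1 = 2^-1 ^+ 2 :> R by field.
by rewrite lerXn2r// nnegrE invr_ge0.
Qed.

(** Completing the square in the first variable leaves the Schur complement. *)
Lemma qform_schur n (t : R) (v : 'rV[R]_n) (W : 'M[R]_n) y x : t != 0 ->
  qform (block_mx t%:M v v^T W) (row_mx y%:M x) =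
  t * (y + (x *m v^T) 0 0 / t) ^+ 2 + qform (W - t^-1 *: (v^T *m v)) x.
Proof.
move=> t0; rewrite /qform mul_row_block tr_row_mx mul_row_col.
rewrite !mul_scalar_mx scale_scalar_mx !tr_scalar_mx mulmxDl.
rewrite !mul_mx_scalar scale_scalar_mx.
rewrite mulmxBr mulmxBl -!scalemxAr -!scalemxAl mulmxA -(mulmxA _ v).
have vx : v *m x^T = (x *m v^T)^T by rewrite trmx_mul trmxK.
rewrite mulmxDl -scalemxAl vx.
rewrite [x *m v^T]mx11_scalar; set s := (x *m v^T) 0 0.
rewrite tr_scalar_mx -scalar_mxM; set w := x *m W *m x^T.
rewrite !mxE !eqxx /= !mulr1n; field.
exact: t0.
Qed.

(** The constant depends on a bound [D] for the determinant and on a lower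
    bound [d] for the values at nonzero integer vectors, but not on the form.
    A nearly minimal vector [r] is taken as the first vector of a basis, and
    the Schur complement [S'] of [t = S(r)] is reduced by induction. The first
    coordinate of an integer vector can be moved to within 1/2 of any real
    number, so near minimality of [t] gives [t <= 2 (t / 4 + S'(x))], that is
    [t / 4 <= S'(x)], for every nonzero integer vector [x]; and [det S' = det
    S / t]. Lifting a basis reduced for [S'] adds at most [t / 4] to its
    values, and [t] is itself bounded because [t / 4] is at most a value of
    [S'] at a vector of the reduced basis. *)
Lemma hermite_reduction n : forall (D d : R), 0 < d -> exists C : R,
  forall S : 'M[R]_n, S^T = S ->
    (forall a : 'rV[R]_n, a != 0 -> 0 < qform S a) -> \det S <= D ->
    (forall a : 'rV[int]_n, a != 0 -> d <= qform S (intv a)) ->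
    exists2 g : 'M[int]_n, g \in unitmx &
      forall i, qform S (intv (row i g)) <= C.
Proof.
elim: n => [|n IH] D d d0.
  by exists 0 => S _ _ _ _; exists 1%:M; [exact: unitmx1|case].
have d4 : 0 < d / 4 by rewrite divr_gt0.
have [C CP] := IH (`|D| / d) (d / 4) d4.
(* The first vector has value t, at most |D| + 4 |C|; the lifted ones have
   value at most C + t / 4. *)
exists (`|D| + 5 * `|C|) => S Ssym Spos SD Sd.
have [a a0 amin] := nearly_minimal_vector (isT : (0 < n.+1)%N) d0 Sd.
have [G Gu [c c0 aE]] := row_of_unimodular a0.
pose r := row 0 G.
have rmin (b : 'rV[int]_n.+1) : b != 0 -> qform S (intv r) <= 2 * qform S (intv b).
  move=> b0; apply: le_trans (amin b b0).
  rewrite aE map_mxZ qformZ ler_peMl//.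
    by apply: le_trans (Sd _ (unit_row_neq0 _ Gu)); exact: ltW.
  rewrite -rmorphXn /= ler1z -[1]/(1 : int); have := c0.
  by rewrite -sqrf_eq0 => ?; rewrite -gtz0_ge1 lt0r sqr_ge0 andbT.
set GR := intv G.
pose S1 : 'M[R]_(1 + n) := GR *m S *m GR^T.
have S1sym : S1^T = S1 by rewrite /S1 !trmx_mul trmxK Ssym mulmxA.
have GRu : GR \in unitmx by rewrite unitmxE det_map_mx rmorph_unit// -unitmxE.
have detG : (\det GR) ^+ 2 = 1.
  rewrite det_map_mx -rmorphXn /=.
  by move: Gu; rewrite unitmxE => /orP[] /eqP ->.
have S1q b : qform S1 (intv b) = qform S (intv (b *m G)).
  by rewrite qform_conj map_mxM.
have bG (b : 'rV[int]_n.+1) : b != 0 -> b *m G != 0.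
  by apply: contra_neq => bG0; rewrite -[b](mulmxK Gu) bG0 mul0mx.
pose t := qform S (intv r).
have t_d : d <= t by apply: Sd; exact: unit_row_neq0.
have t0 : 0 < t by exact: lt_le_trans t_d.
pose v := ursubmx S1; pose W := drsubmx S1.
have S1E : S1 = block_mx t%:M v v^T W.
  rewrite -[LHS]submxK; congr block_mx.
    apply/matrixP => i j; rewrite !ord1 /t /r map_row qform_row 5!mxE eqxx.
    by rewrite mulr1n (_ : lshift n 0 = 0)//; exact/val_inj.
  by rewrite -{1}S1sym -trmx_ursub.
pose S' := W - t^-1 *: (v^T *m v).
pose s (x : 'rV[R]_n) := (x *m v^T) 0 0 / t.
have S'q y x : qform S1 (row_mx y%:M x) = t * (y + s x) ^+ 2 + qform S' x.
  by rewrite S1E qform_schur ?gt_eqF.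
have S'sym : S'^T = S'.
  rewrite /S' linearB /= linearZ /= trmx_mul trmxK.
  by rewrite trmx_drsub S1sym.
have S'pos x : x != 0 -> 0 < qform S' x.
  move=> x0; have := S'q (- s x) x; rewrite addNr expr0n /= mulr0 add0r => <-.
  rewrite qform_conj Spos//; apply: contra_neq x0 => e0.
  have : row_mx (- s x)%:M x = 0 by rewrite -[LHS](mulmxK GRu) e0 mul0mx.
  by move/(congr1 rsubmx); rewrite row_mxKr => ->; rewrite linear0.
have S'lb (x : 'rV[int]_n) : x != 0 -> t / 4 <= qform S' (intv x).
  move=> x0; have [y yP] := nearest_integer (- s (intv x)).
  have : row_mx y%:M x != 0.
    by apply: contra_neq x0 => /(congr1 rsubmx); rewrite row_mxKr => ->; rewrite linear0.
  move=> /bG /rmin; rewrite -S1q map_row_mx map_scalar_mx /= S'q.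
  move: yP; rewrite opprK => yP; rewrite -/t.
  have := ler_pM2l t0 ((y%:~R + s (intv x)) ^+ 2) 4^-1; rewrite yP; lra.
have detS' : \det S = t * \det S'.
  have -> : \det S = \det S1.
    by rewrite /S1 !det_mulmx det_tr mulrAC -expr2 detG mul1r.
  have -> : S1 = block_mx 1%:M 0 (t^-1 *: v^T) 1%:M *m block_mx t%:M v 0 S'.
    rewrite mulmx_block !mul1mx !mul0mx !addr0 S1E mul_mx_scalar scalerA.
    by rewrite divff ?gt_eqF// scale1r -scalemxAl /S' addrC subrK.
  by rewrite det_mulmx det_lblock det_ublock !det1 !mul1r det_scalar1.
have detS'le : \det S' <= `|D| / d.
  have -> : \det S' = \det S / t by rewrite detS' mulrC mulKf ?gt_eqF.
  have [dS|/ltW dS] := leP (\det S) 0.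
    apply: (@le_trans _ _ 0); last by rewrite divr_ge0 ?normr_ge0 ?ltW.
    by rewrite mulr_le0_ge0// invr_ge0 ltW.
  rewrite ler_pM ?invr_ge0 ?(ltW t0)//.
    by apply: le_trans SD _; exact: ler_norm.
  by rewrite lef_pV2.
have [|g gu gC] := CP S' S'sym S'pos detS'le.
  by move=> x x0; apply: le_trans (S'lb x x0); rewrite ler_pM2r ?invr_gt0.
have tle : t <= `|D| + 4 * `|C|.
  (* When n = 0 there is no vector to compare with, but then t is the
     determinant of S. *)
  have [n0|n0] := posnP n.
    have dS1 : \det S' = 1 by move: (S'); rewrite n0 => A; exact: det_mx00.
    rewrite dS1 mulr1 in detS'.
    rewrite -detS'; apply: le_trans SD _; apply: le_trans (ler_norm _) _.
    by rewrite lerDl mulr_ge0.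
  have := S'lb _ (unit_row_neq0 (Ordinal n0) gu); have := gC (Ordinal n0).
  have := ler_norm C; have := normr_ge0 D; lra.
pose y i := projT1 (cid (nearest_integer (- s (intv (row i g))))).
have yP i : ((y i)%:~R + s (intv (row i g))) ^+ 2 <= 4^-1.
  by rewrite /y; case: cid => /= m; rewrite opprK.
pose g1 : 'M[int]_(1 + n) := block_mx 1%:M 0 (\col_i y i) g.
exists (g1 *m G).
  rewrite unitmx_mul Gu andbT unitmxE.
  by rewrite (det_lblock (1%:M : 'M[int]_1)) det1 mul1r -unitmxE.
have g1u (j : 'I_1) : row (@lshift 1 n j) g1 = row_mx 1%:M 0.
  rewrite /g1 /block_mx rowKu row_row_mx linear0; congr row_mx.
  by apply/matrixP => a1 b1; rewrite !ord1 !mxE.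
have g1d (j : 'I_n) : row (@rshift 1 n j) g1 = row_mx (y j)%:M (row j g).
  rewrite /g1 /block_mx rowKd row_row_mx; congr row_mx.
  by apply/matrixP => a1 b1; rewrite !ord1 !mxE.
have C0 := normr_ge0 C.
move=> i; rewrite row_mul -S1q; case: (@split_ordP 1 n i) => j ->.
  rewrite g1u map_row_mx map_scalar_mx map_mx0 S'q /s mul0mx mxE mul0r.
  by rewrite addr0 expr1n mulr1 /qform !mul0mx mxE addr0; lra.
rewrite g1d map_row_mx map_scalar_mx S'q.
have := yP j; have := gC j; have := ler_norm C.
have := ler_pM2l t0 (((y j)%:~R + s (intv (row j g))) ^+ 2) 4^-1.
move=> <-; lra.
Qed.
End Reduction.

(** * Topology of complex matrices *)

Section MatrixTopology.

Lemma mx_continuous (X T : topologicalType) m n (f : X -> 'M[T]_(m, n)) :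
  (forall i j, continuous (fun x => f x i j)) -> continuous f.
Proof.
move=> fij x A [P Px PA].
have : \forall y \near x, forall i j, P i j (f y i j).
  apply: filter_forall => i; apply: filter_forall => j; exact: fij.
by apply: filterS => y; exact: PA.
Qed.

Lemma entry_continuous (T : topologicalType) m n i j :
  continuous (fun M : 'M[T]_(m, n) => M i j).
Proof.
move=> M A MA; exists (fun i' j' => if (i' == i) && (j' == j) then A else setT).
  move=> i' j'; case: ifP => [/andP[/eqP -> /eqP ->] //|_]; exact: filterT.
by move=> N /= /(_ i j); rewrite !eqxx.
Qed.

Lemma comp_ctns (X Y Z : topologicalType) (f : X -> Y) (h : Y -> Z) :
  continuous f -> continuous h -> continuous (fun x => h (f x)).
Proof. by move=> cf ch x; apply: (@continuous_comp _ _ _ f h); [exact: cf|exact: ch]. Qed.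

Lemma entry_ctns (X T : topologicalType) m n (f : X -> 'M[T]_(m, n)) i j :
  continuous f -> continuous (fun x => f x i j).
Proof. by move=> cf; exact: comp_ctns cf (@entry_continuous _ _ _ i j). Qed.

Variable K : numFieldType.

Lemma add_ctns (X : topologicalType) (f g : X -> K) :
  continuous f -> continuous g -> continuous (fun x => f x + g x).
Proof. by move=> cf cg x; apply: cvgD; [exact: cf|exact: cg]. Qed.

Lemma mul_ctns (X : topologicalType) (f g : X -> K) :
  continuous f -> continuous g -> continuous (fun x => f x * g x).
Proof. by move=> cf cg x; apply: cvgM; [exact: cf|exact: cg]. Qed.

Lemma sum_ctns (X : topologicalType) (I : Type) (r : seq I) (P : pred I)
    (F : I -> X -> K) : (forall i, P i -> continuous (F i)) ->
  continuous (fun x => \sum_(i <- r | P i) F i x).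
Proof.
apply: (@continuous_big _ _ +%R 0 P); exact: add_continuous.
Qed.

Lemma mulmx_ctns (X : topologicalType) m n p (f : X -> 'M[K]_(m, n))
    (g : X -> 'M[K]_(n, p)) :
  continuous f -> continuous g -> continuous (fun x => f x *m g x).
Proof.
move=> cf cg; apply: mx_continuous => i j.
have -> : (fun x => (f x *m g x) i j) = (fun x => \sum_k f x i k * g x k j).
  by apply: boolp.funext => x; rewrite mxE.
apply: sum_ctns => k _; apply: mul_ctns.
  exact: entry_ctns.
exact: entry_ctns.
Qed.

Lemma trmx_ctns (T : topologicalType) (X : topologicalType) m n (f : X -> 'M[T]_(m, n)) :
  continuous f -> continuous (fun x => (f x)^T).
Proof.
move=> cf; apply: mx_continuous => i j.
have -> : (fun x => (f x)^T i j) = (fun x => f x j i).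
  by apply: boolp.funext => x; rewrite mxE.
exact: entry_ctns.
Qed.

Lemma map_mx_ctns (T T' : topologicalType) (X : topologicalType) m n (h : T -> T')
    (f : X -> 'M[T]_(m, n)) : continuous h ->
  continuous f -> continuous (fun x => map_mx h (f x)).
Proof.
move=> ch cf; apply: mx_continuous => i j.
have -> : (fun x => (map_mx h (f x)) i j) = (fun x => h (f x i j)).
  by apply: boolp.funext => x; rewrite mxE.
by apply: comp_ctns ch; exact: entry_ctns.
Qed.

End MatrixTopology.

Section ComplexTopology.
Variable R : realType.
Local Notation C := (CC R).
Implicit Types z : C.

Definition creal (t : R) : C := t%:C%C.
HB.instance Definition _ := GRing.RMorphism.copy creal (real_complex R).
Definition rpart z : R := complex.Re z.
Definition ipart z : R := complex.Im z.

Lemma rpartD : {morph rpart : x y / x + y}. Proof. by move=> [a b] [c d]. Qed.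
Lemma ipartD : {morph ipart : x y / x + y}. Proof. by move=> [a b] [c d]. Qed.
Lemma rpartN : {morph rpart : x / - x}. Proof. by move=> [a b]. Qed.
Lemma ipartN : {morph ipart : x / - x}. Proof. by move=> [a b]. Qed.

Definition ci : C := 'i%C.

Lemma creal_parts z : z = creal (rpart z) + ci * creal (ipart z).
Proof. exact: complexE. Qed.

Lemma rpart_rect (a b : R) : rpart (creal a + ci * creal b) = a.
Proof. by rewrite /rpart /= mul0r mul1r subr0 addr0. Qed.

Lemma ipart_rect (a b : R) : ipart (creal a + ci * creal b) = b.
Proof. by rewrite /ipart /= mul0r mul1r !add0r. Qed.

Lemma conj_creal t : Num.conj (creal t) = creal t.
Proof. exact: conjc_real. Qed.

Lemma conj_ci : Num.conj ci = - ci.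
Proof. by rewrite /ci; apply/eqP; rewrite eq_complex /= oppr0 !eqxx. Qed.

Lemma ci_sqr : ci * ci = -1. Proof. by rewrite -expr2 sqr_i. Qed.

Lemma ci_neq0 : ci != 0.
Proof.
by apply/eqP => i0; have := ci_sqr; rewrite i0 mul0r => /eqP; rewrite eq_sym oppr_eq0 oner_eq0.
Qed.

Lemma creal_inj : injective creal. Proof. exact: complexI. Qed.

Lemma creal_le s t : (creal s <= creal t) = (s <= t). Proof. exact: lecR. Qed.
Lemma creal_lt s t : (creal s < creal t) = (s < t). Proof. exact: ltcR. Qed.

Lemma normc_creal (t : R) : `|creal t| = creal `|t|.
Proof.
rewrite /creal; rewrite normc_def /= expr0n /= addr0 sqrtr_sqr //.
Qed.

Lemma norm_rpart z : creal `|rpart z| <= `|z|.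
Proof.
rewrite normc_def creal_le -sqrtr_sqr ler_wsqrtr// lerDl sqr_ge0 //.
Qed.

Lemma norm_ipart z : creal `|ipart z| <= `|z|.
Proof.
rewrite normc_def creal_le -sqrtr_sqr ler_wsqrtr// lerDr sqr_ge0 //.
Qed.

Lemma norm_parts z : `|z| <= creal (`|rpart z| + `|ipart z|).
Proof.
rewrite {1}[z]creal_parts; apply: le_trans (ler_normD _ _) _.
rewrite normrM !normc_creal rmorphD lerD2l /=.
have -> : `|ci| = 1.
  by rewrite normc_def /= expr0n /= expr1n add0r sqrtr1.
by rewrite mul1r.
Qed.

Lemma posC_real (e : C) : 0 < e -> exists2 r : R, 0 < r & e = creal r.
Proof.
move=> e0; have er : e \is Num.real by rewrite realE ltW.
exists (rpart e); last by rewrite /creal (RRe_real er).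
by rewrite -creal_lt /creal (RRe_real er).
Qed.

Lemma creal_ctns : continuous creal.
Proof.
move=> t A /nbhs_ballP[e /= e0 eA]; have [r r0 er] := posC_real e0.
apply/nbhs_ballP; exists r => //= s sr; apply: eA.
rewrite /ball /= -rmorphB normc_creal er creal_lt; exact: sr.
Qed.

Lemma rpart_ctns : continuous rpart.
Proof.
move=> t A /nbhs_ballP[e /= e0 eA].
apply/nbhs_ballP; exists (creal e); first by rewrite /= creal_lt.
move=> s sr; apply: eA; rewrite /ball /= -rpartN -rpartD -creal_lt.
exact: le_lt_trans (norm_rpart _) sr.
Qed.

Lemma ipart_ctns : continuous ipart.
Proof.
move=> t A /nbhs_ballP[e /= e0 eA].
apply/nbhs_ballP; exists (creal e); first by rewrite /= creal_lt.
move=> s sr; apply: eA; rewrite /ball /= -ipartN -ipartD -creal_lt.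
exact: le_lt_trans (norm_ipart _) sr.
Qed.

Lemma conj_ctns : continuous (Num.conj : C -> C).
Proof.
move=> t A /nbhs_ballP[e /= e0 eA].
apply/nbhs_ballP; exists e => // s sr; apply: eA.
by rewrite /ball /= -rmorphB norm_conjC.
Qed.

Definition ctr m n (M : 'M[C]_(m, n)) := (map_mx Num.conj M)^T.

Lemma ctr_ctns (X : topologicalType) m n (f : X -> 'M[C]_(m, n)) :
  continuous f -> continuous (fun x => ctr (f x)).
Proof. by move=> cf; apply: trmx_ctns; apply: map_mx_ctns => //; exact: conj_ctns. Qed.

Definition mx_bounded m n (B : R) (M : 'M[C]_(m, n)) :=
  forall i j, `|M i j| <= creal B.

(** The complex numbers of modulus at most [B] lie in the image of a real
    square, so a product of compact segments maps onto a set of matrices that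
    contains the bounded ones. *)
Lemma mx_box_compact m n (B : R) :
  exists2 K : set 'M[C]_(m, n), compact K & forall M, mx_bounded B M -> K M.
Proof.
pose f (x : 'rV[R]_2) : C := creal (x 0 0) + ci * creal (x 0 1).
have cf : continuous f.
  have cc j : continuous (fun x : 'rV[R]_2 => creal (x 0 j)).
    by apply: comp_ctns creal_ctns; exact: entry_continuous.
  apply: add_ctns; first exact: cc; apply: mul_ctns; last exact: cc; exact: cst_continuous.
pose D := f @` [set v : 'rV[R]_2 | forall i, [set` `[- B, B]] (v ord0 i)].
have Dc : compact D.
  apply: continuous_compact; first exact: continuous_subspaceT.
  by apply: (@rV_compact _ _ (fun=> [set` `[- B, B]])) => i; exact: segment_compact.
pose g (x : 'rV[C]_(m * n)) : 'M[C]_(m, n) := vec_mx x.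
have cg : continuous g.
  apply: mx_continuous => i j.
  have -> : (fun x => g x i j) = (fun x => x 0 (mxvec_index i j)).
    by apply: boolp.funext => x; rewrite !mxE.
  exact: entry_continuous.
exists (g @` [set v : 'rV[C]_(m * n) | forall i, D (v ord0 i)]).
  apply: continuous_compact; first exact: continuous_subspaceT.
  exact: (@rV_compact _ _ (fun=> D)).
move=> M MB; exists (mxvec M); last by rewrite /g mxvecK.
move=> k; have [i j] := mxvec_indexP k; rewrite mxvecE.
exists (\row_l (if l == 0 then rpart (M i j) else ipart (M i j))).
  move=> l /=; rewrite mxE in_itv /= -ler_norml.
  case: ifP => _; rewrite -creal_le; apply: le_trans (MB i j).
    exact: norm_rpart.
  exact: norm_ipart.
by rewrite /f !mxE /= -creal_parts.
Qed.

Lemma compact_mx_bounded (X : topologicalType) (A : set X) m n (f : X -> 'M[C]_(m, n)) :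
  continuous f -> compact A -> exists B, forall x, A x -> mx_bounded B (f x).
Proof.
move=> cf cA.
have bnd (h : X -> R) : continuous h -> exists B, forall x, A x -> `|h x| <= B.
  move=> ch; have /compact_bounded : compact (h @` A).
    by apply: continuous_compact cA; exact: continuous_subspaceT.
  move=> [M [_ HM]]; exists (M + 1) => x Ax; apply: (HM (M + 1)).
    by rewrite ltrDl.
  by exists x.
have ce i j : continuous (fun x => f x i j).
  exact: entry_ctns.
have /choice[B BP] : forall ij : 'I_m * 'I_n, exists B, forall x, A x ->
    `|f x ij.1 ij.2| <= creal B.
  move=> [i j]; have [|B1 B1P] := bnd (fun x => rpart (f x i j)).
    exact: comp_ctns (ce i j) rpart_ctns.
  have [|B2 B2P] := bnd (fun x => ipart (f x i j)).
    exact: comp_ctns (ce i j) ipart_ctns.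
  exists (B1 + B2) => x Ax; apply: le_trans (norm_parts _) _.
  by rewrite creal_le lerD// ?B1P ?B2P.
exists (\sum_ij `|B ij|) => x Ax i j; apply: le_trans (BP (i, j) _ Ax) _.
rewrite creal_le (bigD1 (i, j)) //=; apply: le_trans (ler_norm _) _.
by rewrite lerDl sumr_ge0.
Qed.

Lemma mulmx_bounded m n p B1 B2 : exists B, forall (M : 'M[C]_(m, n)) (N : 'M[C]_(n, p)),
  mx_bounded B1 M -> mx_bounded B2 N -> mx_bounded B (M *m N).
Proof.
exists (n%:R * (`|B1| * `|B2|)) => M N M1 N2 i j; rewrite mxE.
apply: le_trans (ler_norm_sum _ _ _) _.
apply: (@le_trans _ _ (\sum_(k < n) creal (`|B1| * `|B2|))).
  apply: ler_sum => k _; rewrite normrM rmorphM ler_pM//.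
    by apply: le_trans (M1 i k) _; rewrite creal_le ler_norm.
  by apply: le_trans (N2 k j) _; rewrite creal_le ler_norm.
by rewrite sumr_const card_ord -rmorphMn /= mulr_natl.
Qed.

Lemma ctr_bounded m n B (M : 'M[C]_(m, n)) : mx_bounded B M -> mx_bounded B (ctr M).
Proof. by move=> MB i j; rewrite !mxE norm_conjC. Qed.

Lemma ex_mx_bounded m n (M : 'M[C]_(m, n)) : exists B, mx_bounded B M.
Proof.
have [B BP] := @compact_mx_bounded 'M[C]_(m, n) [set M] m n id (fun x => @cvg_id _ _) (@compact_set1 _ _).
by exists B; exact: BP.
Qed.

End ComplexTopology.

(** * The topological group of isometries of a matrix *)

Section UnitaryTopology.
Variables (R : realType) (n : nat) (J : 'M[CC R]_n).
Local Notation C := (CC R).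
Local Notation G := (unitary_group J).

Lemma isometryE X : isometry_group Num.conj J X -> X *m J *m ctr X = J.
Proof. by case. Qed.

Lemma mx_of_iso (g : G) : mx_of g *m J *m ctr (mx_of g) = J.
Proof. exact/isometryE/mx_ofP. Qed.

Lemma isometry_unit X : J \in unitmx -> X *m J *m ctr X = J ->
  isometry_group Num.conj J X.
Proof.
move=> Ju XJ; split => //; exists (J *m ctr X *m invmx J).
have e : X *m (J *m ctr X *m invmx J) = 1%:M by rewrite !mulmxA XJ mulmxV.
split=> //; exact: mulmx1C.
Qed.

Definition mk_unitary X (h : isometry_group Num.conj J X) : G :=
  exist _ X (mem_set h).

Lemma mk_unitaryE X (h : isometry_group Num.conj J X) : mx_of (mk_unitary h) = X.
Proof. by []. Qed.

Lemma mx_of_inv (g : G) : J \in unitmx ->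
  mx_of (g^-1)%g = J *m ctr (mx_of g) *m invmx J.
Proof.
move=> Ju; rewrite mx_ofV; apply: (can_inj (mulKmx (mx_of_unit g))).
by rewrite mulmxV ?mx_of_unit// !mulmxA mx_of_iso mulmxV.
Qed.

Lemma mx_of_ctns : continuous (@mx_of R n J).
Proof. exact: initial_continuous. Qed.

Lemma to_unitary_ctns (X : topologicalType) (f : X -> G) :
  continuous (fun x => mx_of (f x)) -> continuous f.
Proof. by move=> cf; apply: continuous_comp_initial. Qed.

Lemma unitary_compact (A : set G) : compact (@mx_of R n J @` A) -> compact A.
Proof.
move=> cA F PF FA.
have [|_ [[a Aa <-] cl]] := cA (@mx_of R n J @ F) _.
  exact: (filterS (@preimage_image _ _ (@mx_of R n J) A) FA).
exists a; split => // B U FB /= Ua.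
have [V [oV Va VU]] : exists V : set 'M[C]_n, [/\ open V, V (mx_of a) &
    @mx_of R n J @^-1` V `<=` U].
  move: Ua; rewrite nbhsE => -[U' [[V oV VU'] U'a] U'U]; exists V.
  by split=> //; [by move: U'a; rewrite -VU'|by rewrite VU'].
have [|_ [[b Bb <-] Vb]] := cl (@mx_of R n J @` B) V _ (open_nbhs_nbhs (conj oV Va)).
  exact: (filterS (@preimage_image _ _ (@mx_of R n J) B) FB).
by exists b; split=> //; exact: VU.
Qed.

Lemma closed_isometry_eq : closed [set X : 'M[C]_n | X *m J *m ctr X = J].
Proof.
have -> : [set X : 'M[C]_n | X *m J *m ctr X = J] =
    \bigcap_(ij in [set: 'I_n * 'I_n]) [set X | (X *m J *m ctr X) ij.1 ij.2 = J ij.1 ij.2].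
  apply/seteqP; split => [X /= XJ ij _|X XJ]; first by rewrite /= XJ.
  by apply/matrixP => i j; exact: (XJ (i, j)).
apply: closed_bigI => -[i j] _ /=.
have cc : continuous (fun X : 'M[C]_n => (X *m J *m ctr X) i j).
  apply: entry_ctns; apply: mulmx_ctns.
    by apply: mulmx_ctns; [move=> x; exact: cvg_id|exact: cst_continuous].
  by apply: ctr_ctns => x; exact: cvg_id.
have := @closed_comp _ _ _ [set J i j] (fun X _ => cc X); apply.
exact/accessible_closed_set1/hausdorff_accessible/norm_hausdorff.
Qed.

(** As [J] is invertible, the closed condition [X *m J *m ctr X = J] implies
    that [X] is invertible, so the group is closed in the space of matrices. *)
Lemma bounded_unitary_compact B : J \in unitmx ->
  exists2 K : set G, compact K & forall g, mx_bounded B (mx_of g) -> K g.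
Proof.
move=> Ju; have [K0 cK0 K0P] := mx_box_compact (R := R) n n B.
exists (@mx_of R n J @^-1` K0); last by move=> g /K0P.
apply: unitary_compact.
have -> : @mx_of R n J @` (@mx_of R n J @^-1` K0) =
    K0 `&` [set X : 'M[C]_n | X *m J *m ctr X = J].
  apply/seteqP; split => [_ [x Kx <-]|X [KX XJ]]; first by split=> //; exact: mx_of_iso.
  by exists (mk_unitary (isometry_unit Ju XJ)).
exact: compact_closedI cK0 closed_isometry_eq.
Qed.

Lemma unitary_mul_ctns (X : topologicalType) (f g : X -> G) :
  continuous f -> continuous g -> continuous (fun x => (f x * g x)%g).
Proof.
move=> cf cg; apply: to_unitary_ctns.
under [X in continuous X]boolp.eq_fun do rewrite mx_ofM.
by apply: mulmx_ctns; apply: comp_ctns mx_of_ctns.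
Qed.

Lemma unitary_inv_ctns (X : topologicalType) (f : X -> G) : J \in unitmx ->
  continuous f -> continuous (fun x => (f x)^-1%g).
Proof.
move=> Ju cf; apply: to_unitary_ctns.
under [X in continuous X]boolp.eq_fun do rewrite mx_of_inv//.
apply: mulmx_ctns; last exact: cst_continuous.
apply: mulmx_ctns; first exact: cst_continuous.
by apply: ctr_ctns; apply: comp_ctns mx_of_ctns.
Qed.

Lemma rational_approx (z : C) (e : R) : 0 < e ->
  exists q : rat * rat, `|z - (creal (ratr q.1) + ci R * creal (ratr q.2))| < creal e.
Proof.
move=> e0.
have ap (x : R) : exists q : rat, `|x - ratr q| < e / 2.
  have [q qP] := @rat_in_itvoo _ (x - e / 2) (x + e / 2) ltac:(lra).
  exists q; move: qP; rewrite in_itv /= ltr_norml => /andP[? ?].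
  by apply/andP; split; lra.
have [q1 h1] := ap (rpart z); have [q2 h2] := ap (ipart z).
exists (q1, q2); apply: le_lt_trans (norm_parts _) _ => /=.
rewrite rpartD rpartN rpart_rect ipartD ipartN ipart_rect creal_lt; lra.
Qed.

(** The sequence is indexed by pairs of a matrix of Gaussian rationals and a
    precision; it picks an element of the group that is this close to the
    matrix, if there is one. The rational matrices themselves need not lie in
    the group. *)
Lemma unitary_separable : exists s : nat -> G, forall g (U : set G),
  open U -> U g -> exists k, U (s k).
Proof.
pose near_to (c : 'M[rat * rat]_n * nat) (h : G) := forall i j,
  `|mx_of h i j - (creal (ratr (c.1 i j).1) + ci R * creal (ratr (c.1 i j).2))|
  < creal (c.2.+1%:R)^-1.
pose s m : G := if unpickle m is Some c then xget 1%g (near_to c) else 1%g.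
exists s => g U.
move=> [V oV VU] Ug.
have : nbhs (mx_of g) V.
  by apply: open_nbhs_nbhs; split=> //; move: Ug; rewrite -VU.
move=> /nbhs_ballP[e /= /posC_real[r r0 ->] eV].
have [k kP] : exists k : nat, 2 * (k.+1%:R)^-1 < r.
  exists (Num.bound (2 / r)); rewrite ltr_pdivrMr// -ltr_pdivrMl// mulrC.
  apply: lt_trans (archi_boundP _) _; first by rewrite divr_ge0 ?ltW.
  by rewrite ltr_nat.
have k0 : (0 : R) < (k.+1%:R)^-1 by rewrite invr_gt0.
have /choice[q qP] : forall ij : 'I_n * 'I_n, exists q : rat * rat,
   `|mx_of g ij.1 ij.2 - (creal (ratr q.1) + ci R * creal (ratr q.2))| < creal (k.+1%:R)^-1.
  by move=> ij; exact: rational_approx.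
pose c : 'M[rat * rat]_n * nat := (\matrix_(i, j) q (i, j), k).
have gc : near_to c g by move=> i j; rewrite /= mxE; exact: (qP (i, j)).
exists (pickle c); rewrite /s pickleK -VU /=; apply: eV.
have := @xgetPex _ 1%g _ (ex_intro _ g gc); set h := xget _ _ => hc.
split; first by rewrite creal_lt.
move=> i j; rewrite /ball /=; apply: (@lt_trans _ _ (creal (2 * (k.+1%:R)^-1))); last by rewrite creal_lt.
rewrite mulr2n mulrDl mul1r rmorphD /=.
set w := creal (ratr (c.1 i j).1) + ci R * creal (ratr (c.1 i j).2).
have -> : mx_of g i j - set_val h i j = (mx_of g i j - w) + - (mx_of h i j - w).
  by rewrite opprB addrA subrK.
apply: le_lt_trans (ler_normD _ _) _; by rewrite normrN ltrD.
Qed.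

End UnitaryTopology.

(** * Poincare recurrence on a quotient of finite volume *)

Section Recurrence.
Local Open Scope group_scope.
Variables (R : realType) (n : nat) (H : 'M[CC R]_n).
Hypothesis Hu : H \in unitmx.
Local Notation G := (unitary_group H).
Variable Gamma : groupClosed G.
Local Notation X := (homogeneous_space Gamma).
Local Notation pi := (fun g : G => (\pi_X g)%qT : X).

Lemma pi_eqP (x y : G) : reflect (pi x = pi y) (x^-1 * y \in Gamma).
Proof. exact: (@eqmodP _ (coset_equiv Gamma) x y). Qed.

Lemma left_translationE (g x : G) : left_translation g (pi x) = pi (g * x) :> X.
Proof.
apply/esym/pi_eqP; rewrite invgM mulgA mulgVK.
by apply/pi_eqP; rewrite /= reprK.
Qed.

Lemma pi_open (V : set G) : open V -> open (pi @` V : set X).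
Proof.
move=> oV; rewrite /open /= /quotient_open.
have -> : pi @^-1` (pi @` V) = \bigcup_(c in [set c | c \in Gamma])
    (fun g => g * c^-1) @^-1` V.
  apply/seteqP; split => [g [v Vv /pi_eqP vg]|g [c /= cG Vgc]].
    by exists (v^-1 * g) => //=; rewrite invgM invgK mulVKg.
  by exists (g * c^-1) => //; apply/pi_eqP; rewrite invgM invgK mulgVK.
apply: bigcup_open => c _; apply: open_comp oV => x _.
have := @unitary_mul_ctns R n H G id (fun=> c^-1) (fun x => @cvg_id _ _).
by apply; exact: cst_continuous.
Qed.

(** The images in the quotient of the translates of [V] by the powers of [a ^+
    M.+1] have the same measure. It is positive, because countably many
    translates of [V] cover the group. The total measure is finite, so two of
    these images meet. Taking powers of [a ^+ M.+1] makes the difference of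
    the exponents at least [M]. *)
Lemma recurrence (V : set G) (a : G) (M : nat) : has_finite_invariant_measure Gamma ->
  open V -> V 1 -> exists k v v' c,
    [/\ (M <= k)%N, V v, V v', c \in Gamma & v * c = a ^+ k * v'].
Proof.
move=> [mu [mu0 mufin muinv]] oV V1.
pose A : set (borel_homogeneous_space Gamma) := pi @` V.
have mA : measurable A by apply: sub_sigma_algebra; exact: pi_open.
pose T (g : G) : set (borel_homogeneous_space Gamma) := pi @` [set g * v | v in V].
have TE g : T g = left_translation g^-1 @^-1` A.
  apply/seteqP; split => [_ [_ [v Vv <-] <-]|q].
    by rewrite /preimage /= left_translationE mulKg; exists v.
  rewrite /preimage /= -[q]reprK left_translationE => -[v Vv vq].
  exists (g * v); first by exists v.
  apply/pi_eqP; move/pi_eqP: vq; rewrite invgM !mulgA //.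
have mT g : measurable (T g).
  apply: sub_sigma_algebra; apply: pi_open.
  have -> : [set g * v | v in V] = (fun x => g^-1 * x) @^-1` V.
    apply/seteqP; split => [_ [v Vv <-]|x Vx]; first by rewrite /= mulKg.
    by exists (g^-1 * x) => //; rewrite mulVKg.
  apply: open_comp oV => x _.
  have := @unitary_mul_ctns R n H G (fun=> g^-1) id.
  by apply; [exact: cst_continuous|move=> ?; exact: cvg_id].
have muT g : mu (T g) = mu A by rewrite TE muinv.
have muA : mu A != 0%E.
  apply: contra_neq mu0 => muA0.
  have [s sP] := unitary_separable H.
  apply/eqP; rewrite eq_le measure_ge0 andbT.
  apply: (@le_trans _ _ (\sum_(k <oo) mu (T (s k)))%E).
    apply: measure_sigma_subadditive => //.
    move=> q _; rewrite -[q]reprK; set g := repr q.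
    have [||k kP] := sP g [set h | V (h^-1 * g)].
    - apply: open_comp oV => x _.
      have := @unitary_mul_ctns R n H G (fun x => x^-1) (fun=> g).
      apply; last exact: cst_continuous.
      by apply: unitary_inv_ctns => // ?; exact: cvg_id.
    - by rewrite /= mulVg.
    exists k => //; exists g => //; exists ((s k)^-1 * g) => //.
    by rewrite mulVKg.
  by rewrite eseries0// => i _ _; rewrite muT.
pose B k := T (a ^+ (M.+1 * k)).
have [tB|] := pselect (trivIset setT B).
  exfalso.
  have lemu S : measurable S -> (mu S <= mu setT)%E by move=> mS; apply: le_measure; rewrite ?inE.
  have fin S : measurable S -> mu S \is a fin_num.
    by move=> mS; rewrite ge0_fin_numE//; exact: le_lt_trans (lemu _ mS) mufin.
  have le_mu N : (fine (mu A) *+ N <= fine (mu setT))%R.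
    rewrite -lee_fin fineK ?fin//.
    have -> : ((fine (mu A) *+ N)%:E = mu (\big[setU/set0]_(i < N) B i))%E.
      rewrite measure_bigsetU//; last by move=> k; exact: mT.
      rewrite (eq_bigr (fun=> (fine (mu A))%:E)) => [|k _].
        by rewrite sumEFin sumr_const card_ord.
      by rewrite fineK ?fin//; exact: muT.
    by apply: lemu; apply: bigsetU_measurable => k _; exact: mT.
  have c0 : (0 < fine (mu A))%R.
    by rewrite fine_gt0// lt0e muA measure_ge0 /= -ge0_fin_numE ?fin.
  have := le_mu (Num.bound (fine (mu setT) / fine (mu A))).
  rewrite leNgt => /negP; apply.
  rewrite -mulr_natr -ltr_pdivrMl// mulrC archi_boundP//.
move=> /existsNP[i /existsNP[j /not_implyP[_ /not_implyP[_ /not_implyP[[q [Bi Bj]] ij]]]]].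
wlog ltij : i j ij Bi Bj / (i < j)%N.
  move=> W; have [ltij|ltji|/esym//] := ltngtP i j; first exact: (W i j).
  by apply: (W j i) => // /esym.
have [_ [v Vv <-] vq] := Bi; have [_ [v' Vv' <-] v'q] := Bj.
exists (M.+1 * j - M.+1 * i)%N, v, v', (v^-1 * (a ^+ (M.+1 * j - M.+1 * i) * v')).
have lem : (M.+1 * i <= M.+1 * j)%N by rewrite leq_mul2l ltnW ?orbT.
split => //; last by rewrite mulVKg.
- by rewrite -mulnBr (leq_trans (leqnSn M))// leq_pmulr// subn_gt0.
have /pi_eqP : pi (a ^+ (M.+1 * i) * v) = pi (a ^+ (M.+1 * j) * v') by rewrite v'q.
have -> : a ^+ (M.+1 * j) = a ^+ (M.+1 * i) * a ^+ (M.+1 * j - M.+1 * i).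
  by rewrite -expgnDr subnKC.
by rewrite invgM -!mulgA mulKg.
Qed.

End Recurrence.

(** * Boosts and isotropic vectors of a ternary hermitian form *)

Lemma sub_two_halves (K : numFieldType) (c s : K) :
  - (c / 2) + s * c + - (c / 2) = (s - 1) * c.
Proof. by field. Qed.

Lemma add_sub_eq0 (K : numFieldType) (x y : K) : x + y = 0 -> x - y = 0 -> x = 0 /\ y = 0.
Proof.
move=> h1 h2; have y0 : y = 0.
  have : (x + y) - (x - y) = 0 by rewrite h1 h2 subr0.
  have -> : x + y - (x - y) = y *+ 2 by ring.
  by move=> /eqP; rewrite mulrn_eq0 => /eqP.
by split=> //; rewrite -h1 y0 addr0.
Qed.

Section Hyperbolic.
Variables (R : realType) (J : 'M[CC R]_3).
Local Notation C := (CC R).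
Hypotheses (Jsym : ctr J = J) (Ju : J \in unitmx).

Lemma ctrM m n p (A : 'M[C]_(m, n)) (B : 'M[C]_(n, p)) : ctr (A *m B) = ctr B *m ctr A.
Proof. by rewrite /ctr map_mxM trmx_mul. Qed.

Lemma ctrE m n (A : 'M[C]_(m, n)) i j : ctr A i j = Num.conj (A j i).
Proof. by rewrite !mxE. Qed.

Lemma ctrK m n (A : 'M[C]_(m, n)) : ctr (ctr A) = A.
Proof. by apply/matrixP => i j; rewrite !mxE conjCK. Qed.

Lemma ctrD m n (A B : 'M[C]_(m, n)) : ctr (A + B) = ctr A + ctr B.
Proof. by rewrite /ctr map_mxD linearD. Qed.

Lemma ctrN m n (A : 'M[C]_(m, n)) : ctr (- A) = - ctr A.
Proof. by rewrite /ctr map_mxN linearN. Qed.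

Lemma ctrZ m n c (A : 'M[C]_(m, n)) : ctr (c *: A) = Num.conj c *: ctr A.
Proof. by rewrite /ctr map_mxZ linearZ. Qed.

Lemma ctr1 n : ctr (1%:M : 'M[C]_n) = 1%:M.
Proof. by rewrite /ctr map_mx1 trmx1. Qed.

Lemma ctr_unit n (A : 'M[C]_n) : (ctr A \in unitmx) = (A \in unitmx).
Proof. by rewrite /ctr unitmx_tr map_unitmx. Qed.

Definition hform (u v : 'rV[C]_3) : C := (u *m J *m ctr v) 0 0.

Lemma hformE u v : u *m J *m ctr v = (hform u v)%:M.
Proof. exact: mx11_scalar. Qed.

Lemma hform_conj u v : Num.conj (hform u v) = hform v u.
Proof.
have : ctr (u *m J *m ctr v) = v *m J *m ctr u by rewrite !ctrM ctrK Jsym mulmxA.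
by move/matrixP/(_ 0 0); rewrite ctrE.
Qed.

Lemma hformDl u1 u2 v : hform (u1 + u2) v = hform u1 v + hform u2 v.
Proof. by rewrite /hform !mulmxDl mxE. Qed.

Lemma hformZl c u v : hform (c *: u) v = c * hform u v.
Proof. by rewrite /hform -!scalemxAl mxE. Qed.

Lemma hformDr u v1 v2 : hform u (v1 + v2) = hform u v1 + hform u v2.
Proof. by rewrite /hform ctrD !mulmxDr mxE. Qed.

Lemma hformZr c u v : hform u (c *: v) = Num.conj c * hform u v.
Proof. by rewrite /hform ctrZ -!scalemxAr mxE. Qed.

Lemma hform_real u : hform u u \is Num.real.
Proof. by rewrite CrealE hform_conj. Qed.

Section Boost.
Variables P Q : 'M[C]_3.
Hypotheses (PP : P *m P = P) (QQ : Q *m Q = Q) (PQ : P *m Q = 0) (QP : Q *m P = 0).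
Hypotheses (PJ : J *m ctr P = Q *m J) (QJ : J *m ctr Q = P *m J).

(** Multiplication by 2 on the image of [P], by 1/2 on that of [Q], and by 1
    on the complement. As the adjunction of [J] exchanges [P] and [Q], it
    carries this matrix to its inverse. *)
Definition boost : 'M[C]_3 := 1%:M + P - 2^-1 *: Q.

(** With [s = 2 ^- k] this is the [k]-th power of the boost divided by [2 ^+
    k]; it is a polynomial in [s] that takes the value [P] at 0. *)
Definition boost_at (s : C) : 'M[C]_3 := P + s *: (1%:M - P - Q) + s ^+ 2 *: Q.

Lemma boost_isometry : isometry_group Num.conj J boost.
Proof.
apply: isometry_unit Ju _; rewrite -mulmxA /boost 2!ctrD ctrN ctrZ ctr1.
have -> : (Num.conj (2^-1 : C)) = 2^-1 by rewrite fmorphV rmorph_nat.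
have -> : J *m (1%:M + ctr P - 2^-1 *: ctr Q) = (1%:M + Q - 2^-1 *: P) *m J.
  rewrite !mulmxDr mulmx1 mulmxN -scalemxAr PJ QJ.
  by rewrite !mulmxDl mul1mx mulNmx -scalemxAl.
rewrite mulmxA.
suff -> : (1%:M + P - 2^-1 *: Q) *m (1%:M + Q - 2^-1 *: P) = 1%:M by rewrite mul1mx.
rewrite !(mulmxDl, mulmxDr) !(mulNmx, mulmxN) !mulmx1 !mul1mx.
rewrite -!scalemxAl -!scalemxAr PP QQ PQ QP !scaler0.
apply/matrixP => i j; rewrite !mxE; by field.
Qed.

Lemma boost_pow k : boost ^+ k = (2 ^+ k) *: boost_at ((2 ^+ k)^-1).
Proof.
have two0 m : (2 ^+ m : C) != 0 by rewrite expf_neq0// pnatr_eq0.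
elim: k => [|k IH].
  rewrite expr0 invr1 /boost_at expr1n !scale1r; apply/matrixP => i j.
  by rewrite !mxE; ring.
rewrite exprS IH /boost_at -[LHS]/(boost *m (_ *: _)) -scalemxAr.
set s := (2 ^+ k)^-1.
have -> : (2 ^+ k.+1)^-1 = 2^-1 * s by rewrite exprS invfM.
rewrite /boost !(mulmxDl, mulmxDr, mulNmx, mulmxN, mulmx1, mul1mx).
rewrite -!scalemxAl -!scalemxAr !(mulmxDl, mulmxDr, mulNmx, mulmxN, mulmx1, mul1mx).
rewrite PP QQ PQ QP.
rewrite (exprSr 2 k) -(scalerA (2 ^+ k) 2); congr (_ *: _); move: s => s.
rewrite !subr0 !subrr !scaler0 oppr0 !addr0 add0r 2!(scalerDr 2) !scalerA.
have -> : 2 * (2^-1 * s) = s by rewrite mulVKf// (two0 1%N).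
have -> : 2 * (2^-1 * s) ^+ 2 = s ^+ 2 - 2^-1 * s ^+ 2 by field.
rewrite scaler_nat mulr2n scalerBl -!addrA; congr (_ + _).
by rewrite [RHS]addrCA; congr (_ + _); rewrite addrCA.
Qed.

End Boost.

(** The projection onto the line of [v] along the orthogonal of [u]. *)
Definition boost_dir (u v : 'rV[C]_3) : 'M[C]_3 := (hform v u)^-1 *: (J *m ctr u *m v).

Lemma rank1_mul (a b c d : 'rV[C]_3) :
  (J *m ctr a *m b) *m (J *m ctr c *m d) = hform b c *: (J *m ctr a *m d).
Proof.
have -> : (J *m ctr a *m b) *m (J *m ctr c *m d) =
   J *m ctr a *m (b *m J *m ctr c) *m d by rewrite !mulmxA.
by rewrite hformE mul_mx_scalar -scalemxAl.
Qed.

Lemma boost_dir_mul (a b c d : 'rV[C]_3) : boost_dir a b *m boost_dir c d =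
  ((hform d c)^-1 * (hform b a)^-1 * hform b c) *: (J *m ctr a *m d).
Proof. by rewrite /boost_dir -scalemxAr -scalemxAl rank1_mul !scalerA. Qed.

Lemma boost_dir_idem a b : hform b a != 0 -> boost_dir a b *m boost_dir a b = boost_dir a b.
Proof. by move=> ba0; rewrite boost_dir_mul mulfVK. Qed.

Lemma boost_dir_ctr a b : J *m ctr (boost_dir a b) = boost_dir b a *m J.
Proof.
rewrite /boost_dir ctrZ !ctrM Jsym ctrK -scalemxAr fmorphV /= hform_conj.
by rewrite -!scalemxAl !mulmxA.
Qed.


Lemma hform0l v : hform 0 v = 0. Proof. by rewrite /hform !mul0mx mxE. Qed.

Lemma hform_nondeg v : v != 0 -> exists u, hform v u != 0.
Proof.
move=> v0; apply: contrapT => nu; move: v0; apply/negP; rewrite negbK.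
have vJ : v *m J = 0.
  apply/rowP => j; rewrite [RHS]mxE; apply/eqP; apply/negP => /negP vj.
  apply: nu; exists (delta_mx 0 j); apply: contra_neq vj => <-.
  rewrite /hform.
  have -> : ctr (delta_mx 0 j : 'rV[C]_3) = delta_mx j 0.
    by apply/matrixP => a b; rewrite !mxE conjC_nat andbC.
  by rewrite -colE [RHS]mxE.
by rewrite -[v](mulmxK Ju) vJ mul0mx.
Qed.

Definition o0 : 'I_3 := ord0.
Definition o1 : 'I_3 := lift ord0 ord0.
Definition o2 : 'I_3 := lift ord0 (lift ord0 ord0).

Lemma ord3P (i : 'I_3) : [\/ i = o0, i = o1 | i = o2].
Proof.
case: i => -[|[|[|//]]] ilt; [constructor 1|constructor 2|constructor 3]; exact/val_inj.
Qed.

(** An isotropic [v] spans a hyperbolic plane with another isotropic vector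
    [f], and [d] spans the orthogonal of this plane. The last clause expresses
    that [v], [d], [f] form a basis: a matrix whose nine pairings vanish is
    zero. *)
Lemma hyperbolic_basis v : v != 0 -> hform v v = 0 -> exists d f,
  [/\ hform f f = 0, hform f v = 1 &
    [/\ hform d v = 0, hform d f = 0, hform d d != 0 &
      forall M : 'M[C]_3, let m (x y : 'rV[C]_3) := (x *m M *m ctr y) 0 0 in
         [/\ m v v = 0, m v d = 0 & m v f = 0] ->
         [/\ m d v = 0, m d d = 0 & m d f = 0] ->
         [/\ m f v = 0, m f d = 0 & m f f = 0] -> M = 0]].
Proof.
move=> v0 vv; have [u vu] := hform_nondeg v0.
have [f0 f0v] : exists f0, hform v f0 = 1.
  exists ((Num.conj (hform v u))^-1 *: u).
  by rewrite hformZr fmorphV /= conjCK mulVf.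
have f0v' : hform f0 v = 1 by rewrite -hform_conj f0v conjC1.
pose f := f0 - (hform f0 f0 / 2) *: v.
have fv : hform f v = 1.
  by rewrite /f hformDl -scaleNr hformZl vv mulr0 addr0.
have vf : hform v f = 1 by rewrite -hform_conj fv conjC1.
have ff : hform f f = 0.
  rewrite {1}/f hformDl -scaleNr hformZl vf mulr1 /f hformDr -scaleNr hformZr f0v'.
  have /CrealP r2 : hform f0 f0 / 2 \is Num.real by rewrite rpredM ?hform_real ?rpredV ?rpred_nat.
  rewrite mulr1 rmorphN /= r2 -addrA -opprD -mulrDl -mulr2n.
  by rewrite -[_ *+ 2]mulr_natr mulfK ?subrr ?pnatr_eq0.
pose A := row_mx (J *m ctr v) (J *m ctr f).
have [|d dA d0] := left_null_vector (A := A); first exact: leq_ltn_trans (rank_leq_col A) _.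
have [dv df] : hform d v = 0 /\ hform d f = 0.
  move: dA; rewrite mul_mx_row => dA; split.
    by have := congr1 lsubmx dA; rewrite row_mxKl linear0 mulmxA /hform => ->; rewrite mxE.
  by have := congr1 rsubmx dA; rewrite row_mxKr linear0 mulmxA /hform => ->; rewrite mxE.
pose P : 'M[C]_3 := \matrix_(i < 3) [tuple v; d; f]`_i.
have rP i : row i P = [tuple v; d; f]`_i by rewrite rowK.
have Pu : P \in unitmx.
  rewrite -row_free_unit -kermx_eq0; apply/rowV0P => x /sub_kermxP xP.
  have xE : x 0 o0 *: v + x 0 o1 *: d + x 0 o2 *: f = 0.
    by rewrite -xP mulmx_sum_row 3!big_ord_recl big_ord0 addr0 !rP /= addrA.
  have x0 : x 0 o0 = 0.
    have := congr1 (hform^~ f) xE.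
    by rewrite hform0l !hformDl !hformZl vf df ff !mulr0 !addr0 mulr1.
  have x2 : x 0 o2 = 0.
    have := congr1 (hform^~ v) xE.
    by rewrite hform0l !hformDl !hformZl vv dv fv !mulr0 !add0r mulr1.
  move: xE; rewrite x0 x2 !scale0r add0r addr0 => /eqP.
  rewrite scaler_eq0 (negPf d0) orbF => /eqP x1.
  by apply/rowP => i; rewrite [RHS]mxE; have [->|->|->] := ord3P i.
have cPu : ctr P \in unitmx by rewrite ctr_unit.
have full (M : 'M[C]_3) : let m (x y : 'rV[C]_3) := (x *m M *m ctr y) 0 0 in
         [/\ m v v = 0, m v d = 0 & m v f = 0] ->
         [/\ m d v = 0, m d d = 0 & m d f = 0] ->
         [/\ m f v = 0, m f d = 0 & m f f = 0] -> M = 0.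
  move=> m [m1 m2 m3] [m4 m5 m6] [m7 m8 m9]; have : P *m M *m ctr P = 0.
    apply/matrixP => i j.
    have e0 : (row i P *m M *m ctr (row j P)) 0 0 = 0.
      rewrite -/(m _ _) !rP.
      have [->|->|->] := ord3P i; have [->|->|->] := ord3P j.
      - exact: m1.
      - exact: m2.
      - exact: m3.
      - exact: m4.
      - exact: m5.
      - exact: m6.
      - exact: m7.
      - exact: m8.
      - exact: m9.
    rewrite [RHS]mxE -[RHS]e0 -row_mul.
    have -> : ctr (row j P) = col j (ctr P) by apply/matrixP => a b; rewrite !mxE.
    rewrite mxE [RHS]mxE; apply: eq_bigr => k _.
    by rewrite [row _ _ _ _]mxE [col _ _ _ _]mxE.
  move=> e0; apply: (can_inj (mulKmx Pu)); apply: (can_inj (mulmxK cPu)).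
  by rewrite e0 mulmx0 mul0mx.
exists d, f; split; [exact: ff|exact: fv|].
split; [exact: dv|exact: df| |exact: full].
apply: contra_neq d0 => dd.
have vd : hform v d = 0 by rewrite -hform_conj dv conjC0.
have fd : hform f d = 0 by rewrite -hform_conj df conjC0.
have : P *m (J *m ctr d) = 0.
  apply/matrixP => i j; rewrite ord1 [RHS]mxE.
  have -> : (P *m (J *m ctr d)) i 0 = hform (row i P) d.
    by rewrite /hform -mulmxA -row_mul [RHS]mxE.
  by rewrite rP; have [->|->|->] /= := ord3P i; [exact: vd|exact: dd|exact: fd].
move=> e0; rewrite -[d]ctrK -[ctr d](mulKmx Ju) -[J *m ctr d](mulKmx Pu) e0.
by rewrite !mulmx0 /ctr map_mx0 trmx0.
Qed.

(** Put [c = h(d, d)]. Besides [v] and [f], the vectors [w(s) = - (c / 2) v +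
    s d + f] with [|s| = 1] are isotropic. They are not orthogonal to [v] nor
    to [f], and [w(1)] is not orthogonal to [w(-1)]. Comparing [s = 1] with [s
    = -1] isolates the entries of [M] in the basis [v], [d], [f]. Only pairs
    that are not orthogonal are used, because these are the pairs that define
    a boost. *)
Lemma isotropic_pairs_separate (M : 'M[C]_3) v : v != 0 -> hform v v = 0 ->
  (forall x y, hform x x = 0 -> hform y y = 0 -> hform x y != 0 ->
     (x *m M *m ctr y) 0 0 = 0) -> M = 0.
Proof.
move=> v0 vv MP; have [d [f [ff fe [de df dd full]]]] := hyperbolic_basis v0 vv.
move: v v0 vv fe de full => e e0 ee fe de full.
have ef : hform e f = 1 by rewrite -hform_conj fe conjC1.
have ed : hform e d = 0 by rewrite -hform_conj de conjC0.
have fd : hform f d = 0 by rewrite -hform_conj df conjC0.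
set c := hform d d in dd.
have cr : Num.conj c = c by apply/CrealP; exact: hform_real.
pose m (x y : 'rV[C]_3) := (x *m M *m ctr y) 0 0.
have mD x y z : m (x + y) z = m x z + m y z by rewrite /m !mulmxDl mxE.
have mZ a x z : m (a *: x) z = a * m x z by rewrite /m -!scalemxAl mxE.
have mDr x y z : m x (y + z) = m x y + m x z by rewrite /m ctrD !mulmxDr mxE.
have mZr a x z : m x (a *: z) = Num.conj a * m x z by rewrite /m ctrZ -!scalemxAr mxE.
pose w (s : C) := (- (c / 2)) *: e + s *: d + f.
have c2r : Num.conj (- (c / 2)) = - (c / 2).
  by rewrite rmorphN rmorphM fmorphV rmorph_nat /= cr.
have hw s t : hform (w s) (w t) = (s * Num.conj t - 1) * c.
  rewrite /w !(hformDl, hformDr, hformZl, hformZr) ee ff fe ef de df ed fd.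
  by rewrite c2r -/c !(mulr0, mulr1, add0r, addr0) mulrA sub_two_halves.
have hfw s : hform f (w s) = - (c / 2).
  by rewrite /w !(hformDr, hformZr) ff fe fd c2r mulr1 mulr0 !addr0.
have hwf s : hform (w s) f = - (c / 2) by rewrite -hform_conj hfw c2r.
have hew s : hform e (w s) = 1.
  by rewrite /w !(hformDr, hformZr) ee ef ed !mulr0 !add0r.
have hwe s : hform (w s) e = 1 by rewrite -hform_conj hew conjC1.
have c2 : - (c / 2) != 0 by rewrite oppr_eq0 mulf_neq0// invr_neq0 ?pnatr_eq0.
have iso s : s * Num.conj s = 1 -> hform (w s) (w s) = 0.
  by move=> s1; rewrite hw s1 subrr mul0r.
have i1 : hform (w 1) (w 1) = 0 by rewrite iso// conjC1 mulr1.
have im : hform (w (-1)) (w (-1)) = 0 by rewrite iso// rmorphN /= conjC1 mulrNN mulr1.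
have one : (1 : C) != 0 := oner_neq0 _.
have m2 : (-1 - 1 : C) != 0 by rewrite -opprD oppr_eq0 (_ : 1 + 1 = 2%:R) ?pnatr_eq0.
have main y : hform y y = 0 -> (forall x, hform x x = 0 -> hform x y != 0 -> m x y = 0).
  by move=> yy x xx xy; exact: MP.
(* The columns of e and f come from the pairings of w (1) and w (-1) with e and
   f, the column of d from the pairings with w (1) on the right. *)
have mfe : m f e = 0 by apply: main; rewrite ?fe.
have mef : m e f = 0 by apply: main; rewrite ?ef.
have mwe s : hform (w s) (w s) = 0 -> - (c / 2) * m e e + s * m d e = 0.
  move=> wi; have : m (w s) e = 0 by apply: main; rewrite ?hwe.
  by rewrite /w !mD !mZ mfe addr0.
have mwf s : hform (w s) (w s) = 0 -> s * m d f + m f f = 0.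
  move=> wi; have : m (w s) f = 0 by apply: main; rewrite ?hwf.
  by rewrite /w !mD !mZ mef mulr0 add0r.
have [mee mde] : m e e = 0 /\ m d e = 0.
  have := mwe _ i1; have := mwe _ im; rewrite mul1r mulN1r => h1 h2.
  have [c1 d1] := add_sub_eq0 h2 h1; split; last exact: d1.
  by apply/eqP; move/eqP: c1; rewrite mulf_eq0 (negPf c2).
have [mff mdf] : m f f = 0 /\ m d f = 0.
  have := mwf _ i1; have := mwf _ im; rewrite mul1r mulN1r => h1 h2.
  by apply: add_sub_eq0; rewrite addrC; [exact: h2|exact: h1].
have med : m e d = 0.
  have : m e (w 1) = 0 by apply: main; rewrite ?hew.
  by rewrite /w !mDr !mZr mee mef mulr0 conjC1 mul1r add0r addr0.
have mfd : m f d = 0.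
  have : m f (w 1) = 0 by apply: main; rewrite ?hfw.
  by rewrite /w !mDr !mZr mfe mff mulr0 conjC1 mul1r add0r addr0.
have mdd : m d d = 0.
  have : m (w 1) (w (-1)) = 0.
    apply: main; [exact: im|exact: i1|].
    rewrite hw mul1r rmorphN /= conjC1; exact: mulf_neq0 m2 dd.
  rewrite /w !mDr !mZr !mD !mZ mee mef med mfe mff mfd mde mdf.
  rewrite c2r !(mulr0, add0r, addr0) rmorphN /= conjC1 mulN1r mul1r.
  by move/eqP; rewrite oppr_eq0 => /eqP.
apply: full; split; [exact: mee|exact: med|exact: mef|exact: mde|exact: mdd|
  exact: mdf|exact: mfe|exact: mfd|exact: mff].
Qed.

End Hyperbolic.

(** * Powers of the elements of a lattice separate matrices *)

Section GroupMorphism.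
Variables (G1 G2 : groupType) (f : G1 -> G2) (g : G2 -> G1).
Hypothesis fM : {morph f : x y / (x * y)%g}.

Lemma group_morph1 : f 1%g = 1%g.
Proof. by apply: (@mulgI _ (f 1%g)); rewrite -fM !mulg1. Qed.

Lemma group_morphV x : f (x^-1)%g = ((f x)^-1)%g.
Proof. by apply: (@mulgI _ (f x)); rewrite -fM !mulgV group_morph1. Qed.

Lemma group_morphX x k : f (x ^+ k)%g = (f x ^+ k)%g.
Proof. by elim: k => [|k IH]; [rewrite !expg0 group_morph1|rewrite !expgS fM IH]. Qed.

Lemma group_morph_can : cancel f g -> cancel g f -> {morph g : x y / (x * y)%g}.
Proof. by move=> fK gK x y; apply: (can_inj fK); rewrite fM !gK. Qed.

End GroupMorphism.

Section TraceSeparation.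
Variables (R : realType) (H J : 'M[CC R]_3).
Local Notation C := (CC R).
Hypotheses (Hu : H \in unitmx) (Jsym : ctr J = J) (Ju : J \in unitmx).
Variable Gamma : groupClosed (unitary_group H).
Hypothesis Gmu : has_finite_invariant_measure Gamma.
Variables (f : unitary_group J -> unitary_group H) (g : unitary_group H -> unitary_group J).
Hypotheses (fM : {morph f : x y / (x * y)%g}) (fK : cancel f g) (gK : cancel g f).
Hypotheses (fc : continuous f) (gc : continuous g).

Lemma mx_of_exp (x : unitary_group J) k : mx_of (x ^+ k)%g = mx_of x ^+ k.
Proof. by elim: k => [|k IH]; [|rewrite expgS exprS mx_ofM IH]. Qed.

Lemma expmx_ctns (X : topologicalType) (h : X -> 'M[C]_3) k :
  continuous h -> continuous (fun x => h x ^+ k).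
Proof.
move=> ch; elim: k => [|k IH]; first exact: cst_continuous.
have -> : (fun x => h x ^+ k.+1) = (fun x => h x *m h x ^+ k).
  by apply: boolp.funext => x; rewrite exprS.
exact: (@mulmx_ctns C X 3 3 3 h (fun x => h x ^+ k) ch IH).
Qed.

Lemma trace_ctns (X : topologicalType) (h : X -> 'M[C]_3) :
  continuous h -> continuous (fun x => \tr (h x)).
Proof. by move=> ch; apply: sum_ctns => i _; exact: entry_ctns. Qed.

Lemma scale_ctns (X : topologicalType) (s : X -> C) (A : 'M[C]_3) :
  continuous s -> continuous (fun x => s x *: A).
Proof.
move=> cs; apply: mx_continuous => i j.
have -> : (fun x => (s x *: A) i j) = (fun x => s x * A i j).
  by apply: boolp.funext => x; rewrite mxE.
exact: (@mul_ctns C X s (fun=> A i j) cs (@cst_continuous _ _ _)).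
Qed.

Lemma addmx_ctns (X : topologicalType) (h k : X -> 'M[C]_3) :
  continuous h -> continuous k -> continuous (fun x => h x + k x).
Proof.
move=> ch ck; apply: mx_continuous => i j.
have -> : (fun x => (h x + k x) i j) = (fun x => h x i j + k x i j).
  by apply: boolp.funext => x; rewrite mxE.
exact: (@add_ctns C X (fun x => h x i j) (fun x => k x i j) (entry_ctns ch) (entry_ctns ck)).
Qed.

(** Recurrence for the boost [a] and a small neighborhood of 1 gives [c] in
    [Gamma] with [g c = u^-1 a^k u'], where [u], [u'] are close to 1 and [k]
    is large. Then [2^-k (g c)] is close to [P], and so is its power of
    exponent [N.+1], since [P] is idempotent. The hypothesis is homogeneous,
    so it passes to the limit. *)
Lemma recurrent_boost (P Q T : 'M[C]_3) (N : nat) :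
  P *m P = P -> Q *m Q = Q -> P *m Q = 0 -> Q *m P = 0 ->
  J *m ctr P = Q *m J -> J *m ctr Q = P *m J ->
  (forall c, c \in Gamma -> \tr (T *m (mx_of (g c)) ^+ N.+1) = 0) ->
  \tr (T *m P) = 0.
Proof.
move=> PP QQ PQ QP PJ QJ Ttr.
pose a := mk_unitary (boost_isometry Ju PP QQ PQ QP PJ QJ).
(* The factor J (ctr u) J^-1 is the inverse of an isometry u; in this form it
   is continuous on all matrices. *)
pose Phi (z : 'M[C]_3 * C * 'M[C]_3) :=
  \tr (T *m (J *m ctr z.1.1 *m invmx J *m boost_at P Q z.1.2 *m z.2) ^+ N.+1).
have cfst (X Y : topologicalType) : continuous (@fst X Y) by move=> [x y]; exact: cvg_fst.
have csnd (X Y : topologicalType) : continuous (@snd X Y) by move=> [x y]; exact: cvg_snd.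
have cPhi : continuous Phi.
  have c1 : continuous (fun z : 'M[C]_3 * C * 'M[C]_3 => z.1.1).
    exact: (@comp_ctns _ _ _ fst fst (@cfst _ _) (@cfst _ _)).
  have c2 : continuous (fun z : 'M[C]_3 * C * 'M[C]_3 => z.1.2).
    exact: (@comp_ctns _ _ _ fst snd (@cfst _ _) (@csnd _ _)).
  have cc n (A : 'M[C]_n) : continuous (fun z : 'M[C]_3 * C * 'M[C]_3 => A).
    exact: cst_continuous.
  have c3 := mulmx_ctns (mulmx_ctns (cc _ J) (ctr_ctns c1)) (cc _ (invmx J)).
  have c4 : continuous (fun z : 'M[C]_3 * C * 'M[C]_3 => z.1.2 *: (1%:M - P - Q)).
    exact: scale_ctns c2.
  have c22 : continuous (fun z : 'M[C]_3 * C * 'M[C]_3 => z.1.2 ^+ 2).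
    exact: (mul_ctns c2 c2).
  have c5 : continuous (fun z : 'M[C]_3 * C * 'M[C]_3 => z.1.2 ^+ 2 *: Q).
    exact: scale_ctns c22.
  have c6 := mulmx_ctns (mulmx_ctns c3 (addmx_ctns (addmx_ctns (cc _ P) c4) c5)) (@csnd _ _).
  have c7 : continuous (fun z : 'M[C]_3 * C * 'M[C]_3 =>
    (J *m ctr z.1.1 *m invmx J *m boost_at P Q z.1.2 *m z.2) ^+ N.+1).
    exact: expmx_ctns c6.
  exact: trace_ctns (mulmx_ctns (cc _ T) c7).
apply: contrapT => /eqP TP0.
have PN : P ^+ N.+1 = P.
  by elim: (N) => [|k IH]; rewrite ?expr1// exprS IH; exact: PP.
have Phi1 : Phi (1%:M, 0, 1%:M) = \tr (T *m P).
  rewrite /Phi /= ctr1 !mulmx1 mulmxV// mul1mx /boost_at.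
  by rewrite expr0n /= !scale0r !addr0 PN.
have : nbhs (1%:M : 'M[C]_3, 0 : C, 1%:M : 'M[C]_3) [set z | Phi z != 0].
  have := cPhi (1%:M, 0, 1%:M) [set y | y != 0]; apply.
  rewrite Phi1; apply: open_nbhs_nbhs; split; last exact: TP0.
  have -> : [set y : C | y != 0] = ~` [set 0] by apply/seteqP; split => y /= /eqP.
  apply: closed_openC.
  exact/accessible_closed_set1/hausdorff_accessible/norm_hausdorff.
move=> [[V12 V3] /= [[[V1 V2] /= [V1n V2n] V12s] V3n] Vs].
have [r r0 rV2] : exists2 r : R, 0 < r & forall s : C, `|s| < creal r -> V2 s.
  move: V2n => /nbhs_ballP[e /= /posC_real[r r0 ->] eV]; exists r => // s sr.
  by apply: eV; rewrite /ball /= sub0r normrN.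
have [M MP] : exists M : nat, forall k, (M <= k)%N -> (2 ^+ k)^-1 < r.
  exists (Num.bound r^-1) => k Mk.
  rewrite -[ltRHS]invrK ltf_pV2 ?posrE ?invr_gt0 ?exprn_gt0//.
  apply: (lt_le_trans (archi_boundP _)); first by rewrite invr_ge0 ltW.
  by rewrite -natrX ler_nat (leq_trans Mk)// ltnW// ltn_expl.
pose W : set 'M[C]_3 := @interior 'M[C]_3 V1 `&` @interior 'M[C]_3 V3.
have oW : open W by apply: openI; exact: open_interior.
pose U : set (unitary_group J) := @mx_of R 3 J @^-1` W.
have oU : open U by apply: open_comp oW => x _; exact: mx_of_ctns.
pose V : set (unitary_group H) := g @^-1` U.
have oV : open V by apply: open_comp oU => x _; exact: gc.
have V1' : V 1%g.
  by rewrite /V /= -(group_morph1 fM) fK; split; [exact: V1n|exact: V3n].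
have [k [v [v' [c [Mk Vv Vv' cG vc]]]]] := recurrence Hu (f a) M Gmu oV V1'.
have gce : g c = ((g v)^-1 * a ^+ k * g v')%g.
  apply: (can_inj fK); rewrite !fM (group_morphV fM) (group_morphX fM) !gK -!mulgA -vc mulKg //.
pose s : C := (2 ^+ k)^-1.
have two0 : (2 ^+ k : C) != 0 by rewrite expf_neq0// pnatr_eq0.
have : Phi (mx_of (g v), s, mx_of (g v')) != 0.
  apply: (Vs (_, _)); split => /=; last exact: interior_subset (Vv'.2).
  apply: (V12s (_, _)); split => /=; first exact: interior_subset (Vv.1).
  apply: rV2; rewrite /s normfV normrX normr_nat.
  have -> : (2 ^+ k : C)^-1 = creal ((2 ^+ k)^-1).
    by rewrite fmorphV rmorphXn rmorph_nat.
  by rewrite creal_lt; exact: MP.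
move=> /eqP; apply.
rewrite /Phi /=.
have -> : boost_at P Q s = s *: mx_of (a ^+ k)%g.
  rewrite mx_of_exp mk_unitaryE boost_pow // scalerA mulVf// scale1r //.
rewrite -(mx_of_inv (g v) Ju) -scalemxAr -scalemxAl -!mx_ofM -gce.
by rewrite exprZn -scalemxAr linearZ /= Ttr ?mulr0.
Qed.

(** A weak form of Borel density: the powers of exponent [N.+1] of the
    elements of the lattice span the space of matrices. For isotropic [x], [y]
    that are not orthogonal, the projection onto the line of [x] along the
    orthogonal of [y] is the limit of a rescaled boost, and its trace against
    [T] is, up to a nonzero factor, the pairing of [x] and [y] under [T *m J]. *)
Lemma trace_separation (T : 'M[C]_3) (N : nat) v : v != 0 -> hform J v v = 0 ->
  (forall c, c \in Gamma -> \tr (T *m (mx_of (g c)) ^+ N.+1) = 0) -> T = 0.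
Proof.
move=> v0 vv Ttr; suff TJ : T *m J = 0 by rewrite -[T](mulmxK Ju) TJ mul0mx.
apply: (isotropic_pairs_separate Jsym Ju v0 vv) => x y xx yy xy.
have yx : hform J y x != 0 by rewrite -hform_conj// conjC_eq0.
have : \tr (T *m boost_dir J y x) = 0.
  apply: (@recurrent_boost _ (boost_dir J x y) T N) => //.
  - exact: boost_dir_idem.
  - exact: boost_dir_idem.
  - by rewrite boost_dir_mul xx mulr0 scale0r.
  - by rewrite boost_dir_mul yy mulr0 scale0r.
  - exact: boost_dir_ctr.
  - exact: boost_dir_ctr.
rewrite /boost_dir -scalemxAr linearZ /= => /eqP; rewrite mulf_eq0 invr_eq0 (negPf xy) /=.
rewrite !mulmxA mxtrace_mulC !mulmxA => /eqP <-.
by rewrite /mxtrace big_ord1.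
Qed.

End TraceSeparation.

(** * Conjugate linear involutions of a matrix algebra *)

Section SkolemNoether.
Variable R : realType.
Local Notation C := (CC R).
Local Notation M3 := 'M[C]_3.

Lemma delta_mul (K : pzSemiRingType) n (i j k l : 'I_n) :
  delta_mx i j *m delta_mx k l = (delta_mx i l : 'M[K]_n) *+ (j == k).
Proof. by rewrite mul_delta_mx_cond. Qed.

Lemma mulmx_deltaE (K : pzSemiRingType) m n p (A : 'M[K]_(m, n)) j (l k : 'I_p) i :
  (A *m delta_mx j l) i k = A i j *+ (k == l).
Proof.
rewrite mxE (bigD1 j)//= big1 ?addr0 => [|x /negPf xj]; rewrite mxE ?xj ?mulr0//.
by rewrite eqxx mulr_natr.
Qed.

Lemma mul_delta_mxE (K : pzSemiRingType) m n p (A : 'M[K]_(n, p)) j l (k : 'I_p) (i : 'I_m) :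
  (delta_mx j l *m A) i k = A l k *+ (i == j).
Proof.
rewrite mxE (bigD1 l)//= big1 ?addr0 => [|x /negPf xj]; rewrite mxE ?xj ?andbF ?mul0r//.
by rewrite eqxx andbT mulr_natl.
Qed.

Lemma central_scalar (K : nzRingType) n (Z : 'M[K]_n.+1) :
  (forall X, Z *m X = X *m Z) -> Z = (Z 0 0)%:M.
Proof.
move=> ZC; apply/matrixP => i j; rewrite [RHS]mxE.
by have /matrixP/(_ i 0) := ZC (delta_mx j 0); rewrite mulmx_deltaE mul_delta_mxE eqxx.
Qed.

Variable T : M3 -> M3.
Hypothesis TD : forall X Y, T (X + Y) = T X + T Y.
Hypothesis TM : forall X Y, T (X *m Y) = T Y *m T X.
Hypothesis TZ : forall c X, T (c *: X) = Num.conj c *: T X.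
Hypothesis TK : involutive T.

Let al X := T (ctr X).
Let T0 : T 0 = 0. Proof. by rewrite -[X in T X](scale0r (0 : M3)) TZ conjC0 scale0r. Qed.
Let alD X Y : al (X + Y) = al X + al Y. Proof. by rewrite /al ctrD TD. Qed.
Let alZ c X : al (c *: X) = c *: al X.
Proof. by rewrite /al ctrZ TZ conjCK. Qed.
Let alM X Y : al (X *m Y) = al X *m al Y. Proof. by rewrite /al ctrM TM. Qed.
Let al0 : al 0 = 0. Proof. by rewrite -[X in al X](scale0r (0 : M3)) alZ scale0r. Qed.
Let al_sum (I : Type) (r : seq I) (F : I -> M3) :
  al (\sum_(i <- r) F i) = \sum_(i <- r) al (F i).
Proof. exact: (big_morph al alD al0). Qed.

(** The Skolem-Noether theorem for the automorphism [X |-> T (ctr X)], written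
    [al]. If [al E_00] has a nonzero column [j], the sum of the [al (E_i0)
    E_j0 E_0i] is a nonzero intertwiner. It is invertible, because its kernel
    is stable under all matrices. *)
Lemma conj_linear_intertwiner : exists2 S : M3, S \in unitmx &
  forall X, al X *m S = S *m X.
Proof.
pose E i j : M3 := delta_mx i j.
have a00 : al (E 0 0) != 0.
  apply/eqP => /(congr1 T); rewrite TK T0 => /(congr1 (@ctr _ _ _)).
  rewrite ctrK => /matrixP/(_ 0 0); rewrite !mxE eqxx /= conjC0 => /eqP.
  by rewrite oner_eq0.
have /matrix0Pn[k [j akj]] := a00.
pose S := \sum_i al (E i 0) *m E j 0 *m E 0 i.
have SE k' l : al (E k' l) *m S = S *m E k' l.
  rewrite /S mulmx_sumr mulmx_suml (bigD1 l)//= [RHS](bigD1 k')//=.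
  rewrite !big1 => [|i ik|i il].
  - by rewrite !addr0 !mulmxA -alM mul_delta_mx -[RHS]mulmxA mul_delta_mx.
  - by rewrite -mulmxA delta_mul (negPf ik) mulr0n mulmx0.
  - by rewrite !mulmxA -alM delta_mul eq_sym (negPf il) mulr0n al0 !mul0mx.
have SX X : al X *m S = S *m X.
  rewrite [X]matrix_sum_delta al_sum mulmx_suml mulmx_sumr.
  apply: eq_bigr => i _; rewrite al_sum mulmx_suml mulmx_sumr.
  by apply: eq_bigr => l _; rewrite alZ -scalemxAl SE scalemxAr.
exists S => //.
have S0 : S != 0.
  apply: contra_neq akj => S0.
  have : (al (E 0 0) *m S) k 0 = 0 by rewrite S0 mulmx0 mxE.
  rewrite /S mulmx_sumr (bigD1 0)//= big1 ?addr0 => [|i i0]; last first.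
    by rewrite !mulmxA -alM delta_mul eq_sym (negPf i0) mulr0n al0 !mul0mx.
  rewrite !mulmxA -alM delta_mul eqxx mulr1n -mulmxA delta_mul eqxx mulr1n.
  by rewrite mulmx_deltaE eqxx.
apply: contraTT S0 => nu; rewrite negbK.
have [|u uS u0] := right_null_vector (A := S).
  by rewrite ltn_neqAle rank_leq_row andbT; move: nu; rewrite -row_free_unit.
have SXu X : S *m X *m u = 0 by rewrite -SX -mulmxA uS mulmx0.
have /cV0Pn[i ui] := u0.
apply/eqP/matrixP => a b; rewrite [RHS]mxE.
have := SXu (E b i) => /matrixP/(_ a 0); rewrite [RHS]mxE => e0.
apply: (mulIf ui); rewrite mul0r -[RHS]e0 mxE (bigD1 i)//= big1 ?addr0.
  by rewrite mulmx_deltaE eqxx.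
by move=> l /negPf li; rewrite mulmx_deltaE li mulr0n mul0r.
Qed.

(** For the matrix [S] of the intertwiner, applying the involution twice shows
    that [S *m invmx (ctr S)] is central, that is [S = z *: ctr S] with [z] of
    modulus 1. A scalar multiple [mu *: S] is hermitian as soon as [conj mu *
    conj z = mu]; take [mu = 1 + conj z] unless this vanishes, in which case
    [z = -1] and [mu] is the imaginary unit. *)
Lemma conj_involution : exists S : M3, [/\ S \in unitmx, ctr S = S &
  forall X, T X = S *m ctr X *m invmx S].
Proof.
have [S Su SX] := conj_linear_intertwiner.
have TS X : T X = S *m ctr X *m invmx S.
  by rewrite -SX mulmxK// /al ctrK.
have cSu : ctr S \in unitmx by rewrite ctr_unit.
have ctrV (A : M3) : A \in unitmx -> ctr (invmx A) = invmx (ctr A).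
  by move=> Au; rewrite /ctr map_invmx trmx_inv.
have ZC X : (S *m invmx (ctr S)) *m X = X *m (S *m invmx (ctr S)).
  have e : S *m invmx (ctr S) *m X *m ctr S *m invmx S = X.
    by have := TK X; rewrite !TS !ctrM ctrK ctrV// !mulmxA.
  by rewrite -{2}e [RHS]mulmxA mulmxKV// mulmxK.
have := central_scalar ZC; set z := (_ 0 0) => zE.
have SzS : S = z *: ctr S by rewrite -mul_scalar_mx -zE mulmxKV.
have cSz : ctr S = Num.conj z *: S by rewrite {1}SzS ctrZ ctrK.
have zz : z * Num.conj z = 1.
  have S0 : S != 0 by apply: contraTneq Su => ->; rewrite unitr0.
  have : (z * Num.conj z - 1) *: S = 0.
    by rewrite scalerBl scale1r -scalerA -cSz -SzS subrr.
  by move/eqP; rewrite scaler_eq0 (negPf S0) orbF subr_eq0 => /eqP.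
have main mu : mu != 0 -> Num.conj mu * Num.conj z = mu ->
    exists S : M3, [/\ S \in unitmx, ctr S = S & forall X, T X = S *m ctr X *m invmx S].
  move=> mu0 muz; exists (mu *: S); split.
  - by rewrite unitmxZ ?unitfE.
  - by rewrite ctrZ cSz scalerA muz.
  - move=> X; rewrite TS invmxZ ?unitmxZ ?unitfE// -!scalemxAl -scalemxAr scalerA.
    by rewrite mulfV// scale1r.
have [z1|z1] := eqVneq (1 + Num.conj z) 0; last first.
  by apply: (main _ z1); rewrite rmorphD rmorph1 /= conjCK mulrDl mul1r zz addrC.
have zN : Num.conj z = -1 by apply/eqP; rewrite -addr_eq0 addrC z1.
apply: (main (ci R) (ci_neq0 R)).
by rewrite conj_ci zN mulrNN mulr1.
Qed.

End SkolemNoether.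

(** * The center of the division algebra at a real place *)

Section QuadraticExtension.
Variables (F : fieldExtType rat) (E : fieldExtType F) (c : {lrmorphism E -> E}).
Hypothesis Equad : quadratic_extension E.

Lemma natf_neq0 (n : nat) : (n.+1%:R : E) != 0.
Proof.
have : (n.+1%:R : rat) != 0 by rewrite pnatr_eq0.
rewrite -(fmorph_eq0 (in_alg F)) rmorph_nat -(fmorph_eq0 (in_alg E)) rmorph_nat //.
Qed.

Lemma quadratic_basis (s : E) : s \notin 1%VS -> forall x : E,
  exists a b : F, x = a%:A + b *: s.
Proof.
move=> s1 x.
have fr : free [tuple s; 1].
  by rewrite free_cons seq1_free oner_neq0 span_seq1 s1.
have bs : basis_of {:E} [tuple s; 1].
  by rewrite basisEfree fr subvf /= Equad.
exists (coord [tuple s; 1] (lift ord0 ord0) x), (coord [tuple s; 1] ord0 x).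
rewrite {1}(coord_basis bs (memvf x)).
by rewrite 2!big_ord_recl big_ord0 addr0 addrC.
Qed.

Hypothesis cK : involutive c.

(** If [c] moves [a], the difference [a - c a] changes sign under [c]. Its
    square is fixed by [c] and therefore lies in [F], because [E] is quadratic
    over [F]. *)
Lemma antisymmetric_element : (exists a, c a != a) ->
  exists s : E, [/\ s != 0, c s = - s, s \notin 1%VS & exists b : F, s ^+ 2 = b%:A].
Proof.
move=> [a ca]; pose s := a - c a.
have dbl0 (x : E) : x + x = 0 -> x = 0.
  move/eqP; rewrite -mulr2n -mulr_natr mulf_eq0 (negPf (natf_neq0 1)) orbF.
  by move/eqP.
have s0 : s != 0 by rewrite subr_eq0 eq_sym.
have cs : c s = - s by rewrite /s rmorphB /= cK opprB.
have s1 : s \notin 1%VS.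
  apply: contra_neqN s0 => /vlineP[b sb]; apply: dbl0.
  have : c s = s by rewrite sb linearZ /= rmorph1.
  by rewrite cs => e; rewrite -{1}e addNr.
exists s; split => //; have [x [y sE]] := quadratic_basis s1 (s ^+ 2).
exists x; rewrite sE; have : c (s ^+ 2) = s ^+ 2 by rewrite rmorphXn /= cs sqrrN.
rewrite sE linearD !linearZ /= cs rmorph1 scalerN => /addrI e.
by rewrite (dbl0 (y *: s)) ?addr0// -{1}e addNr.
Qed.

End QuadraticExtension.

(** The square of [eps s] is real, so [eps s] is real or purely imaginary. If
    it were real, all of [E = F + F s] would have real image. *)
Lemma totally_imaginary_sqrt (R : realType) (F : fieldExtType rat) (E : fieldExtType F)
    (eps : {rmorphism E -> CC R}) (iota : F -> R) (s : E) :
  quadratic_extension E -> totally_imaginary R E ->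
  (forall a : F, eps a%:A = creal (iota a)) ->
  s \notin 1%VS -> (exists b : F, s ^+ 2 = b%:A) ->
  exists2 t : R, t != 0 & eps s = ci R * creal t.
Proof.
move=> Equad Eim epsF s1 [b sb].
have s0 : s != 0 by apply: contraNneq s1 => ->; exact: mem0v.
set z := eps s; have z2 : z ^+ 2 = creal (iota b) by rewrite /z -rmorphXn sb epsF.
have ab : rpart z * ipart z = 0.
  have := congr1 (@ipart R) z2; rewrite -[creal _]addr0 -[X in _ + X](mulr0 (ci R)).
  rewrite -[X in _ * X](rmorph0 (@creal R)) ipart_rect expr2.
  move: z {z2} => -[x y]; rewrite /ipart /rpart /=; lra.
have [y0|y0] := eqVneq (ipart z) 0.
  exfalso; apply: (Eim eps) => x; have [a1 [b1 ->]] := quadratic_basis Equad s1 x.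
  have zr : z = creal (rpart z) by rewrite {1}[z]creal_parts y0 rmorph0 mulr0 addr0.
  rewrite rmorphD -(mulr_algl b1) rmorphM !epsF -/z.
  apply/complex_realP; exists (iota a1 + iota b1 * rpart z).
  by rewrite {1}zr -rmorphM -rmorphD.
exists (ipart z) => //; rewrite {1}[z]creal_parts.
by move/eqP: ab; rewrite mulf_eq0 (negPf y0) orbF => /eqP ->; rewrite rmorph0 add0r.
Qed.

Section Completion.
Variables (R : realType) (F : fieldExtType rat) (E : fieldExtType F) (D : falgType E).
Local Notation C := (CC R).
Variables (tau : D -> D) (iota : {rmorphism F -> R}) (d : nat).
Variables (phi : {rmorphism D -> 'M[C]_d.+1}) (tau' : 'M[C]_d.+1 -> 'M[C]_d.+1).
Hypothesis Equad : quadratic_extension E.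
Hypothesis Eim : totally_imaginary R E.
Hypothesis tau_inv : involution_over_galois tau.
Hypothesis comp : real_completion tau iota phi tau'.

Lemma completion_span (P : 'M[C]_d.+1 -> Prop) :
  (forall x, P (phi x)) -> (forall (t : R) M, P M -> P (creal t *: M)) ->
  (forall M N, P M -> P N -> P (M + N)) -> forall M, P M.
Proof.
move=> Pphi PZ PD M; have [_ h2 _ _] := comp; have [n [t [x ->]]] := h2 M.
elim/big_ind: _ => //; last by move=> i _; apply: PZ; exact: Pphi.
by rewrite -(rmorph0 phi); exact: Pphi.
Qed.

Lemma phiM x y : phi (x * y) = phi x *m phi y. Proof. exact: rmorphM. Qed.

(** The image of an element of [E] commutes with that of [D], hence with its
    real span, which is the whole matrix algebra; so it is scalar. *)
Lemma center_embedding : exists2 eps : {rmorphism E -> C},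
  (forall a, phi a%:A = (eps a)%:M) & forall a : F, eps a%:A = creal (iota a).
Proof.
pose e a := phi a%:A 0 0.
have eE a : phi a%:A = (e a)%:M.
  apply: central_scalar; apply: completion_span => [x|t M IH|M N IH1 IH2].
  - by rewrite -!phiM mulr_algl mulr_algr.
  - by rewrite -scalemxAr IH scalemxAl.
  - by rewrite mulmxDr IH1 IH2 mulmxDl.
have eB : zmod_morphism e by move=> a b; rewrite /e scalerBl rmorphB !mxE.
have eM : monoid_morphism e.
  split; first by rewrite /e scale1r rmorph1 mxE eqxx.
  move=> a b.
  have : phi (a * b)%:A = (e a * e b)%:M.
    by rewrite scalar_mxM -!eE -phiM mulr_algl scalerA.
  by rewrite eE => /matrixP/(_ 0 0); rewrite !mxE !eqxx !mulr1n.
pose eA := GRing.isZmodMorphism.Build _ _ e eB.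
pose eMM := GRing.isMonoidMorphism.Build _ _ e eM.
pose e' : {rmorphism E -> C} := HB.pack e eA eMM.
exists e' => // a; have [h1 _ _ _] := comp; have := h1 a.
by rewrite eE => /matrixP/(_ 0 0); rewrite !mxE !eqxx !mulr1n.
Qed.

Lemma tau'D M N : tau' (M + N) = tau' M + tau' N.
Proof. by have [_ _ h _] := comp; have := h 1 M N; rewrite !scale1r. Qed.

Lemma tau'0 : tau' 0 = 0.
Proof. by have := tau'D 0 0; rewrite addr0 => /eqP; rewrite eq_sym -subr_eq0 addrK => /eqP. Qed.

Lemma tau'Zr (t : R) M : tau' (creal t *: M) = creal t *: tau' M.
Proof. by have [_ _ h _] := comp; have := h t M 0; rewrite tau'0 !addr0. Qed.

Lemma tau'M M N : tau' (M *m N) = tau' N *m tau' M.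
Proof.
have [_ _ _ h4] := comp; have [_ tM _ _] := tau_inv.
move: M N; apply: completion_span => [x|t M IH N|M M' IH1 IH2 N].
- apply: completion_span => [y|t N IH|N N' IH1 IH2].
  + by rewrite -phiM !h4 tM phiM.
  + by rewrite -scalemxAr !tau'Zr IH scalemxAl.
  + by rewrite mulmxDr !tau'D IH1 IH2 mulmxDl.
- by rewrite -scalemxAl !tau'Zr IH scalemxAr.
- by rewrite mulmxDl !tau'D IH1 IH2 mulmxDr.
Qed.

Lemma tau'K : involutive tau'.
Proof.
have [_ _ _ h4] := comp; have [_ _ tK _] := tau_inv.
apply: completion_span => [x|t M IH|M M' IH1 IH2].
- by rewrite !h4 tK.
- by rewrite !tau'Zr IH.
- by rewrite !tau'D IH1 IH2.
Qed.

(** The involution [tau'] is only given as a real linear map. The imaginary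
    unit is a real multiple of the image of an antisymmetric element of [E],
    so [tau'] changes its sign. *)
Lemma tau'Z (z : C) M : tau' (z *: M) = Num.conj z *: tau' M.
Proof.
have [tD tM tK [c cne tc]] := tau_inv; have [_ _ _ h4] := comp.
have cK : involutive c.
  move=> a; have := tK a%:A; rewrite !tc => /eqP.
  by rewrite -subr_eq0 -scalerBl scaler_eq0 (negPf (oner_neq0 _)) orbF subr_eq0 => /eqP.
have [s [s0 cs s1 sb]] := antisymmetric_element Equad cK cne.
have [eps epsE epsF] := center_embedding.
have [t t0 st] := totally_imaginary_sqrt Equad Eim epsF s1 sb.
have ti : tau' (ci R)%:M = - (ci R)%:M.
  have -> : (ci R)%:M = creal t^-1 *: phi s%:A :> 'M[C]_d.+1.
    rewrite epsE st scale_scalar_mx mulrCA -rmorphM mulVf// rmorph1 mulr1 //.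
  by rewrite tau'Zr h4 tc cs scaleNr rmorphN scalerN.
have tiM N : tau' (ci R *: N) = - ci R *: tau' N.
  by rewrite -mul_scalar_mx tau'M ti mulmxN mul_mx_scalar scaleNr.
rewrite [z]creal_parts scalerDl tau'D -scalerA tiM !tau'Zr.
rewrite rmorphD rmorphM /= !conj_creal conj_ci scalerDl scalerA; congr (_ + _).
Qed.

End Completion.

(** * Matrices over the division algebra as complex matrices *)

Section Model.
Variables (R : realType) (F : fieldExtType rat) (E : fieldExtType F) (D : falgType E).
Local Notation C := (CC R).
Variables (tau : D -> D) (r : nat) (K : 'M[D]_r) (iota : F -> R).

Definition escale (e : E) (X : 'M[D]_r) : 'M[D]_r := map_mx (fun x => e *: x) X.

(** The extension of scalars along [iota] of [M_r(D)] with the involution [X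
    |-> tau(X)^T], realized on complex 3 x 3 matrices. There the involution is
    the conjugate transpose up to conjugation by the hermitian matrix [twist].
    The record treats the two possible degrees of [D] alike. *)
Record unitary_model := UnitaryModel {
  rho : 'M[D]_r -> 'M[C]_3;
  eps : {rmorphism E -> C};
  twist : 'M[C]_3;
  rhoD : {morph rho : X Y / X + Y};
  rhoM : forall X Y, rho (X *m Y) = rho X *m rho Y;
  rho1 : rho 1%:M = 1%:M;
  rhoZ : forall e X, rho (escale e X) = eps e *: rho X;
  rho_inj : forall X, rho X = 0 -> X = 0;
  eps_base : forall a : F, eps a%:A = creal (iota a);
  rho_span : forall Y, exists s : seq (R * 'M[D]_r),
    Y = \sum_(p <- s) creal p.1 *: rho p.2;
  twist_unit : twist \in unitmx;
  twist_herm : ctr twist = twist;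
  rho_adj : forall X, rho (map_mx tau X)^T = twist *m ctr (rho X) *m invmx twist }.

Definition model_form (m : unitary_model) : 'M[C]_3 := rho m K *m twist m.

Lemma model_form_herm (m : unitary_model) : hermitian_mx tau K ->
  ctr (model_form m) = model_form m.
Proof.
move=> Kh; rewrite /model_form ctrM twist_herm.
have := rho_adj m K; rewrite Kh => {2}->.
by rewrite mulmxKV ?twist_unit.
Qed.

Lemma rho_form (m : unitary_model) X Y :
  rho m (X *m K *m (map_mx tau Y)^T) *m twist m =
  rho m X *m model_form m *m ctr (rho m Y).
Proof.
rewrite !rhoM rho_adj /model_form !mulmxA mulmxKV ?twist_unit//.
Qed.

End Model.

Section ModelOfCompletion.
Variables (R : realType) (F : fieldExtType rat) (E : fieldExtType F) (D : falgType E).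
Local Notation C := (CC R).
Variables (tau : D -> D) (iota : {rmorphism F -> R}) (d r : nat) (K : 'M[D]_r).
Variables (phi : {rmorphism D -> 'M[C]_d.+1}) (tau' : 'M[C]_d.+1 -> 'M[C]_d.+1).
Hypothesis Equad : quadratic_extension E.
Hypothesis Eim : totally_imaginary R E.
Hypothesis Dunit : forall x : D, x != 0 -> x \is a GRing.unit.
Hypothesis tau_inv : involution_over_galois tau.
Hypothesis comp : real_completion tau iota phi tau'.
Hypothesis Kherm : hermitian_mx tau K.
Local Notation B := 'M['M[C]_d.+1]_r.
Variables (psi : B -> 'M[C]_3) (psii : 'M[C]_3 -> B).
Hypotheses (psiK : cancel psi psii) (psiiK : cancel psii psi).
Hypothesis psiD : forall X Y, psi (X + Y) = psi X + psi Y.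
Hypothesis psiM : forall X Y, psi (X *m Y) = psi X *m psi Y.
Hypothesis psi1 : psi 1%:M = 1%:M.
Hypothesis psiZ : forall z X, psi (map_mx (fun N => z *: N) X) = z *: psi X.

Let tr' (X : B) : B := (map_mx tau' X)^T.

Let tr'M (X Y : B) : tr' (X *m Y) = tr' Y *m tr' X.
Proof.
apply/matrixP => i j; rewrite !mxE.
rewrite (big_morph tau' (tau'D comp) (tau'0 comp)); apply: eq_bigr => k _.
by rewrite [LHS](tau'M tau_inv comp) !mxE.
Qed.

Let psi0 : psi 0 = 0.
Proof. by have := psiD 0 0; rewrite addr0 => /eqP; rewrite eq_sym -subr_eq0 addrK => /eqP. Qed.

Let T Y := psi (tr' (psii Y)).

Let psiiD Y Z : psii (Y + Z) = psii Y + psii Z.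
Proof. by apply: (can_inj psiK); rewrite psiD !psiiK. Qed.

Let psiiM Y Z : psii (Y *m Z) = psii Y *m psii Z.
Proof. by apply: (can_inj psiK); rewrite psiM !psiiK. Qed.

Let psiiZ z Y : psii (z *: Y) = map_mx (fun N => z *: N) (psii Y).
Proof. by apply: (can_inj psiK); rewrite psiZ !psiiK. Qed.

Let T_form : exists S : 'M[C]_3, [/\ S \in unitmx, ctr S = S &
  forall X, T X = S *m ctr X *m invmx S].
Proof.
apply: conj_involution.
- move=> X Y; rewrite /T psiiD -psiD; congr psi.
  by apply/matrixP => i j; rewrite !mxE (tau'D comp).
- by move=> X Y; rewrite /T psiiM tr'M psiM.
- move=> c X; rewrite /T psiiZ -psiZ; congr psi.
  by apply/matrixP => i j; rewrite !mxE (tau'Z Equad Eim tau_inv comp).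
- move=> X; rewrite /T psiK -[RHS]psiiK; congr psi.
  by apply/matrixP => i j; rewrite !mxE (tau'K tau_inv comp).
Qed.

Let rh (X : 'M[D]_r) := psi (map_mx phi X).

Let rhD : {morph rh : X Y / X + Y}.
Proof. by move=> X Y; rewrite /rh map_mxD psiD. Qed.

Let rh_span Y : exists s : seq (R * 'M[D]_r), Y = \sum_(p <- s) creal p.1 *: rh p.2.
Proof.
pose Sp Y := exists s : seq (R * 'M[D]_r), Y = \sum_(p <- s) creal p.1 *: rh p.2.
have Sp0 : Sp 0 by exists [::]; rewrite big_nil.
have SpD Y1 Y2 : Sp Y1 -> Sp Y2 -> Sp (Y1 + Y2).
  by move=> [s1 ->] [s2 ->]; exists (s1 ++ s2); rewrite big_cat.
have SpZ t Y1 : Sp Y1 -> Sp (creal t *: Y1).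
  move=> [s1 ->]; exists [seq (t * p.1, p.2) | p <- s1].
  by rewrite big_map scaler_sumr; apply: eq_bigr => p _; rewrite scalerA rmorphM.
suff SpB (X : B) : Sp (psi X) by rewrite -[Y]psiiK; exact: SpB.
rewrite [X]matrix_sum_delta (big_morph psi psiD psi0).
elim/big_ind: _ => // i _; rewrite (big_morph psi psiD psi0).
elim/big_ind: _ => // j _.
have : Sp (psi (X i j *: delta_mx i j)).
  move: (X i j); apply: (completion_span comp) => [x|t M IH|M N IH1 IH2].
  - exists [:: (1, x *: delta_mx i j)]; rewrite big_seq1 scale1r /rh /=; congr psi.
    apply/matrixP => a b; rewrite !mxE rmorphM; congr (_ * _).
    by case: (_ && _); rewrite ?rmorph0 ?rmorph1.
  - have -> : psi ((creal t *: M) *: delta_mx i j) = creal t *: psi (M *: delta_mx i j).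
      by rewrite -psiZ; congr psi; apply/matrixP => a b; rewrite !mxE scalerAl.
    exact: SpZ.
  - by rewrite scalerDl psiD; exact: SpD.
by [].
Qed.

(** The algebra [B] of block matrices is identified with that of complex
    matrices by [psi], and [conj_involution] puts the involution in standard
    form. As [D] is a division algebra, [rho] is injective. *)
Lemma model_of_completion : exists m : unitary_model tau r iota,
  (forall X, rho m X = psi (map_mx phi X)) /\
  (forall X : B, isometry_group tau' (map_mx phi K) X <->
     isometry_group Num.conj (model_form K m) (psi X)).
Proof.
have [S [Su Sh TS]] := T_form.
have [ep epE epF] := center_embedding comp.
have rZ e X : rh (escale e X) = ep e *: rh X.
  rewrite /rh -psiZ; congr psi; apply/matrixP => i j; rewrite !mxE.
  by rewrite -mulr_algl (phiM phi) epE mul_scalar_mx.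
have rM X Y : rh (X *m Y) = rh X *m rh Y.
  rewrite /rh -psiM; congr psi.
  apply/matrixP => i j; rewrite !mxE rmorph_sum; apply: eq_bigr => k _.
  by rewrite !mxE; exact: phiM.
have r1 : rh 1%:M = 1%:M.
  rewrite -psi1 /rh; congr psi; apply/matrixP => i j; rewrite !mxE.
  by case: (i == j); rewrite ?mulr1n ?mulr0n ?rmorph1 ?rmorph0.
have rinj X : rh X = 0 -> X = 0.
  rewrite -psi0 => /(can_inj psiK) /matrixP X0; apply/matrixP => i j.
  have := X0 i j; rewrite !mxE => e0; apply/eqP; apply: contraPT e0 => x0.
  have : phi (X i j) *m phi (X i j)^-1 = 1%:M.
    by rewrite -phiM divrr ?Dunit// rmorph1.
  move=> + e0; rewrite e0 mul0mx => /matrixP/(_ 0 0) /eqP.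
  by rewrite !mxE eqxx eq_sym oner_eq0.
have radj X : rh (map_mx tau X)^T = S *m ctr (rh X) *m invmx S.
  rewrite -TS /T /rh psiK; congr psi; apply/matrixP => i j; rewrite !mxE.
  by have [_ _ _ ->] := comp.
exists (@UnitaryModel R F E D tau r iota rh ep S rhD rM r1 rZ rinj epF rh_span Su Sh radj).
split=> // X; rewrite /model_form /=.
have key : psi (X *m map_mx phi K *m (map_mx tau' X)^T) *m S =
    psi X *m (rh K *m S) *m ctr (psi X).
  have := TS (psi X); rewrite /T psiK => e; rewrite !psiM e !mulmxA mulmxKV//.
have psi_inj := can_inj psiK.
split=> -[[Y [XY YX]] iso]; split.
- by exists (psi Y); rewrite -!psiM XY YX psi1.
- by rewrite -[RHS]/(rh K *m S) -key iso.
- by exists (psii Y); split; apply: psi_inj; rewrite psiM psiiK ?XY ?YX psi1.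
- apply: psi_inj; apply: (can_inj (mulmxK Su)); rewrite key; exact: iso.
Qed.

End ModelOfCompletion.

Section Flatten.
Variable R : realType.
Local Notation C := (CC R).

Definition flat1 (X : 'M['M[C]_1]_3) : 'M[C]_3 := map_mx (fun N : 'M[C]_1 => N 0 0) X.
Definition unflat1 (Y : 'M[C]_3) : 'M['M[C]_1]_3 := map_mx (fun z => z%:M) Y.

Lemma flat1K : cancel flat1 unflat1.
Proof. by move=> X; apply/matrixP => i j; rewrite !mxE -mx11_scalar. Qed.
Lemma unflat1K : cancel unflat1 flat1.
Proof. by move=> Y; apply/matrixP => i j; rewrite !mxE eqxx mulr1n. Qed.
Lemma flat1D X Y : flat1 (X + Y) = flat1 X + flat1 Y.
Proof. by apply/matrixP => i j; rewrite !mxE. Qed.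
Lemma flat1M X Y : flat1 (X *m Y) = flat1 X *m flat1 Y.
Proof.
apply/matrixP => i j; rewrite !mxE summxE; apply: eq_bigr => k _.
by rewrite [LHS]mxE big_ord1 !mxE.
Qed.
Lemma flat1_1 : flat1 1%:M = 1%:M.
Proof. by apply/matrixP => i j; rewrite !mxE; case: (i == j); rewrite ?mulr1n ?mulr0n mxE ?eqxx. Qed.
Lemma flat1Z z X : flat1 (map_mx (fun N => z *: N) X) = z *: flat1 X.
Proof. by apply/matrixP => i j; rewrite !mxE. Qed.
Lemma flat1_ctns : continuous flat1.
Proof.
apply: map_mx_ctns; first exact: entry_continuous.
by move=> x; exact: cvg_id.
Qed.
Lemma unflat1_ctns : continuous unflat1.
Proof.
apply: map_mx_ctns; last by move=> x; exact: cvg_id.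
apply: mx_continuous => i j.
have -> : (fun z : C => z%:M i j) = (fun z : C => z).
  by apply: boolp.funext => z; rewrite mxE !ord1 eqxx.
by move=> x; exact: cvg_id.
Qed.

Definition flat3 (X : 'M['M[C]_3]_1) : 'M[C]_3 := X 0 0.
Definition unflat3 (Y : 'M[C]_3) : 'M['M[C]_3]_1 := const_mx Y.
Lemma flat3K : cancel flat3 unflat3.
Proof. by move=> X; apply/matrixP => i j; rewrite !ord1 mxE. Qed.
Lemma unflat3K : cancel unflat3 flat3.
Proof. by move=> Y; rewrite /flat3 mxE. Qed.
Lemma flat3D X Y : flat3 (X + Y) = flat3 X + flat3 Y.
Proof. by rewrite /flat3 mxE. Qed.
Lemma flat3M X Y : flat3 (X *m Y) = flat3 X *m flat3 Y.
Proof. by rewrite /flat3 mxE big_ord1. Qed.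
Lemma flat3_1 : flat3 1%:M = 1%:M.
Proof. by rewrite /flat3 mxE. Qed.
Lemma flat3Z z X : flat3 (map_mx (fun N => z *: N) X) = z *: flat3 X.
Proof. by rewrite /flat3 mxE. Qed.
Lemma flat3_ctns : continuous flat3.
Proof. exact: entry_continuous. Qed.
Lemma unflat3_ctns : continuous unflat3.
Proof.
apply: mx_continuous => i j.
have -> : (fun Y : 'M[C]_3 => unflat3 Y i j) = id.
  by apply: boolp.funext => Y; rewrite /unflat3 mxE.
by move=> x; exact: cvg_id.
Qed.

End Flatten.

Section ModelExists.
Variables (R : realType) (F : fieldExtType rat) (E : fieldExtType F) (D : falgType E).
Local Notation C := (CC R).

(** For [d = 1] there are nine blocks of size one, for [d = 3] a single block
    of size three. *)
Lemma model_exists (tau : D -> D) (iota : {rmorphism F -> R}) (d : nat)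
    (K : 'M[D]_(3 %/ d)%N) (phi : {rmorphism D -> 'M[C]_d}) (tau' : 'M[C]_d -> 'M[C]_d) :
  d = 1%N \/ d = 3%N -> quadratic_extension E -> totally_imaginary R E ->
  (forall x : D, x != 0 -> x \is a GRing.unit) -> involution_over_galois tau ->
  real_completion tau iota phi tau' -> hermitian_mx tau K ->
  exists (m : unitary_model tau (3 %/ d)%N iota)
    (psi : 'M['M[C]_d]_(3 %/ d)%N -> 'M[C]_3) (psii : 'M[C]_3 -> 'M['M[C]_d]_(3 %/ d)%N),
  [/\ cancel psi psii, cancel psii psi, continuous psi & continuous psii] /\
  [/\ forall X Y, psi (X *m Y) = psi X *m psi Y,
     forall X, rho m X = psi (map_mx phi X) &
     forall X, isometry_group tau' (map_mx phi K) X <->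
       isometry_group Num.conj (model_form K m) (psi X)].
Proof.
move=> d13 Equad Eim Dunit tau_inv comp Kherm.
case: d13 K phi tau' comp Kherm => -> K phi tau' comp Kherm.
- have [m [mr miso]] := @model_of_completion R F E D tau iota 0 3 K phi tau' Equad Eim
     Dunit tau_inv comp _ _ (@flat1K R) (@unflat1K R) (@flat1D R) (@flat1M R) (@flat1_1 R)
     (@flat1Z R).
  exists m, (@flat1 R), (@unflat1 R); split; split=> //.
  + exact: flat1K.
  + exact: unflat1K.
  + exact: flat1_ctns.
  + exact: unflat1_ctns.
  + exact: flat1M.
- have [m [mr miso]] := @model_of_completion R F E D tau iota 2 1 K phi tau' Equad Eim
     Dunit tau_inv comp _ _ (@flat3K R) (@unflat3K R) (@flat3D R) (@flat3M R) (@flat3_1 R)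
     (@flat3Z R).
  exists m, (@flat3 R), (@unflat3 R); split; split=> //.
  + exact: flat3K.
  + exact: unflat3K.
  + exact: flat3_ctns.
  + exact: unflat3_ctns.
  + exact: flat3M.
Qed.

End ModelExists.

(** * Compactness and isotropic vectors *)

Section Isotropy.
Variables (R : realType) (J : 'M[CC R]_3).
Local Notation C := (CC R).
Hypothesis Jsym : ctr J = J.

Lemma ctr0 m n : ctr (0 : 'M[C]_(m, n)) = 0.
Proof. by rewrite /ctr map_mx0 trmx0. Qed.

Lemma ctr_eq0 m n (A : 'M[C]_(m, n)) : ctr A = 0 -> A = 0.
Proof. by move=> A0; rewrite -[A]ctrK A0 ctr0. Qed.

Lemma rank1_neq0 (K : fieldType) m n (a : 'cV[K]_m) (b : 'rV[K]_n) :
  a != 0 -> b != 0 -> a *m b != 0.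
Proof.
move=> /eqP a0 /eqP b0; apply/eqP => ab; apply: a0; apply/colP => i; rewrite [RHS]mxE.
apply/eqP/negPn/negP => ai; apply: b0; apply/rowP => j; rewrite [RHS]mxE.
have /matrixP/(_ i j) := ab; rewrite !mxE big_ord1 => /eqP.
by rewrite mulf_eq0 (negPf ai) /= => /eqP.
Qed.

Lemma nilpotent_family_unbounded (N : 'M[C]_3) B : N != 0 -> N *m N = 0 ->
  (forall t : R, (1%:M + creal t *: N) *m J *m ctr (1%:M + creal t *: N) = J) ->
  exists2 X, isometry_group Num.conj J X & ~ mx_bounded B X.
Proof.
move=> N0 NN iso.
have /matrix0Pn[i [j Nij]] := N0.
have [r r0 rE] : exists2 r : R, 0 < r & `|N i j| = creal r.
  by apply: posC_real; rewrite normr_gt0.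
pose t := (`|B| + 2) / r.
exists (1%:M + creal t *: N).
  split; last exact: iso.
  have inv s : (1%:M + s *: N) *m (1%:M - s *: N) = 1%:M.
    by rewrite mulmxDl !mulmxBr !mulmx1 mul1mx -scalemxAl -scalemxAr NN !scaler0 subr0 subrK.
  exists (1%:M - creal t *: N); split; first exact: inv.
  by have := inv (- creal t); rewrite scaleNr opprK.
move=> /(_ i j); rewrite !mxE => bd.
have : `|creal t * N i j| <= creal (B + 1).
  have -> : creal t * N i j = ((i == j)%:R + creal t * N i j) - (i == j)%:R.
    by rewrite [X in X - _]addrC addrK.
  apply: le_trans (ler_normB _ _) _; rewrite rmorphD rmorph1 lerD//.
  by case: (i == j); rewrite ?normr1 ?normr0.
rewrite normrM normc_creal rE -rmorphM creal_le.
have t0 : 0 < t by rewrite divr_gt0// ltr_wpDl.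
rewrite gtr0_norm// /t divfK ?gt_eqF// => h.
by have := ler_norm B; move: h; lra.
Qed.

(** The isometries [1 + t N] with [t] real, [N] nilpotent of square zero. If
    [v *m J] is not zero, then [N = i J v* v] works. If it vanishes, the form
    is degenerate, and [N = c v] works for any column [c] with [v c = 0]. *)
Lemma isotropic_unbounded v B : v != 0 -> hform J v v = 0 ->
  exists2 X, isometry_group Num.conj J X & ~ mx_bounded B X.
Proof.
move=> v0 vv; have [vJ|vJ] := eqVneq (v *m J) 0.
  have [|c vc c0] := right_null_vector (A := v); first exact: leq_ltn_trans (rank_leq_row _) _.
  apply: (@nilpotent_family_unbounded (c *m v)); first exact: rank1_neq0.
    by rewrite mulmxA -(mulmxA c v c) vc mulmx0 mul0mx.
  move=> t; rewrite ctrD ctrZ ctr1 conj_creal mulmxDl mul1mx -scalemxAl -mulmxA vJ.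
  rewrite mulmx0 scaler0 addr0 mulmxDr mulmx1 -scalemxAr ctrM.
  have -> : J *m (ctr v *m ctr c) = ctr (v *m J) *m ctr c by rewrite ctrM Jsym mulmxA.
  by rewrite vJ ctr0 mul0mx scaler0 addr0.
pose N := ci R *: (J *m ctr v *m v).
have i0 := ci_neq0 R.
have Jv0 : J *m ctr v != 0.
  by apply: contra_neq vJ => e0; apply: ctr_eq0; rewrite ctrM Jsym.
have vJv : v *m J *m ctr v = 0 by rewrite hformE vv raddf0.
have NJ : J *m ctr N = - (N *m J).
  by rewrite /N ctrZ conj_ci !ctrM ctrK Jsym scaleNr mulmxN -scalemxAl -scalemxAr !mulmxA.
have NN : N *m N = 0.
  rewrite /N -scalemxAl -scalemxAr.
  have -> : J *m ctr v *m v *m (J *m ctr v *m v) = J *m ctr v *m (v *m J *m ctr v) *m v.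
    by rewrite !mulmxA.
  by rewrite vJv mulmx0 mul0mx !scaler0.
have N0 : N != 0 by rewrite scaler_eq0 (negPf i0) rank1_neq0.
move: N NJ NN N0 => N NJ NN N0.
apply: (@nilpotent_family_unbounded N) => // t.
rewrite -mulmxA ctrD ctrZ ctr1 conj_creal mulmxDr mulmx1 -scalemxAr NJ.
rewrite scalerN mulmxBr !mulmxDl !mul1mx -!scalemxAl -!scalemxAr !mulmxA NN.
by rewrite mul0mx !scaler0 addr0 addrK.
Qed.

Lemma anisotropic_unit : (forall v : 'rV[C]_3, v != 0 -> hform J v v != 0) -> J \in unitmx.
Proof.
move=> an; rewrite -row_free_unit -kermx_eq0; apply/rowV0P => x /sub_kermxP xJ.
by apply/eqP/negPn/negP => /an; rewrite /hform xJ mul0mx mxE eqxx.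
Qed.

(** In an orthonormal basis of eigenvectors of [J] the form is diagonal with
    eigenvalues [d i]. They have the same sign, since otherwise a combination
    of two eigenvectors would be isotropic. The [i]-th row of an isometry [Y]
    has the value [d i], so [|Y i j|^2 <= d i / d j]. *)
Lemma anisotropic_bounded : (forall v : 'rV[C]_3, v != 0 -> hform J v v != 0) ->
  exists B, forall X, X *m J *m ctr X = J -> mx_bounded B X.
Proof.
move=> an; pose P := spectralmx J; pose d i := spectral_diag J 0 i.
have ctrE' (A : 'M[C]_3) : map_mx Num.conj A^T = ctr A by rewrite /ctr map_trmx.
have Jn : J \is normalmx by apply/normalmxP; rewrite ctrE' Jsym.
have Pu : P *m ctr P = 1%:M.
  by have /unitarymxP := spectral_unitarymx J; rewrite ctrE'.
have Pu' : ctr P *m P = 1%:M by exact: mulmx1C.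
have PV : invmx P = ctr P.
  by rewrite invmx_unitary ?spectral_unitarymx// ctrE'.
have JE : J = ctr P *m diag_mx (spectral_diag J) *m P.
  by rewrite -PV; exact/orthomx_spectralP.
have hx x y : hform J (x *m P) (y *m P) = \sum_i x 0 i * d i * Num.conj (y 0 i).
  rewrite /hform {1}JE ctrM !mulmxA -(mulmxA x P) Pu mulmx1 -(mulmxA _ P) Pu mulmx1.
  rewrite mxE; apply: eq_bigr => i _; rewrite ctrE; congr (_ * _).
  by rewrite mul_mx_diag mxE.
have hd x : hform J (x *m P) (x *m P) = \sum_i `|x 0 i| ^+ 2 * d i.
  by rewrite hx; apply: eq_bigr => i _; rewrite normCK mulrAC.
have nz (x : 'rV[C]_3) : x != 0 -> x *m P != 0.
  by apply: contra_neq => xP; rewrite -[x]mulmx1 -Pu mulmxA xP mul0mx.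
have hdelta i : hform J (delta_mx 0 i *m P) (delta_mx 0 i *m P) = d i.
  rewrite hd (bigD1 i)//= big1 ?addr0 => [|k /negPf ki].
    by rewrite mxE !eqxx normr1 expr1n mul1r.
  by rewrite mxE ki andbF normr0 expr0n mul0r.
have dr i : d i \is Num.real by rewrite -hdelta; exact: hform_real.
have d0 i : d i != 0.
  rewrite -hdelta; apply/an/nz; apply/eqP => /rowP/(_ i).
  by rewrite !mxE !eqxx => /eqP; rewrite oner_eq0.
have dd i j : 0 < d i / d j.
  have rr : d i / d j \is Num.real by rewrite rpredM ?rpredV.
  have [->|ij] := eqVneq i j; first by rewrite divff.
  have [//|neg|/esym/eqP] := real_ltgtP (real0 _) rr; last first.
    by rewrite mulf_eq0 invr_eq0 (negPf (d0 i)) (negPf (d0 j)).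
  exfalso; have ji : (j == i) = false by rewrite eq_sym (negPf ij).
  (* With this b the vector x below has the value d i + b^2 d j = 0. *)
  pose b := sqrtC (- (d i / d j)).
  have b0 : 0 <= b by rewrite sqrtC_ge0 oppr_ge0 ltW.
  pose x : 'rV[C]_3 := delta_mx 0 i + b *: delta_mx 0 j.
  have x0 : x != 0.
    apply/eqP => /rowP/(_ i); rewrite !mxE !eqxx (negPf ij) mulr0 addr0 => /eqP.
    by rewrite oner_eq0.
  have := an _ (nz x x0); rewrite hd (bigD1 i)//= (bigD1 j) ?ji//= big1 => [|k /andP[/negPf ki /negPf kj]].
    rewrite !mxE !eqxx (negPf ij) ji /= mulr0 mulr1 addr0 add0r normr1 expr1n mul1r.
    by rewrite ger0_norm// sqrtCK mulNr divfK// addr0 subrr eqxx.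
  by rewrite !mxE ki kj andbF mulr0 addr0 normr0 expr0n mul0r.
pose Bd : R := \sum_(ij : 'I_3 * 'I_3) (1 + `|rpart (d ij.1 / d ij.2)|).
have bdP i j : 1 + d i / d j <= creal Bd.
  have -> : d i / d j = creal (rpart (d i / d j)).
    by rewrite /creal RRe_real// realE ltW.
  rewrite -[1](rmorph1 (@creal R)) -rmorphD creal_le /Bd (bigD1 (i, j))//=.
  apply: ler_wpDr; first by rewrite sumr_ge0// => k _; rewrite addr_ge0.
  by rewrite lerD2l ler_norm.
have [B1 B1P] := ex_mx_bounded P.
have [B2 B2P] := mulmx_bounded (R := R) 3 3 3 B1 Bd.
have [B3 B3P] := mulmx_bounded (R := R) 3 3 3 B2 B1.
exists B3 => X XJ; pose Y := P *m X *m ctr P.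
have -> : X = ctr P *m Y *m P.
  by rewrite /Y !mulmxA Pu' mul1mx -mulmxA Pu' mulmx1.
apply: B3P => //; apply: B2P; first exact: ctr_bounded.
move=> i j.
have Yi : \sum_k `|Y i k| ^+ 2 * d k = d i.
  pose e : 'rV[C]_3 := delta_mx 0 i.
  have eY : e *m Y *m P = e *m P *m X.
    by rewrite /Y !mulmxA -(mulmxA _ (ctr P)) Pu' mulmx1.
  rewrite -hdelta -/e.
  transitivity (hform (X *m J *m ctr X) (e *m P) (e *m P)); last by rewrite XJ.
  have -> : hform (X *m J *m ctr X) (e *m P) (e *m P) = hform J (e *m Y *m P) (e *m Y *m P).
    by rewrite eY /hform !ctrM !mulmxA.
  by rewrite hd; apply: eq_bigr => k _; rewrite /e -rowE [row _ _ _ _]mxE.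
have : `|Y i j| ^+ 2 <= d i / d j.
  rewrite -Yi mulr_suml (bigD1 j)//= mulfK// lerDl sumr_ge0// => k _.
  by rewrite -mulrA mulr_ge0 ?exprn_ge0// ltW.
move=> Yij; apply: le_trans (bdP i j); apply: le_trans (_ : 1 + `|Y i j| ^+ 2 <= _); last by rewrite lerD2l.
have y0 := normr_ge0 (Y i j).
have [y1|/ltW y1] := real_leP (normr_real (Y i j)) (real1 _).
  by apply: le_trans y1 _; rewrite lerDl exprn_ge0.
by rewrite ler_wpDl// expr2 ler_peMl.
Qed.

End Isotropy.

Lemma nilpotent_mul (K : comNzRingType) n (N : 'M[K]_n) : N *m N = 0 -> forall s t : K,
  (1%:M + s *: N) *m (1%:M + t *: N) = 1%:M + (s + t) *: N.
Proof.
move=> NN s t; rewrite mulmxDl mulmxDr mulmx1 mul1mx mulmxDr mulmx1 -scalemxAl -scalemxAr NN.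
by rewrite !scaler0 addr0 -addrA -scalerDl (addrC t).
Qed.

(** * Isometries that commute with their conjugates *)

Section CentralElements.
Variables (R : realType) (J : 'M[CC R]_3).
Local Notation C := (CC R).
Hypotheses (Jsym : ctr J = J) (Ju : J \in unitmx).
Variable v0 : 'rV[C]_3.
Hypotheses (v0n : v0 != 0) (v0i : hform J v0 v0 = 0).

(** There is no totally isotropic plane: after subtraction of a multiple of
    [w], the vector [y] is orthogonal to the hyperbolic plane of [w] and [f],
    hence it is an isotropic multiple of the anisotropic vector [d]. *)
Lemma orthogonal_isotropic_colinear w y : w != 0 -> hform J w w = 0 ->
  hform J y y = 0 -> hform J y w = 0 -> exists a, y = a *: w.
Proof.
move=> w0 ww yy yw.
have [d [f [ff fw [dw df dd full]]]] := hyperbolic_basis Jsym Ju w0 ww.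
have wf : hform J w f = 1 by rewrite -hform_conj// fw conjC1.
have wy : hform J w y = 0 by rewrite -hform_conj// yw conjC0.
pose a := hform J y f; exists a; apply/eqP; rewrite -subr_eq0; apply/eqP.
pose z := y - a *: w.
have hB u1 u2 u : hform J (u1 - u2) u = hform J u1 u - hform J u2 u.
  by rewrite hformDl -scaleN1r hformZl mulN1r.
have zw : hform J z w = 0 by rewrite hB hformZl yw ww mulr0 subr0.
have zf : hform J z f = 0 by rewrite hB hformZl wf mulr1 subrr.
have zy : hform J z y = 0 by rewrite hB hformZl yy wy mulr0 subr0.
have zz : hform J z z = 0.
  by rewrite {2}/z -scaleNr hformDr hformZr zy zw mulr0 addr0.
pose b := hform J z d / hform J d d; pose z' := z - b *: d.
have z'w : hform J z' w = 0 by rewrite hB hformZl zw dw mulr0 subr0.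
have z'f : hform J z' f = 0 by rewrite hB hformZl zf df mulr0 subr0.
have z'd : hform J z' d = 0 by rewrite hB hformZl divfK// subrr.
have mE x u : hform J z' u = 0 -> (x *m (J *m ctr z' *m (z' *m J)) *m ctr u) 0 0 = 0.
  move=> h0; have -> : x *m (J *m ctr z' *m (z' *m J)) *m ctr u =
    x *m J *m ctr z' *m (z' *m J *m ctr u) by rewrite !mulmxA.
  by rewrite (hformE J z' u) h0 raddf0 mulmx0 mxE.
have M0 : J *m ctr z' *m (z' *m J) = 0 by apply: full; split; exact: mE.
have z'0 : z' = 0.
  have [z'J|z'J] := eqVneq (z' *m J) 0; first by rewrite -[z'](mulmxK Ju) z'J mul0mx.
  have z'J' : J *m ctr z' != 0.
    by apply: contra_neq z'J => e0; apply: ctr_eq0; rewrite ctrM Jsym.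
  by have := rank1_neq0 z'J' z'J; rewrite M0 eqxx.
have zE : z = b *: d by apply/eqP; rewrite -subr_eq0 -/z' z'0.
have b0 : b = 0.
  have : b * (Num.conj b * hform J d d) = 0 by rewrite -hformZr -hformZl -zE.
  have nz3 (x k : C) : k != 0 -> x * (Num.conj x * k) = 0 -> x = 0.
    by move=> k0 /eqP; rewrite !mulf_eq0 (negPf k0) orbF conjC_eq0 orbb => /eqP.
  exact: nz3 dd.
by rewrite -/z zE b0 scale0r.
Qed.

(** Two isotropic eigenvectors that are not orthogonal have eigenvalues [a],
    [b] with [a * conj b = 1]. Comparing three isotropic vectors [v0], [f],
    [w], no two of them orthogonal, shows that they have the same eigenvalue,
    of modulus 1, and every isotropic vector then has this eigenvalue. *)
Lemma isotropic_eigen_scalar (X : 'M[C]_3) : isometry_group Num.conj J X ->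
  (forall w, w != 0 -> hform J w w = 0 -> exists a, w *m X = a *: w) ->
  is_scalar_mx X.
Proof.
move=> [_ XJ] eig.
have hX u w : hform J (u *m X) (w *m X) = hform J u w.
  by rewrite /hform ctrM -{2}XJ !mulmxA.
have conjeig u w a b : u *m X = a *: u -> w *m X = b *: w -> hform J u w != 0 ->
    a * Num.conj b = 1.
  move=> ua wb uw; apply: (mulIf uw); rewrite mul1r -{2}hX ua wb hformZl hformZr.
  by rewrite -mulrA.
have [d [f [ff fv [dv df dd full]]]] := hyperbolic_basis Jsym Ju v0n v0i.
set c := hform J d d in dd.
have cr : Num.conj c = c by apply/CrealP; exact: hform_real.
have vf : hform J v0 f = 1 by rewrite -hform_conj// fv conjC1.
have vd : hform J v0 d = 0 by rewrite -hform_conj// dv conjC0.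
have fd : hform J f d = 0 by rewrite -hform_conj// df conjC0.
pose w := (- (c / 2)) *: v0 + d + f.
have c2r : Num.conj (- (c / 2)) = - (c / 2).
  by rewrite rmorphN rmorphM fmorphV rmorph_nat /= cr.
have ww : hform J w w = 0.
  rewrite /w !(hformDl, hformDr, hformZl, hformZr) ff fv vf dv df vd fd v0i c2r -/c.
  by rewrite !(mulr0, mulr1, add0r, addr0) -[X in _ + X - _]mul1r sub_two_halves subrr mul0r.
have wv : hform J w v0 = 1.
  by rewrite /w !hformDl hformZl v0i dv fv mulr0 !add0r.
have wf : hform J w f = - (c / 2).
  by rewrite /w !hformDl hformZl vf df ff mulr1 !addr0.
have c2 : - (c / 2) != 0 by rewrite oppr_eq0 mulf_neq0// invr_neq0 ?pnatr_eq0.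
have nz u u' : hform J u u' != 0 -> u != 0 /\ u' != 0.
  move=> h; split; apply: contra_neq h => ->; first by rewrite hform0l.
  by rewrite -hform_conj// hform0l conjC0.
have [w0 _] : w != 0 /\ v0 != 0 by apply: nz; rewrite wv oner_neq0.
have [f0 _] : f != 0 /\ v0 != 0 by apply: nz; rewrite fv oner_neq0.
have [a va] := eig _ v0n v0i; have [b fb] := eig _ f0 ff; have [g wg] := eig _ w0 ww.
have ba : b * Num.conj a = 1 by apply: conjeig fb va _; rewrite fv oner_neq0.
have ga : g * Num.conj a = 1 by apply: conjeig wg va _; rewrite wv oner_neq0.
have gb : g * Num.conj b = 1 by apply: conjeig wg fb _; rewrite wf.
have a0 : Num.conj a != 0 by apply/eqP => a0; move: ba; rewrite a0 mulr0 => /eqP; rewrite eq_sym oner_eq0.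
have b0 : Num.conj b != 0 by apply/eqP => b0; move: gb; rewrite b0 mulr0 => /eqP; rewrite eq_sym oner_eq0.
have bg : b = g by apply: (mulIf a0); rewrite ba ga.
have ab : a = b.
  have aab : Num.conj a = Num.conj b.
    have g0 : g != 0 by apply/eqP => g0; move: ga; rewrite g0 mul0r => /eqP; rewrite eq_sym oner_eq0.
    by apply: (mulfI g0); rewrite ga gb.
  by rewrite -[a]conjCK aab conjCK.
have aa : a * Num.conj a = 1 by rewrite {1}ab.
have all_a u : u != 0 -> hform J u u = 0 -> u *m X = a *: u.
  move=> u0 uu; have [e ue] := eig _ u0 uu.
  have [uv|uv] := eqVneq (hform J u v0) 0.
    by have [k ->] := orthogonal_isotropic_colinear v0n v0i uu uv; rewrite -scalemxAl va scalerA mulrC -scalerA.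
  have ea := conjeig _ _ _ _ ue va uv.
  by rewrite ue; congr (_ *: _); apply: (mulIf a0); rewrite ea aa.
apply/is_scalar_mxP; exists a; apply/eqP; rewrite -subr_eq0; apply/eqP.
suff : (X - a%:M) *m J = 0 by move=> e0; rewrite -[X - _](mulmxK Ju) e0 mul0mx.
apply: (isotropic_pairs_separate Jsym Ju v0n v0i) => x y xx yy xy.
have [x0 _] := nz _ _ xy.
have e0 : x *m (X - a%:M) = 0 by rewrite mulmxBr all_a// mul_mx_scalar subrr.
by rewrite mulmxA e0 !mul0mx mxE.
Qed.

(** This recognizes scalars by a property of the abstract group. For an
    isotropic vector [w] put [N = i J w* w]; then [1 + t N] is an isometry for
    all real [t]. The conjugates of the matrix [X] of [x] by [1 + N] and [1 -
    N] have the sum [2 (X - N X N)], so [X] commutes with [N X N], which is a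
    multiple of [J w* w]. Unless the factor [h(w X, w)] vanishes, this makes
    [w] an eigenvector. If it vanishes, [w X] and [w] are isotropic and
    orthogonal, hence proportional. *)
Lemma conj_commute_scalar (x : unitary_group J) :
  (forall k : unitary_group J, commute x (k * x * k^-1)%g) -> is_scalar_mx (mx_of x).
Proof.
move=> xC; apply: (isotropic_eigen_scalar (mx_ofP x)) => w w0 ww.
have i0 := ci_neq0 R.
pose X := mx_of x; pose N := ci R *: (J *m ctr w *m w).
have hx u v : hform J (u *m X) (v *m X) = hform J u v.
  by rewrite /hform ctrM -{2}(mx_of_iso x) !mulmxA.
have NJ : J *m ctr N = - (N *m J).
  by rewrite /N ctrZ conj_ci !ctrM ctrK Jsym scaleNr mulmxN -scalemxAl -scalemxAr !mulmxA.
have NXN : N *m X *m N = (ci R * ci R * hform J (w *m X) w) *: (J *m ctr w *m w).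
  rewrite /N -!scalemxAl -scalemxAr !scalerA.
  have -> : J *m ctr w *m w *m X *m (J *m ctr w *m w) =
     J *m ctr w *m (w *m X *m J *m ctr w) *m w by rewrite !mulmxA.
  by rewrite hformE mul_mx_scalar -scalemxAl scalerA.
have NN : N *m N = 0.
  rewrite /N -scalemxAl -scalemxAr.
  have -> : J *m ctr w *m w *m (J *m ctr w *m w) = J *m ctr w *m (w *m J *m ctr w) *m w.
    by rewrite !mulmxA.
  by rewrite hformE ww raddf0 mulmx0 mul0mx !scaler0.
have mul_N := nilpotent_mul NN.
have isoN (t : R) : isometry_group Num.conj J (1%:M + creal t *: N).
  apply: isometry_unit Ju _; rewrite -mulmxA ctrD ctrZ ctr1 conj_creal mulmxDr mulmx1 -scalemxAr NJ.
  have -> : J + creal t *: - (N *m J) = (1%:M + creal (- t) *: N) *m J.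
    by rewrite mulmxDl mul1mx rmorphN -scalemxAl scaleNr scalerN.
  by rewrite mulmxA mul_N -rmorphD subrr rmorph0 scale0r addr0 mul1mx.
pose A t := (1%:M + creal t *: N) *m X *m (1%:M - creal t *: N).
have XA t : X *m A t = A t *m X.
  have := congr1 (@mx_of R 3 J) (xC (mk_unitary (isoN t))).
  rewrite !mx_ofM mx_ofV mk_unitaryE.
  have -> : invmx (1%:M + creal t *: N) = 1%:M - creal t *: N.
    have u : (1%:M + creal t *: N) *m (1%:M - creal t *: N) = 1%:M.
      by rewrite -scaleNr mul_N subrr scale0r addr0.
    have [uu _] := mulmx1_unit u.
    by apply: (can_inj (mulKmx uu)); rewrite mulmxV.
  by rewrite /A.
have AE : A 1 + A (-1) = (X - N *m X *m N) *+ 2.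
  rewrite /A rmorphN !rmorph1 !scaleN1r !scale1r opprK.
  rewrite !(mulmxDl, mulmxDr, mulNmx, mulmxN, mulmx1, mul1mx) mulr2n.
  move: (N *m X *m N) (N *m X) (X *m N) => p q r.
  by apply/matrixP => a b; rewrite !mxE; ring.
have comm : X *m (N *m X *m N) = (N *m X *m N) *m X.
  have := XA 1; have := XA (-1); move: (A 1) (A (-1)) AE => A1 A2 A12 XA2 XA1.
  have : X *m (A1 + A2) = (A1 + A2) *m X by rewrite mulmxDr XA1 XA2 mulmxDl.
  move: (N *m X *m N) A12 => NXN' ->.
  rewrite -[_ *+ 2]scaler_nat -scalemxAr -scalemxAl => /(congr1 (fun Y => 2^-1 *: Y)).
  rewrite !scalerA mulVf ?pnatr_eq0// !scale1r mulmxBr mulmxBl => /addrI /oppr_inj.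
  by [].
have [q0|q0] := eqVneq (hform J (w *m X) w) 0.
  by apply: orthogonal_isotropic_colinear; rewrite ?hx.
have [u uw] := hform_nondeg Ju w0.
have wu : hform J u w != 0 by rewrite -hform_conj// conjC_eq0.
pose kk := ci R * ci R * hform J (w *m X) w.
have kk0 : kk != 0 by exact: mulf_neq0 (mulf_neq0 i0 i0) q0.
have comm' : X *m (J *m ctr w *m w) = (J *m ctr w *m w) *m X.
  by move: comm; rewrite NXN -/kk -scalemxAr -(scalemxAl kk (J *m ctr w *m w)) => /(scalerI kk0).
have := congr1 (mulmx u) comm'; rewrite !mulmxA.
have -> : u *m X *m J *m ctr w = (hform J (u *m X) w)%:M by exact: hformE.
rewrite hformE !mul_scalar_mx -scalemxAl => e.
by exists ((hform J u w)^-1 * hform J (u *m X) w); rewrite -scalerA e scalerA mulVf// scale1r.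
Qed.

End CentralElements.

(** * Transport of isometries along a topological isomorphism *)

Section Transport.
Variables (R : realType) (d r : nat).
Local Notation C := (CC R).
Local Notation B := 'M['M[C]_d]_r.
Variables (psi : B -> 'M[C]_3) (psii : 'M[C]_3 -> B) (A : set B) (J : 'M[C]_3).
Hypotheses (psiK : cancel psi psii) (psiiK : cancel psii psi).
Hypotheses (psic : continuous psi) (psiic : continuous psii).
Hypothesis psiM : forall X Y, psi (X *m Y) = psi X *m psi Y.
Hypothesis AJ : forall X, A X <-> isometry_group Num.conj J (psi X).
Hypothesis Jsym : ctr J = J.

Lemma compact_anisotropic : compact A -> forall v : 'rV[C]_3, v != 0 -> hform J v v != 0.
Proof.
move=> cA v v0; apply/eqP => vv.
have [Bd BdP] := compact_mx_bounded psic cA.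
have [X XJ XB] := isotropic_unbounded Jsym Bd v0 vv.
by apply: XB; rewrite -[X]psiiK; apply: BdP; apply/AJ; rewrite psiiK.
Qed.

Lemma noncompact_isotropic : ~ compact A -> exists2 v : 'rV[C]_3, v != 0 & hform J v v = 0.
Proof.
move=> ncA; apply: contrapT => nv; apply: ncA.
have an (v : 'rV[C]_3) : v != 0 -> hform J v v != 0.
  by move=> v0; apply/eqP => vv; apply: nv; exists v.
have Ju := anisotropic_unit an.
have [Bd BdP] := anisotropic_bounded Jsym an.
have [K0 cK0 K0P] := mx_box_compact (R := R) 3 3 Bd.
have -> : A = psii @` (K0 `&` [set X : 'M[C]_3 | X *m J *m ctr X = J]).
  apply/seteqP; split => [X /AJ[_ XJ]|_ [X [_ XJ] <-]].
    by exists (psi X); [split => //; apply: K0P; exact: BdP|exact: psiK].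
  by apply/AJ; rewrite psiiK; exact: isometry_unit.
apply: continuous_compact; first exact: continuous_subspaceT.
by apply: compact_closedI => //; exact: closed_isometry_eq.
Qed.

Variables (H : 'M[C]_3) (f : set_type A -> unitary_group H).
Hypothesis fM : forall X Y Z : set_type A,
  set_val Z = set_val X *m set_val Y -> f Z = (f X * f Y)%g.
Hypothesis fc : continuous f.
Hypothesis fiso : exists g, [/\ continuous g, cancel f g & cancel g f].

(** Through [psi] the isomorphism [f] becomes one between two groups of 3 x 3
    matrices. The last clause keeps track of the elements that come from [D]. *)
Lemma unitary_transport :
  exists (fU : unitary_group J -> unitary_group H) (gU : unitary_group H -> unitary_group J),
  [/\ {morph fU : x y / (x * y)%g}, cancel fU gU, cancel gU fU, continuous fU & continuous gU] /\
  forall X : set_type A, mx_of (gU (f X)) = psi (set_val X).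
Proof.
have [g [gc fK gK]] := fiso.
have toAP (x : unitary_group J) : psii (mx_of x) \in A.
  by apply/mem_set/AJ; rewrite psiiK; exact: mx_ofP.
pose toA (x : unitary_group J) : set_type A := exist _ (psii (mx_of x)) (toAP x).
have toAE x : set_val (toA x) = psii (mx_of x) by [].
have ofAP (X : set_type A) : isometry_group Num.conj J (psi (set_val X)).
  by apply/AJ; exact: set_valP.
pose ofA (X : set_type A) : unitary_group J := mk_unitary (ofAP X).
have toK : cancel toA ofA.
  by move=> x; apply: mx_of_inj; rewrite mk_unitaryE /= psiiK.
have ofK : cancel ofA toA.
  by move=> X; apply: val_inj; rewrite /= mk_unitaryE psiK.
have toc : continuous toA.
  apply: continuous_comp_initial.
  have -> : set_val \o toA = (fun x => psii (mx_of x)) by [].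
  exact: comp_ctns (@mx_of_ctns _ _ _) psiic.
have ofc : continuous ofA.
  apply: to_unitary_ctns.
  have -> : (fun x => mx_of (ofA x)) = (fun X : set_type A => psi (set_val X)) by [].
  exact: comp_ctns (@initial_continuous _ _ _) psic.
exists (fun x => f (toA x)), (fun y => ofA (g y)); split; first split.
- move=> x y; apply: fM; apply: (can_inj psiK).
  by rewrite psiM !toAE !psiiK mx_ofM.
- by move=> x; rewrite fK toK.
- by move=> y; rewrite ofK gK.
- exact: comp_ctns toc fc.
- exact: comp_ctns gc ofc.
- by move=> X; rewrite fK mk_unitaryE.
Qed.

End Transport.

Section Nondegenerate.
Variables (R : realType) (J H : 'M[CC R]_3).
Local Notation C := (CC R).
Hypotheses (Jsym : ctr J = J) (Hsym : ctr H = H) (Hu : H \in unitmx).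
Variables (v0 : 'rV[C]_3).
Hypotheses (v0n : v0 != 0) (v0i : hform H v0 v0 = 0).
Variables (f : unitary_group J -> unitary_group H) (g : unitary_group H -> unitary_group J).
Hypotheses (fM : {morph f : x y / (x * y)%g}) (fK : cancel f g) (gK : cancel g f).
Hypotheses (fc : continuous f) (gc : continuous g).

Lemma transported_central (x : unitary_group J) :
  (forall k : unitary_group J, commute x (k * x * k^-1)%g) ->
  is_scalar_mx (mx_of (f x)) /\ forall y, commute x y.
Proof.
move=> xC.
have sc : is_scalar_mx (mx_of (f x)).
  apply: (conj_commute_scalar Hsym Hu v0n v0i) => k.
  have := xC (g k); rewrite /commute => /(congr1 f).
  by rewrite !fM (group_morphV fM) gK.
split=> // y; apply: (can_inj fK); rewrite !fM.
by apply/esym/scalar_unitaryC.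
Qed.

(** If [J] is degenerate, [U(J)] has an element that commutes with all its
    conjugates without being central, whereas in [U(H)] such an element is
    scalar. For [v] in the radical and [J u* <> 0] it is [1 + Y] with [Y = J
    u* v]: its conjugates are of the form [1 + Y'] with [Y Y' = Y' Y = 0], but
    it does not commute with [1 + c v], where [v c = 1]. The case [J = 0] is
    excluded by boundedness. *)
Lemma transported_form_unit : J \in unitmx.
Proof.
apply: contrapT => /negP Jnu.
have [v vJ v0'] : exists2 v : 'rV[C]_3, v *m J = 0 & v != 0.
  have /rowV0Pn[v /sub_kermxP vJ v1] : kermx J != 0 by rewrite kermx_eq0 row_free_unit.
  by exists v.
have Jv : J *m ctr v = 0 by rewrite -{1}Jsym -ctrM vJ ctr0.
have iso1 (p : 'M[C]_3) : p *m J = 0 -> (1%:M + p) *m J *m ctr (1%:M + p) = J.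
  move=> pJ; have Jp : J *m ctr p = 0 by rewrite -{1}Jsym -ctrM pJ ctr0.
  by rewrite mulmxDl mul1mx pJ addr0 ctrD ctr1 mulmxDr mulmx1 Jp addr0.
(* When J = 0 the scalar 2 is an isometry. Its powers are unbounded, but their
   images are scalars of modulus 1 and stay in a compact set. *)
have [J0|J0] := eqVneq J 0.
  pose two : 'M[C]_3 := 2%:M.
  have twoP : isometry_group Num.conj J two.
    split; last by rewrite J0 mulmx0 mul0mx.
    by exists (2^-1)%:M; rewrite -!scalar_mxM mulfV ?mulVf ?pnatr_eq0.
  pose x := mk_unitary twoP.
  have [sc _] : is_scalar_mx (mx_of (f x)) /\ forall y, commute x y.
    apply: transported_central => k.
    have xC y : (x * y = y * x)%g by apply: mx_of_inj; rewrite !mx_ofM mk_unitaryE scalar_mxC.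
    by rewrite -xC /commute mulgK.
  have [z fz] := is_scalar_mxP sc.
  have zz : `|z| = 1.
    have := mx_of_iso (f x); rewrite fz /ctr map_scalar_mx tr_scalar_mx mul_scalar_mx mul_mx_scalar scalerA => e.
    have : (Num.conj z * z - 1) *: H = 0 by rewrite scalerBl scale1r e subrr.
    have H0 : H != 0 by apply: contraTneq Hu => ->; rewrite unitr0.
    move/eqP; rewrite scaler_eq0 (negPf H0) orbF subr_eq0 mulrC -normCK => /eqP z2.
    by apply/eqP; rewrite -(@eqrXn2 _ 2)// ?z2 ?expr1n.
  have [Kc cK KcP] := bounded_unitary_compact 1 Hu.
  have fxk k : mx_bounded 1 (mx_of (f (x ^+ k)%g)).
    have -> : mx_of (f (x ^+ k)%g) = (z ^+ k)%:M.
      elim: k => [|k IH]; first by rewrite expg0 (group_morph1 fM) expr0.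
      by rewrite expgS fM mx_ofM fz IH exprS scalar_mxM.
    move=> i j; rewrite mxE rmorph1; case: (i == j); rewrite ?mulr1n ?mulr0n ?normr0//.
    by rewrite normrX zz expr1n.
  have cgK : compact (g @` Kc) by apply: continuous_compact cK; exact: continuous_subspaceT.
  have [Bd BdP] := compact_mx_bounded (@mx_of_ctns R 3 J) cgK.
  have bd k : 2 ^+ k <= Bd.
    have := BdP (x ^+ k)%g; rewrite -creal_le => /(_ _ 0 0) h; apply: le_trans (h _).
      have -> : mx_of (x ^+ k)%g = (2 ^+ k)%:M.
        by elim: k {h} => [|k IH]; rewrite ?expg0 ?expr0// expgS mx_ofM IH exprS scalar_mxM.
      by rewrite mxE eqxx mulr1n normrX normr_nat rmorphXn rmorph_nat.
    by exists (f (x ^+ k)%g); [exact: KcP|exact: fK].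
  have := bd (Num.bound `|Bd|); apply/negP; rewrite -ltNge.
  apply: (le_lt_trans (ler_norm _)); apply: lt_le_trans (archi_boundP _) _ => //.
  by rewrite -natrX ler_nat ltnW// ltn_expl.
have [u uJ] : exists u : 'rV[C]_3, J *m ctr u != 0.
  apply: contrapT => nu; move: J0; apply/negP; rewrite negbK; apply/eqP/matrixP => i j.
  rewrite [RHS]mxE; apply/eqP/negPn/negP => Jij; apply: nu; exists (delta_mx 0 j).
  apply: contraNneq Jij => /colP/(_ i).
  have -> : ctr (delta_mx 0 j : 'rV[C]_3) = delta_mx j 0.
    by apply/matrixP => a b; rewrite !mxE conjC_nat andbC.
  by rewrite -colE !mxE => ->.
pose Y : 'M[C]_3 := J *m ctr u *m v.
have Y0 : Y != 0 by exact: rank1_neq0.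
have YJ : Y *m J = 0 by rewrite -mulmxA vJ mulmx0.
have YY : Y *m Y = 0.
  by rewrite /Y !mulmxA -(mulmxA (J *m ctr u) v J) vJ mulmx0 !mul0mx.
have [c vc] : exists c : 'cV[C]_3, v *m c = 1%:M.
  have /rV0Pn[i vi] := v0'.
  exists ((v 0 i)^-1 *: delta_mx i 0); rewrite -scalemxAr -colE.
  by apply/matrixP => a b; rewrite !ord1 !mxE mulVf.
have xP : isometry_group Num.conj J (1%:M + Y).
  split; last exact: iso1.
  exists (1%:M - Y); rewrite mulmxDl mulmxBl !mulmxDr !mulmxN !mul1mx !mulmx1 YY.
  by rewrite oppr0 !addr0 subrK addrK.
pose p : 'M[C]_3 := c *m v.
have pp : p *m p = p by rewrite /p mulmxA -(mulmxA c v c) vc mulmx1.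
have pJ : p *m J = 0 by rewrite -mulmxA vJ mulmx0.
have tP : isometry_group Num.conj J (1%:M + p).
  split; last exact: iso1.
  have e : (1%:M + p) *m (1%:M - 2^-1 *: p) = 1%:M.
    rewrite mulmxDl mul1mx mulmxBr mulmx1 -scalemxAr pp.
    have hp : p - 2^-1 *: p = 2^-1 *: p.
      have h2 : (2^-1 + 2^-1 : C) = 1 by field.
      by apply/eqP; rewrite subr_eq -scalerDl h2 scale1r.
    by rewrite hp subrK.
  by exists (1%:M - 2^-1 *: p); split=> //; exact: mulmx1C.
pose x := mk_unitary xP; pose t := mk_unitary tP.
have invJ (k : unitary_group J) : mx_of k *m J = J *m ctr (mx_of (k^-1)%g).
  transitivity ((mx_of k *m J *m ctr (mx_of k)) *m ctr (mx_of (k^-1)%g)).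
    by rewrite -mulmxA -ctrM mx_ofV mulVmx ?mx_of_unit// ctr1 mulmx1.
  by rewrite mx_of_iso.
have vkJ (k : unitary_group J) : v *m mx_of k *m J = 0.
  by rewrite -mulmxA invJ mulmxA vJ mul0mx.
have [_ xC] : is_scalar_mx (mx_of (f x)) /\ forall y, commute x y.
  apply: transported_central => k; apply: mx_of_inj.
  rewrite !mx_ofM; set k1 := mx_of k; set k2 := mx_of (k^-1)%g.
  have kk : k1 *m k2 = 1%:M by rewrite /k2 mx_ofV mulmxV ?mx_of_unit.
  have -> : k1 *m mx_of x *m k2 = 1%:M + k1 *m Y *m k2.
    by rewrite mk_unitaryE mulmxDr mulmx1 mulmxDl kk.
  have e1 : Y *m (k1 *m Y *m k2) = 0.
    by rewrite /Y !mulmxA -(mulmxA (J *m ctr u) v k1) -(mulmxA (J *m ctr u) (v *m k1) J) vkJ mulmx0 !mul0mx.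
  have e2 : k1 *m Y *m k2 *m Y = 0.
    by rewrite /Y !mulmxA -(mulmxA (k1 *m J *m ctr u) v k2) -(mulmxA (k1 *m J *m ctr u) (v *m k2) J) vkJ mulmx0 !mul0mx.
  rewrite mk_unitaryE mulmxDl mul1mx mulmxDr mulmx1 e1 addr0.
  by rewrite mulmxDl mul1mx mulmxDr mulmx1 e2 addr0 -!addrA (addrC (k1 *m Y *m k2)).
have := congr1 (@mx_of R 3 J) (xC t); rewrite !mx_ofM !mk_unitaryE.
have pY : p *m Y = 0 by rewrite /p /Y !mulmxA -(mulmxA c v J) vJ mulmx0 !mul0mx.
have Yp : Y *m p = Y by rewrite /p /Y mulmxA -(mulmxA (J *m ctr u) v c) vc mulmx1.
rewrite mulmxDl mul1mx mulmxDr mulmx1 Yp mulmxDl mul1mx mulmxDr mulmx1 pY addr0.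
move=> e; move: Y0; apply/negP; rewrite negbK; apply/eqP.
apply: (addrI (1%:M + p + Y)); rewrite addr0 -[RHS]addrA (addrC p) addrA -e.
by rewrite -!addrA.
Qed.

End Nondegenerate.

(** * Finite index, coordinates and traces *)

Section FiniteIndex.
Local Open Scope group_scope.

(** Two of the powers of [p] with exponents from 0 to the number [N] of cosets
    lie in the same coset, so [p ^+ q] is in [B] for some [q] with [0 < q <=
    N], and every such [q] divides the factorial of [N]. *)
Lemma finite_index_exponent (G : groupType) (A B : set G) :
  finite_index A (A `&` B) -> A 1 -> B 1 ->
  (forall x y, A x -> A y -> A (x * y)) -> (forall x y, B x -> B y -> B (x * y)) ->
  exists m, forall p, A p -> B (p ^+ m.+1).
Proof.
move=> /finite_seqP[s sE] A1 B1 AM BM.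
pose N := size s; exists (N`!).-1 => p Ap.
have Apow k : A (p ^+ k) by elim: k => [|k IH]; rewrite ?expg0// expgS; exact: AM.
have Bpow q k : B q -> B (q ^+ k.+1).
  by move=> Bq; elim: k => [|k IH]; rewrite ?expg1// expgS; exact: BM.
pose co k := [set p ^+ k * b | b in A `&` B].
have cos k : co k \in s.
  have : [set [set a * b | b in A `&` B] | a in A] (co k) by exists (p ^+ k).
  by rewrite sE.
have ltN k : (index (co k) s < N)%N by rewrite index_mem.
pose F (k : 'I_N.+1) : 'I_N := Ordinal (ltN k).
have [i [j [ij Fij]]] : exists i j : 'I_N.+1, i != j /\ F i = F j.
  apply: contrapT => nex; have /leq_card : injective F.
    by move=> i j Fij; apply/eqP/negPn/negP => ij; apply: nex; exists i, j.
  by rewrite !card_ord ltnn.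
have coij : co i = co j.
  by rewrite -[LHS](nth_index set0 (cos i)) -[RHS](nth_index set0 (cos j)); case: Fij => ->.
wlog ltij : i j ij coij {Fij} / (i < j)%N.
  move=> W; have [ltij|ltji|/val_inj/eqP e] := ltngtP i j; first exact: (W i j).
    by apply: (W j i); rewrite // eq_sym.
  by rewrite e in ij.
have : co j (p ^+ j) by exists 1; rewrite ?mulg1.
rewrite -coij => -[b [Ab Bb] pb].
have bE : b = p ^+ (j - i) by apply: (@mulgI _ (p ^+ i)); rewrite pb -expgnDr subnKC// ltnW.
have /dvdnP[q qE] : (j - i %| N`!)%N.
  by rewrite dvdn_fact// subn_gt0 ltij (leq_trans (leq_subr _ _))// -ltnS.
have q0 : (0 < q)%N by move: (fact_gt0 N); rewrite qE; case: (q).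
by rewrite prednK ?fact_gt0// qE mulnC expgnA -bE -(prednK q0); exact: Bpow.
Qed.

End FiniteIndex.

Section Coordinates.

(** As [U] carries no scalar multiplication, the last clause speaks of two
    rows [x] and [y] whose entries have proportional images under [h]. *)
Lemma flatten_rows (k : pzRingType) (U : zmodType) m (h : U -> 'rV[k]_m) n :
  {morph h : x y / x + y} -> bijective h ->
  exists H : 'rV[U]_n -> 'rV[k]_(n * m), [/\ {morph H : x y / x + y}, bijective H &
    forall (a : k) (x y : 'rV[U]_n), (forall i, h (y 0 i) = a *: h (x 0 i)) -> H y = a *: H x].
Proof.
move=> hD [h' hK h'K].
pose H (x : 'rV[U]_n) := mxvec (\matrix_(i < n) h (x 0 i)).
exists H; split.
- by move=> x y; rewrite /H -linearD; congr mxvec; apply/row_matrixP => i; rewrite linearD /= !rowK mxE hD.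
- exists (fun y => \row_i h' (row i (vec_mx y))).
    by move=> x; apply/rowP => i; rewrite mxE /H mxvecK rowK hK.
  move=> y; rewrite /H -[RHS]vec_mxK; congr mxvec; apply/row_matrixP => i.
  by rewrite rowK mxE h'K.
- move=> a x y hxy; rewrite /H -linearZ; congr mxvec; apply/row_matrixP => i.
  by rewrite linearZ /= !rowK hxy.
Qed.

Lemma vector_coordinates (k : fieldType) (V : vectType k) :
  exists h : V -> 'rV[k]_(\dim {:V}), [/\ {morph h : x y / x + y}, bijective h &
    forall a x, h (a *: x) = a *: h x].
Proof.
pose h (v : V) : 'rV[k]_(\dim {:V}) := \row_i coord (vbasis {:V}) i v.
exists h; split.
- by move=> x y; apply/rowP => i; rewrite !mxE linearD.
- exists (fun y : 'rV[k]_(\dim {:V}) => \sum_i y 0 i *: (vbasis {:V})`_i) => [x|y].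
    by rewrite [RHS](coord_vbasis (memvf x)); apply: eq_bigr => i _; rewrite mxE.
  by apply/rowP => i; rewrite mxE coord_sum_free // (basis_free (vbasisP _)).
- by move=> a x; apply/rowP => i; rewrite !mxE linearZ.
Qed.

Lemma matrix_coordinates (k : fieldType) (V : vectType k) r :
  exists H : 'M[V]_r -> 'rV[k]_(r * r * \dim {:V}), [/\ {morph H : x y / x + y}, bijective H &
    forall a x, H (map_mx (fun v => a *: v) x) = a *: H x].
Proof.
have [h [hD hb hZ]] := vector_coordinates V.
have [H [HD Hb HZ]] := flatten_rows (r * r) hD hb.
exists (fun X => H (mxvec X)); split.
- move=> X Y; rewrite -HD; congr H; apply/rowP => i.
  by have [i1 j1] := mxvec_indexP i; rewrite mxE !mxvecE mxE.
- by apply: bij_comp => //; exists vec_mx; [exact: mxvecK|exact: vec_mxK].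
- move=> a X; apply: HZ => i; have [i1 j1] := mxvec_indexP i.
  by rewrite !mxvecE !mxE hZ.
Qed.

End Coordinates.

Section Spanning.
Variables (K : fieldType) (n : nat) (P : 'rV[K]_n -> Prop).

(** The rows are chosen one at a time: a column that is killed by the rows
    chosen so far is not killed by all of [P]. *)
Lemma spanning_rows : (forall c : 'cV[K]_n, (forall v, P v -> v *m c = 0) -> c = 0) ->
  exists2 M : 'M[K]_n, M \in unitmx & forall i, P (row i M).
Proof.
move=> Pc.
suff main k : (k <= n)%N -> exists M : 'M[K]_(k, n), row_free M /\ forall i, P (row i M).
  have [M [Mf MP]] := main n (leqnn n); exists M => //; by rewrite -row_free_unit.
elim: k => [_|k IH kn]; first by exists 0; split; [rewrite /row_free mxrank0|case].
have [M [Mf MP]] := IH (ltnW kn).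
have [|c cM c0] := right_null_vector (A := M); first by rewrite (eqP Mf).
have [v Pv vc] : exists2 v, P v & v *m c != 0.
  apply: contrapT => nex; move: c0; apply/negP; rewrite negbK; apply/eqP/Pc => v Pv.
  by apply/eqP/negPn/negP => ?; apply: nex; exists v.
exists (col_mx v M : 'M[K]_(1 + k, n)); split.
  apply/row_freeP; apply: contrapT => nf.
  have : ~~ row_free (col_mx v M) by apply/negP => /row_freeP.
  rewrite -kermx_eq0 => /rowV0Pn[x /sub_kermxP xM x0].
  move: xM; rewrite -[x]hsubmxK mul_row_col => e.
  have : lsubmx x *m (v *m c) = 0.
    have := congr1 (mulmx^~ c) e; rewrite mulmxDl -!mulmxA cM mulmx0 addr0 mul0mx //.
  rewrite [lsubmx x]mx11_scalar mul_scalar_mx => /eqP; rewrite scaler_eq0 (negPf vc) orbF => /eqP l0.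
  have lx : lsubmx x = 0 by rewrite [LHS]mx11_scalar l0 raddf0.
  move: e; rewrite lx mul0mx add0r => rM.
  have rx : rsubmx x = 0 by apply: (row_free_inj Mf); rewrite rM mul0mx.
  by move: x0; rewrite -[x]hsubmxK lx rx row_mx0 eqxx.
move=> i; case: (@split_ordP 1 k i) => j ->.
  by rewrite (_ : row _ _ = v)//; apply/rowP => l; rewrite mxE (@col_mxEu _ 1 k) ord1.
by rewrite (_ : row _ _ = row j M)//; apply/rowP => l; rewrite mxE (@col_mxEd _ 1 k) [RHS]mxE.
Qed.

End Spanning.

Section Traces.

(** When [B] is the inverse of [A], this is the trace of the adjoint action of
    [A]. *)
Lemma trace_conjugation (K : comNzRingType) n (A B : 'M[K]_n) :
  \tr (lin_mx (mulmxr B \o mulmx A : 'M[K]_n -> 'M[K]_n)) = \tr A * \tr B.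
Proof.
rewrite /mxtrace (reindex _ (curry_mxvec_bij n n)) /=.
rewrite big_distrlr /= pair_bigA /=; apply: eq_bigr => -[i j] _ /=.
rewrite !mxE /= vec_mx_delta mxvecE mxE (bigD1 j) //= [X in _ + X]big1 ?addr0 => [|k kj].
  rewrite mxE (bigD1 i) //= big1 ?addr0 => [|k ki]; first by rewrite mxE !eqxx mulr1.
  by rewrite mxE (negPf ki) mulr0.
by rewrite mxE big1 ?mul0r // => l _; rewrite mxE (negPf kj) andbF mulr0.
Qed.

(** Newton's identity expresses the determinant by traces of powers, from
    which it inherits rationality. *)
Lemma newton3 (K : comNzRingType) (A : 'M[K]_3) :
  \tr A ^+ 3 - 3 * \tr A * \tr (A *m A) + 2 * \tr (A *m A *m A) = 6 * \det A.
Proof.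
rewrite (expand_det_row _ ord0) !big_ord_recl big_ord0 /cofactor.
rewrite !(expand_det_row _ ord0) !big_ord_recl !big_ord0 /cofactor !det_mx11.
rewrite /mxtrace !big_ord_recl !big_ord0 /=.
pose i0 : 'I_3 := ord0; pose i1 : 'I_3 := lift ord0 ord0; pose i2 : 'I_3 := lift ord0 (lift ord0 ord0).
have mulE (X Y : 'M[K]_3) i j : (X *m Y) i j = X i i0 * Y i0 j + X i i1 * Y i1 j + X i i2 * Y i2 j.
  by rewrite mxE !big_ord_recl big_ord0 addr0 addrA.
rewrite !mulE !mxE.
have e1 : lift (lift ord0 ord0) (ord0 : 'I_2) = i0 by exact: val_inj.
have e2 : lift (lift ord0 (lift ord0 ord0)) (ord0 : 'I_2) = i0 by exact: val_inj.
have e3 : lift (lift ord0 ord0) (lift ord0 ord0 : 'I_2) = i2 by exact: val_inj.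
have e4 : lift (lift ord0 (lift ord0 ord0)) (lift ord0 ord0 : 'I_2) = i1 by exact: val_inj.
rewrite ?e1 ?e2 ?e3 ?e4 -/i0 -/i1 -/i2.
have e5 x : lift i1 (lift (lift ord0 ord0) x) = i0 by apply: val_inj; case: x => -[].
have e6 x : lift i2 (lift (lift ord0 ord0) x) = i0 by apply: val_inj; case: x => -[].
have e7 x : lift ord0 (lift (lift ord0 ord0) x) = i1 by apply: val_inj; case: x => -[].
rewrite ?e5 ?e6 ?e7 /bump /= !addn0 !addr0 /= !(expr0, expr1, sqrrN, expr1n, mul1r, mulN1r).
move: (A i0 i0) (A i0 i1) (A i0 i2) (A i1 i0) (A i1 i1) (A i1 i2) (A i2 i0) (A i2 i1) (A i2 i2).
move=> a b c d e f g h i; ring.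
Qed.

End Traces.

(** * Rationality of the trace of the adjoint action *)

Section TraceDescent.
Variables (R : realType) (F : fieldExtType rat) (E : fieldExtType F) (D : falgType E).
Local Notation C := (CC R).
Variables (tau : D -> D) (r : nat) (iota : F -> R) (m : unitary_model tau r iota).
Hypothesis dimA : (r * r * \dim {: D} = 3 * 3)%N.

Let rho0 : rho m 0 = 0.
Proof. exact: additive0 (rhoD m). Qed.

Let rho_sum (I : finType) (G : I -> 'M[D]_r) : rho m (\sum_i G i) = \sum_i rho m (G i).
Proof. by apply: big_morph => //; exact: rhoD. Qed.

(** The rows of [M] are a basis of the complex matrices and at the same time a
    basis over [E] of the image of [rho]. In this basis [T] has entries in the
    image of [E]. *)
Lemma trace_in_base (M T : 'M[C]_(3 * 3)) : M \in unitmx ->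
  (forall i, exists Z, row i M = mxvec (rho m Z)) ->
  (forall i, exists Z, row i M *m T = mxvec (rho m Z)) ->
  exists q, \tr T = eps m q.
Proof.
move=> Mu /(fun h => boolp.choice h)[Z ZE] /(fun h => boolp.choice h)[W WE].
have [H [HD [H' HK H'K] HZ]] : exists H : 'M[D]_r -> 'rV[E]_(3 * 3),
    [/\ {morph H : x y / x + y}, bijective H &
    forall a x, H (map_mx (fun v => a *: v) x) = a *: H x].
  by rewrite -dimA; exact: matrix_coordinates.
have H0 : H 0 = 0 := additive0 HD.
have comb (u : 'rV[E]_(3 * 3)) :
    mxvec (rho m (\sum_i escale (u 0 i) (Z i))) = map_mx (eps m) u *m M /\
    H (\sum_i escale (u 0 i) (Z i)) = u *m \matrix_i H (Z i).
  split.
    rewrite rho_sum linear_sum mulmx_sum_row; apply: eq_bigr => i _.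
    by rewrite rhoZ linearZ ZE mxE.
  rewrite (big_morph H HD H0) mulmx_sum_row; apply: eq_bigr => i _.
  by rewrite rowK -HZ.
have Nu : \matrix_i H (Z i) \in unitmx.
  rewrite -row_free_unit -kermx_eq0; apply/eqP/row_matrixP => i; rewrite row0.
  have /sub_kermxP uN := row_sub i (kermx (\matrix_i H (Z i))).
  move: (row i _) uN => u uN; have [c1 c2] := comb u.
  have s0 : \sum_i escale (u 0 i) (Z i) = 0 by rewrite -[LHS]HK c2 uN -H0 HK.
  have eu : map_mx (eps m) u = 0.
    by rewrite -[LHS](mulmxK Mu) -c1 s0 rho0 linear0 mul0mx.
  by apply/eqP; rewrite -(map_mx_eq0 (eps m)) eu.
pose Q := \matrix_i (H (W i) *m invmx (\matrix_i H (Z i))).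
have QM : M *m T = map_mx (eps m) Q *m M.
  apply/row_matrixP => i; rewrite !row_mul WE -map_row rowK.
  have [<- c2] := comb (H (W i) *m invmx (\matrix_i H (Z i))).
  by congr (mxvec (rho m _)); rewrite -[RHS]HK c2 mulmxKV// HK.
exists (\tr Q); rewrite -trace_map_mx.
by rewrite -[X in \tr X = _](mulKmx Mu) QM mxtrace_mulC mulmxK.
Qed.

Lemma rho_rows : exists2 M : 'M[C]_(3 * 3), M \in unitmx &
  forall i, exists Z, row i M = mxvec (rho m Z).
Proof.
apply: (@spanning_rows C (3 * 3) (fun v => exists Z, v = mxvec (rho m Z))) => c cE.
have cY (Y : 'M[C]_3) : mxvec Y *m c = 0.
  have [s ->] := rho_span m Y; rewrite linear_sum mulmx_suml big1_seq // => p _.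
  by rewrite linearZ -scalemxAl cE ?scaler0 //; exists p.2.
apply/row_matrixP => i; rewrite row0 -(cY (vec_mx (delta_mx 0 i))) vec_mxK.
by rewrite rowE.
Qed.

(** Left multiplication by [rho m Y] preserves the image of [rho], and its
    trace is three times that of [rho m Y]. *)
Lemma rho_trace Y : exists q, \tr (rho m Y) = eps m q.
Proof.
have [M Mu MZ] := rho_rows.
have [q qE] : exists q, \tr (lin_mx (mulmxr 1%:M \o mulmx (rho m Y) : 'M[C]_3 -> 'M[C]_3)) = eps m q.
  apply: (trace_in_base Mu MZ) => i; have [Z ->] := MZ i; exists (Y *m Z).
  by rewrite mul_vec_lin /= mulmx1 rhoM.
exists (q / 3); rewrite rmorphM fmorphV /= -qE trace_conjugation mxtrace1 rmorph_nat.
by rewrite mulfK // pnatr_eq0.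
Qed.

Lemma rho_det Y : exists q, \det (rho m Y) = eps m q.
Proof.
have [q1 e1] := rho_trace Y; have [q2] := rho_trace (Y *m Y).
have [q3] := rho_trace (Y *m Y *m Y); rewrite !rhoM => e3 e2.
exists ((q1 ^+ 3 - 3 * q1 * q2 + 2 * q3) / 6).
rewrite rmorphM fmorphV /= rmorphD rmorphB rmorphXn !rmorphM !rmorph_nat /= -e1 -e2 -e3.
by rewrite newton3 mulrC mulKf // pnatr_eq0.
Qed.

End TraceDescent.

Section AdjointTrace.
Variables (R : realType) (F : fieldExtType rat) (E : fieldExtType F) (D : falgType E).
Local Notation C := (CC R).
Variables (tau : D -> D) (r : nat) (iota : F -> R) (m : unitary_model tau r iota).
Hypothesis dimA : (r * r * \dim {: D} = 3 * 3)%N.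
Variables (H J : 'M[C]_3).
Hypotheses (Hu : H \in unitmx) (Jsym : ctr J = J) (Ju : J \in unitmx).
Variable Gamma : groupClosed (unitary_group H).
Hypothesis Gmu : has_finite_invariant_measure Gamma.
Variables (f : unitary_group J -> unitary_group H) (g : unitary_group H -> unitary_group J).
Hypotheses (fM : {morph f : x y / (x * y)%g}) (fK : cancel f g) (gK : cancel g f).
Hypotheses (gc : continuous g).
Variables (v : 'rV[C]_3) (e : nat).
Hypotheses (v0 : v != 0) (vv : hform J v v = 0).
Hypothesis alg : forall c, c \in Gamma ->
  exists s Y, mx_of (g (c ^+ e.+1)%g) = s *: rho m Y.

(** This expression does not change when [W] is multiplied by a scalar, and it
    is compatible with conjugation. *)
Let nu (W : 'M[C]_3) : 'M[C]_3 := (\det W)^-1 *: (W *m W *m W).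

Let nu_alg c : c \in Gamma -> exists Z, nu (mx_of (g (c ^+ e.+1)%g)) = rho m Z.
Proof.
move=> cG; have [s [Y WE]] := alg cG; have Wu := mx_of_unit (g (c ^+ e.+1)%g).
have [q qE] := rho_det m dimA Y.
move: Wu; rewrite unitmxE unitfE /nu WE detZ qE => sq.
have s0 : s != 0 by apply: contraNneq sq => ->; rewrite expr0n mul0r.
exists (escale (q^-1) (Y *m Y *m Y)); rewrite rhoZ !rhoM fmorphV /=.
rewrite -!(scalemxAl, scalemxAr) !scalerA invfM; congr (_ *: _).
by rewrite (mulrC (s ^- 3)) -!mulrA -expr2 -exprS mulVf ?mulr1 ?expf_neq0.
Qed.

Let g_conj (x c : unitary_group H) k :
  mx_of (g ((x * c * x^-1) ^+ k)%g) = mx_of (g x) *m mx_of (g (c ^+ k)%g) *m invmx (mx_of (g x)).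
Proof.
have -> : ((x * c * x^-1) ^+ k = x * c ^+ k * x^-1)%g.
  elim: k => [|k IH]; first by rewrite !expg0 mulg1 mulgV.
  by rewrite !expgS IH !mulgA mulgVK.
have gM := group_morph_can fM fK gK.
have -> : g (x * c ^+ k * x^-1)%g = (g x * g (c ^+ k) * (g x)^-1)%g.
  by rewrite !gM (group_morphV gM).
by [].
Qed.

(** By [trace_separation] nine of the matrices [nu (g (c ^+ e.+1))] form a
    basis of the space of matrices. They lie in the image of [rho], and
    conjugation by [g c0] carries each of them to another matrix of this kind,
    so [trace_in_base] applies. *)
Lemma adjoint_trace c0 : c0 \in Gamma ->
  exists q, \tr (mx_of (g c0)) * \tr (invmx (mx_of (g c0))) = eps m q.
Proof.
move=> c0G; set G := mx_of (g c0).
have Gu : G \in unitmx by exact: mx_of_unit.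
pose P (w : 'rV[C]_(3 * 3)) := exists2 c, c \in Gamma & w = mxvec (nu (mx_of (g (c ^+ e.+1)%g))).
have [M Mu MP] : exists2 M, M \in unitmx & forall i, P (row i M).
  apply: spanning_rows => y yP; pose T := vec_mx y^T : 'M[C]_3.
  have Ty (A : 'M[C]_3) : mxvec A *m y = (\tr (T^T *m A))%:M.
    rewrite [LHS]mx11_scalar; congr (_%:M); rewrite mxE (reindex _ (curry_mxvec_bij 3 3)) /=.
    rewrite mxtrace_mulC /mxtrace; under [RHS]eq_bigr => i _ do rewrite mxE.
    by rewrite pair_bigA /=; apply: eq_bigr => -[i j] _ /=; rewrite mxvecE !mxE.
  have T0 : T^T = 0.
    apply: (trace_separation Hu Jsym Ju Gmu fM fK gK gc (N := (e.+1 * 3).-1) v0 vv) => c cG.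
    have := yP _ (ex_intro2 _ _ c cG erefl); rewrite Ty => /(congr1 (fun M : 'M[C]_1 => M 0 0)).
    rewrite !mxE eqxx mulr1n /nu -scalemxAr linearZ /= => /eqP.
    rewrite mulf_eq0 invr_eq0.
    have /negPf -> /= : \det (mx_of (g (c ^+ e.+1)%g)) != 0.
      by rewrite -unitfE -unitmxE mx_of_unit.
    rewrite (_ : (e * 3).+3 = (e.+1 * 3)%N)// exprM -mx_of_exp.
    have -> : (g c ^+ e.+1 = g (c ^+ e.+1))%g.
      by rewrite (group_morphX (group_morph_can fM fK gK)).
    by move=> /eqP; rewrite !exprS expr0 mulr1 !mulmxA.
  apply: trmx_inj; rewrite -[y^T]vec_mxK.
  by rewrite -/T -[T]trmxK T0 !linear0.
have [q qE] : exists q, \tr (lin_mx (mulmxr (invmx G) \o mulmx G : 'M[C]_3 -> 'M[C]_3)) = eps m q.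
  have MZ i : exists Z, row i M = mxvec (rho m Z).
    by have [c cG ->] := MP i; have [Z ->] := nu_alg cG; exists Z.
  apply: (trace_in_base dimA Mu MZ) => i; have [c cG ->] := MP i.
  have cG' : (c0 * c * c0^-1)%g \in Gamma by rewrite !gpredM ?gpredV.
  have [Z ZE] := nu_alg cG'; exists Z; rewrite mul_vec_lin /= -ZE g_conj -/G.
  rewrite /nu !det_mulmx det_inv mulrAC mulfV ?mul1r; last by rewrite -unitfE -unitmxE.
  rewrite -scalemxAr -scalemxAl; congr (mxvec (_ *: _)).
  by rewrite !mulmxA !mulmxKV.
by exists q; rewrite -qE trace_conjugation.
Qed.

End AdjointTrace.

(** * Matrices of finite order with a noncommutative centralizer *)

Section FiniteOrderMatrices.
Variable C : numClosedFieldType.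

Lemma finite_order_diag n m (A : 'M[C]_m.+1) : (0 < n)%N -> A ^+ n = 1 ->
  exists P (d : 'rV[C]_m.+1), P \in unitmx /\ P *m A = diag_mx d *m P.
Proof.
move=> n0 An.
have /diagonalizableP dA : exists2 rs, uniq rs & mxminpoly A %| \prod_(x <- rs) ('X - x%:P).
  have [rs rsE] := closed_field_poly_normal ('X^n - 1 : {poly C}).
  have lc : lead_coef ('X^n - 1 : {poly C}) = 1 by apply/monicP; exact: monicXnsubC.
  rewrite lc scale1r in rsE; exists rs; last first.
    rewrite -rsE; apply: mxminpoly_min.
    by rewrite rmorphB rmorphXn rmorph1 /= horner_mx_X An subrr.
  by rewrite -separable_prod_XsubC -rsE separable_Xn_sub_1 // pnatr_eq0 -lt0n.
have [P Pu /diagonalizable_forPex[d /(simmxP Pu) e]] := dA.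
by exists P, d.
Qed.

Lemma diag_mx_exp m (d : 'rV[C]_m.+1) k : diag_mx d ^+ k = diag_mx (map_mx (fun x => x ^+ k) d).
Proof.
elim: k => [|k IH].
  by rewrite expr0; apply/matrixP => i j; rewrite !mxE expr0.
rewrite exprS IH; change (diag_mx d *m diag_mx (map_mx (fun x => x ^+ k) d) = diag_mx (map_mx (fun x => x ^+ k.+1) d)).
by rewrite mulmx_diag; congr diag_mx; apply/rowP => i; rewrite !mxE exprS.
Qed.

Section Diag.
Variables (m : nat) (A P : 'M[C]_m.+1) (d : 'rV[C]_m.+1).
Hypotheses (Pu : P \in unitmx) (PA : P *m A = diag_mx d *m P).

Lemma diag_exp k : A ^+ k = invmx P *m diag_mx (map_mx (fun x => x ^+ k) d) *m P.
Proof.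
rewrite -diag_mx_exp; suff e : P *m A ^+ k = diag_mx d ^+ k *m P by rewrite -mulmxA -e mulKmx.
elim: k => [|k IH]; first by rewrite !expr0 mulmx1 mul1mx.
rewrite !exprS; transitivity (P *m A *m A ^+ k); first by rewrite -mulmxA.
by rewrite PA -mulmxA IH mulmxA.
Qed.

Lemma diag_trace_exp k : \tr (A ^+ k) = \sum_i d 0 i ^+ k.
Proof.
rewrite diag_exp mxtrace_mulC mulmxA mulmxV // mul1mx mxtrace_diag.
by apply: eq_bigr => i _; rewrite mxE.
Qed.

(** The matrices that commute with a diagonal matrix with distinct entries are
    diagonal, so they commute with each other. *)
Lemma noncommuting_centralizer (X Y : 'M[C]_m.+1) : X *m A = A *m X -> Y *m A = A *m Y ->
  X *m Y <> Y *m X -> exists i j, i != j /\ d 0 i = d 0 j.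
Proof.
move=> XA YA XY; apply: contrapT => nex; apply: XY.
have conj Z : Z *m A = A *m Z -> exists e, P *m Z *m invmx P = diag_mx e.
  move=> ZA; exists (\row_i (P *m Z *m invmx P) i i); set W := P *m Z *m invmx P.
  have WD : W *m diag_mx d = diag_mx d *m W.
    rewrite /W -[diag_mx d](mulmxK Pu) -PA !mulmxA mulmxKV // -(mulmxA P Z A) ZA.
    by rewrite !mulmxA mulmxKV.
  apply/matrixP => i j; rewrite !mxE; have [->|ij] := eqVneq; first by rewrite mulr1n.
  have := congr1 (fun M : 'M[C]_m.+1 => M i j) WD; rewrite mul_mx_diag mul_diag_mx !mxE => e.
  have dij : d 0 j - d 0 i != 0.
    by rewrite subr_eq0; apply/eqP => e'; apply: nex; exists i, j.
  by apply: (mulIf dij); rewrite mulr0n mul0r mulrBr e mulrC subrr.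
have [x xE] := conj _ XA; have [y yE] := conj _ YA.
have XE : X = invmx P *m diag_mx x *m P by rewrite -xE !mulmxA mulVmx // mul1mx mulmxKV.
have YE : Y = invmx P *m diag_mx y *m P by rewrite -yE !mulmxA mulVmx // mul1mx mulmxKV.
rewrite XE YE !mulmxA !(mulmxK Pu) -!(mulmxA _ (diag_mx _) (diag_mx _)) !mulmx_diag.
by congr (_ *m diag_mx _ *m _); apply/rowP => i; rewrite !mxE mulrC.
Qed.

End Diag.

Lemma sum3 (d : 'rV[C]_3) k : \sum_i d 0 i ^+ k = d 0 o0 ^+ k + d 0 o1 ^+ k + d 0 o2 ^+ k.
Proof. by rewrite !big_ord_recl big_ord0 addr0 addrA. Qed.

Lemma trace_ratio (a b : C) : a != 0 -> b != 0 ->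
  (a + a + b) * (a^-1 + a^-1 + b^-1) = 5 + 2 * (b / a + (b / a)^-1).
Proof. by move=> a0 b0; field; rewrite a0 b0. Qed.

(** The eigenvalues are [a], [a], [b], and [z = b / a]. *)
Lemma double_eigenvalue n (A X Y : 'M[C]_3) : (0 < n)%N -> A ^+ n = 1 ->
  X *m A = A *m X -> Y *m A = A *m Y -> X *m Y <> Y *m X ->
  exists z, [/\ z ^+ n = 1, \tr A * \tr (invmx A) = 5 + 2 * (z + z^-1) &
    forall k, z ^+ k = 1 -> is_scalar_mx (A ^+ k)].
Proof.
move=> n0 An XA YA XY; have [P [d [Pu PA]]] := finite_order_diag n0 An.
have dn i : d 0 i ^+ n = 1.
  have e : diag_mx (map_mx (fun x => x ^+ n) d) = 1%:M.
    have h := diag_exp Pu PA n; rewrite An in h.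
    transitivity (P *m 1 *m invmx P); last by rewrite mulmx1 mulmxV.
    by rewrite h !mulmxA mulmxV // mul1mx mulmxK.
  by have := congr1 (fun M : 'M[C]_3 => M i i) e; rewrite !mxE eqxx !mulr1n.
have d0 i : d 0 i != 0.
  by apply: contra_eq_neq (dn i) => ->; rewrite expr0n gtn_eqF // eq_sym oner_eq0.
have trV : \tr (invmx A) = (d 0 o0)^-1 + (d 0 o1)^-1 + (d 0 o2)^-1.
  have -> : invmx A = A ^+ n.-1.
    have Au : A \in unitmx.
      by apply: (mulmx1_unit (B := A ^+ n.-1) _).1; rewrite -[LHS]exprS prednK.
    by rewrite -[LHS]mulmx1 -[1%:M]An -(prednK n0) exprS; exact: mulKmx.
  rewrite (diag_trace_exp Pu PA) sum3.
  have dV i : d 0 i ^+ n.-1 = (d 0 i)^-1.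
    by apply: (mulIf (d0 i)); rewrite mulVf // -exprSr prednK.
  by rewrite !dV.
have [i [j [ij dij]]] := noncommuting_centralizer Pu PA XA YA XY.
have [a [b [an bn trA trV' ab]]] : exists a b, [/\ a ^+ n = 1, b ^+ n = 1,
    \tr A = a + a + b, \tr (invmx A) = a^-1 + a^-1 + b^-1 &
    forall k, a ^+ k = b ^+ k -> forall i, d 0 i ^+ k = a ^+ k].
  have trA : \tr A = d 0 o0 + d 0 o1 + d 0 o2.
    by rewrite -[A]expr1 (diag_trace_exp Pu PA) sum3 !expr1.
  rewrite trA trV; move: ij dij.
  have [->|->|->] := ord3P i; have [->|->|->] := ord3P j => // _ e.
  - by exists (d 0 o0), (d 0 o2); split; rewrite ?e // => k ek l; have [->|->|->] := ord3P l; rewrite ?e.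
  - by exists (d 0 o0), (d 0 o1); split; rewrite ?e // 1?addrAC // => k ek l; have [->|->|->] := ord3P l; rewrite ?e.
  - by exists (d 0 o0), (d 0 o2); split; rewrite ?e // => k ek l; have [->|->|->] := ord3P l; rewrite ?e.
  - by exists (d 0 o1), (d 0 o0); split; rewrite ?e // -1?addrA 1?addrC // => k ek l; have [->|->|->] := ord3P l; rewrite ?e.
  - by exists (d 0 o0), (d 0 o1); split; rewrite ?e // 1?addrAC // => k ek l; have [->|->|->] := ord3P l; rewrite ?e.
  - by exists (d 0 o1), (d 0 o0); split; rewrite ?e // -1?addrA 1?addrC // => k ek l; have [->|->|->] := ord3P l; rewrite ?e.
have nz (x : C) : x ^+ n = 1 -> x != 0.
  by move=> xn; apply: contra_eq_neq xn => ->; rewrite expr0n gtn_eqF // eq_sym oner_eq0.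
have [a0 b0] := (nz _ an, nz _ bn).
exists (b / a); split.
- by rewrite expr_div_n an bn divr1.
- by rewrite trA trV' trace_ratio.
- move=> k; rewrite expr_div_n => /divr1_eq e; apply/is_scalar_mxP; exists (a ^+ k).
  rewrite (diag_exp Pu PA) (_ : diag_mx _ = (a ^+ k)%:M).
    by rewrite scalar_mxC -mulmxA mulVmx // mulmx1.
  rewrite -diag_const_mx; congr diag_mx; apply/rowP => l; rewrite !mxE; apply: ab; exact/esym.
Qed.

End FiniteOrderMatrices.

(** * Roots of unity with rational real part *)

Section RationalCosine.

(** For [x = a / b] in lowest terms, [a^2 - 2 b^2] is still prime to [b]. *)
Lemma denq_chebyshev (x : rat) : denq (x ^+ 2 - 2) = denq x ^+ 2.
Proof.
set a := numq x; set b := denq x.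
have b0 : b%:~R != 0 :> rat by rewrite intr_eq0 denq_neq0.
have -> : x ^+ 2 - 2 = (a ^+ 2 - 2 * b ^+ 2)%:~R / (b ^+ 2)%:~R.
  rewrite -{1}(divq_num_den x) -/a -/b intrB (intrM _ 2) !expr2 !intrM.
  by field.
rewrite coprimeq_den.
  have b2 : 0 < b ^+ 2 by rewrite exprn_gt0 // denq_gt0.
  by rewrite gt_eqF // gtr0_norm.
rewrite -coprimezE coprimez_sym (_ : _ - _ = - 2 * b ^+ 2 + a ^+ 2); last by ring.
rewrite /coprimez gcdzMDl -/(coprimez _ _) coprimez_sym coprimezXl // coprimezXr //.
exact: coprime_num_den.
Qed.

Variable C : numClosedFieldType.

(** The map [x |-> x^2 - 2] carries [z + z^-1] to [z^2 + z^-2]. It squares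
    denominators, but the orbit of a root of unity under squaring is finite. *)
Lemma rational_cosine_int (z : C) n p : (0 < n)%N -> z ^+ n = 1 -> z + z^-1 = ratr p ->
  exists c : int, p = c%:~R.
Proof.
move=> n0 zn zp; pose s j := iter j (fun x : rat => x ^+ 2 - 2) p.
have z0 : z != 0 by apply: contra_eq_neq zn => ->; rewrite expr0n gtn_eqF // eq_sym oner_eq0.
have sE j : ratr (s j) = z ^+ (2 ^ j) + z ^- (2 ^ j) :> C.
  elim: j => [|j IH]; first by rewrite expn0 expr1.
  have w0 : z ^+ (2 ^ j) != 0 by rewrite expf_neq0.
  rewrite /s iterS -/(s j) rmorphB rmorphXn rmorph_nat /= IH expnSr !exprM.
  by move: (z ^+ (2 ^ j)) w0 => w w0; field.
have dE j : denq (s j) = denq p ^+ (2 ^ j).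
  by elim: j => [|j IH]; rewrite ?expr1 // /s iterS -/(s j) denq_chebyshev IH -exprM expnSr.
have [i [j [ltij sij]]] : exists i j, (i < j)%N /\ s i = s j.
  pose F (k : 'I_n.+1) : 'I_n := Ordinal (ltn_pmod (2 ^ k) n0).
  have [i [j [ij Fij]]] : exists i j : 'I_n.+1, i != j /\ F i = F j.
    apply: contrapT => nex; have /leq_card : injective F.
      by move=> i j Fij; apply/eqP/negPn/negP => ij; apply: nex; exists i, j.
    by rewrite !card_ord ltnn.
  have e : s i = s j.
    apply: (fmorph_inj (ratr : {rmorphism rat -> C})); rewrite /= !sE.
    have zm k : z ^+ k = z ^+ (k %% n) by rewrite expr_mod.
    by rewrite [z ^+ (2 ^ i)]zm [z ^+ (2 ^ j)]zm; case: Fij => ->.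
  have [lt|lt|/val_inj eij] := ltngtP i j; last by rewrite eij eqxx in ij.
    by exists i, j.
  by exists j, i.
have d1 : denq p = 1.
  have dp := denq_gt0 p; have : denq p ^+ (2 ^ i) = denq p ^+ (2 ^ j) by rewrite -!dE sij.
  case: (ltgtP (denq p) 1) => // [|d1 e]; first by move: dp; lia.
  have : (2 ^ i < 2 ^ j)%N by rewrite ltn_exp2l.
  by rewrite -(ltr_eXn2l (x := denq p)) // e ltxx.
by exists (numq p); rewrite -[LHS]divq_num_den d1 divr1.
Qed.

(** The integer [c = z + z^-1] satisfies [|c| <= 2], and [z^2 = c z - 1]. *)
Lemma rational_cosine_order (z : C) n p : (0 < n)%N -> z ^+ n = 1 -> z + z^-1 = ratr p ->
  exists2 k, k \in [:: 1; 2; 3; 4; 6]%N & z ^+ k = 1.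
Proof.
move=> n0 zn zp; have [c pE] := rational_cosine_int n0 zn zp.
have z0 : z != 0 by apply: contra_eq_neq zn => ->; rewrite expr0n gtn_eqF // eq_sym oner_eq0.
rewrite pE ratr_int in zp.
have nz : `|z| = 1.
  by apply/eqP; rewrite -(@pexpr_eq1 _ _ n) // -normrX zn normr1.
have c2 : `|c| <= 2.
  rewrite -(ler_int C) intr_norm -zp; apply: le_trans (ler_normD _ _) _.
  by rewrite normfV nz invr1.
have zz : z ^+ 2 = c%:~R * z - 1.
  by rewrite -zp mulrDl mulVf // addrK.
have {c2} : [\/ c = 2, c = 1, c = 0 | c = -1 \/ c = -2].
  have [->|c2'] := eqVneq c 2; first by constructor 1.
  have [->|c1'] := eqVneq c 1; first by constructor 2.
  have [->|c0'] := eqVneq c 0; first by constructor 3.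
  by constructor 4; move: c2 c2' c1' c0'; rewrite ler_norml; lia.
move=> h; move: zz; case: h => [->|->|->|[->|->]] zz.
- exists 1%N => //; apply/eqP; rewrite expr1 -subr_eq0.
  suff : (z - 1) ^+ 2 == 0 by rewrite expf_eq0.
  by rewrite sqrrB1 zz; apply/eqP; ring.
- exists 6%N => //; rewrite (_ : 6 = 3 * 2)%N // exprM (_ : z ^+ 3 = -1) ?sqrrN ?expr1n //.
  by transitivity (z ^+ 2 - z); [rewrite exprS {1}zz; ring|rewrite zz; ring].
- exists 4%N => //; rewrite (_ : 4 = 2 * 2)%N // exprM zz; ring.
- exists 3%N => //; transitivity (- z ^+ 2 - z); [rewrite exprS {1}zz; ring|rewrite zz; ring].
- exists 2%N => //; suff -> : z = -1 by rewrite sqrrN expr1n.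
  apply/eqP; rewrite -subr_eq0 opprK.
  suff : (z + 1) ^+ 2 == 0 by rewrite expf_eq0.
  by rewrite sqrrD1 zz; apply/eqP; ring.
Qed.

End RationalCosine.

(** * The centralizer of a complex reflection *)

Lemma hyperplane_sub (K : fieldType) n m (W : 'M[K]_(m, n.+1)) (c : 'cV[K]_n.+1) (u : 'rV[K]_n.+1) :
  \rank W = n -> c != 0 -> W *m c = 0 -> u *m c = 0 -> (u <= W)%MS.
Proof.
move=> rW c0 Wc uc; have sub : (W <= kermx c)%MS by apply/sub_kermxP.
have r0 : (0 < \rank c)%N by rewrite lt0n mxrank_eq0.
have r1 : \rank c = 1%N by apply/eqP; rewrite eqn_leq rank_leq_col.
have [_ e] := mxrank_leqif_eq sub; move: e; rewrite mxrank_ker rW r1 subn1 eqxx.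
by move=> /esym/eqmxP ->; apply/sub_kermxP.
Qed.

Lemma cancel_outer (K : pzRingType) :
  (forall a b : K, a - a - b * 0 = 0) * (forall a b : K, a - b * 0 - a = 0).
Proof. by split=> a b; rewrite mulr0 subr0 subrr. Qed.

Lemma shift_nonzero (K : numFieldType) (a b : K) : b != 0 ->
  exists k : nat, k.+1%:R * (k.+1%:R * b) + a != 0.
Proof.
move=> b0; have [e|ne] := eqVneq (a + b) 0; last first.
  by exists 0; rewrite !mul1r addrC.
exists 1%N; rewrite (_ : 2 * (2 * b) + a = (a + b) + 3 * b); last by ring.
by rewrite e add0r mulf_neq0 // pnatr_eq0.
Qed.

Lemma sum_nonzero (K : fieldType) :
  (forall a b s : K, s * (s * b) + a != 0 -> a + s * 0 + s * (0 + s * b) != 0) *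
  ((forall s : K, 0 + s * 0 = 0) * (forall a s : K, a != 0 -> a + s * 0 != 0)).
Proof. by do ![split] => *; rewrite !mulr0 ?add0r ?addr0 // addrC. Qed.

Lemma commuting_complements (K : fieldType) n (N1 N2 : 'M[K]_n.+1) a b : a != 0 -> b != 0 ->
  (1%:M - a *: N1) *m (1%:M - b *: N2) = (1%:M - b *: N2) *m (1%:M - a *: N1) ->
  N1 *m N2 = N2 *m N1.
Proof.
move=> a0 b0 e; have : GRing.comm (a *: N1) (b *: N2).
  rewrite -[a *: N1](subKr 1) -[b *: N2](subKr 1).
  apply/commrB; first exact: commr1.
  by apply/commr_sym/commrB; [exact: commr1|exact/esym].
rewrite /GRing.comm -!scalerAl -!scalerAr !scalerA (mulrC b) => h.
exact: (scalerI (mulf_neq0 a0 b0) h).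
Qed.

Section ReflectionCentralizer.
Variables (R : realType) (H : 'M[CC R]_3).
Local Notation C := (CC R).
Hypotheses (Hsym : ctr H = H) (Hu : H \in unitmx).
Local Notation h := (hform H).

(** By polarization the form would otherwise vanish on [L]. The second
    hypothesis, that every linear form given by the pairing with a vector [y]
    is on [L] the pairing with a vector of [L], contradicts this. *)
Lemma anisotropic_vector (L : 'rV[C]_3 -> Prop) :
  (forall c u v, L u -> L v -> L (u + c *: v)) ->
  (forall y, exists2 y', L y' & forall u, L u -> h u y = h u y') ->
  (exists2 u, L u & u != 0) -> exists2 u, L u & h u u != 0.
Proof.
move=> Lc Lp [u Lu u0]; apply: contrapT => nex.
have iso v : L v -> h v v = 0.
  by move=> Lv; apply/eqP/negPn/negP => vv; apply: nex; exists v.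
have [y uy] := hform_nondeg Hu u0; have [y' Ly' yy'] := Lp y.
rewrite yy' // in uy; move: (iso _ (Lc (h u y') _ _ Lu Ly')).
rewrite !hformDl !hformZl !hformDr !hformZr (iso _ Lu) (iso _ Ly') -(hform_conj Hsym u y').
move: (h u y') uy => z z0 /eqP; rewrite !mulr0 add0r addr0.
rewrite (mulrC z) -mulr2n mulrn_eq0 /= mulf_eq0 conjC_eq0.
by rewrite (negPf z0).
Qed.

Lemma hformBZl c x z v : h (x - c *: z) v = h x v - c * h z v.
Proof. by rewrite -scaleNr hformDl hformZl mulNr. Qed.

Lemma hformBZr c x z v : h v (x - c *: z) = h v x - Num.conj c * h v z.
Proof. by rewrite -scaleNr hformDr hformZr rmorphN mulNr. Qed.

Definition rank1_form (v : 'rV[C]_3) : 'M[C]_3 := H *m ctr v *m v.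

Lemma mul_rank1_form u v : u *m rank1_form v = h u v *: v.
Proof. by rewrite /rank1_form !mulmxA hformE mul_scalar_mx. Qed.

Lemma rank1_reflection v : h v v != 0 ->
  isometry_group Num.conj H (1%:M - (2 / h v v) *: rank1_form v).
Proof.
move=> vv; apply: isometry_unit Hu _.
have rr : Num.conj (2 / h v v) = 2 / h v v.
  by rewrite rmorphM fmorphV /= rmorph_nat hform_conj.
have NN : rank1_form v *m rank1_form v = h v v *: rank1_form v by exact: rank1_mul.
have NH : H *m ctr (rank1_form v) = rank1_form v *m H.
  by rewrite /rank1_form !ctrM ctrK Hsym !mulmxA.
rewrite ctrD ctrN ctrZ ctr1 rr -mulmxA mulmxBr mulmx1 -scalemxAr NH.
move: (rank1_form v) NN => N NN; move: (h v v) vv NN => q q0 NN.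
rewrite mulmxBl mul1mx mulmxBr -!scalemxAl -scalemxAr -?scalemxAl mulmxA NN.
rewrite -scalemxAl !scalerA; apply/eqP; rewrite -subr_eq0 opprB addrA addrAC.
rewrite (_ : 2 / q * (2 / q * q) = 2 / q + 2 / q); last by field.
by rewrite scalerDl -(addrA H) -opprD subrK subrr.
Qed.

Lemma reflections_noncommute v1 v2 x : h v1 v1 != 0 -> h v2 v2 != 0 -> h v1 v2 != 0 ->
  h v1 x = 0 -> h v2 x != 0 ->
  (1%:M - (2 / h v1 v1) *: rank1_form v1) *m (1%:M - (2 / h v2 v2) *: rank1_form v2) <>
  (1%:M - (2 / h v2 v2) *: rank1_form v2) *m (1%:M - (2 / h v1 v1) *: rank1_form v1).
Proof.
move=> v11 v22 v12 v1x v2x.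
have nz (q : C) : q != 0 -> 2 / q != 0 by move=> q0; rewrite mulf_neq0 ?invr_eq0 ?pnatr_eq0.
move=> /(commuting_complements (nz _ v11) (nz _ v22)) e.
have := congr1 (fun N => h (v1 *m N) x) e.
rewrite /= (mulmxA v1 (rank1_form v1)) (mulmxA v1 (rank1_form v2)).
rewrite !mul_rank1_form !hformZl v1x.
move: (h v1 v1) (h v1 v2) (h v2 x) (h v2 v1) v11 v12 v2x => a b c d a0 b0 c0.
rewrite !mulr0.
by move/eqP; rewrite !mulf_eq0 (negPf a0) (negPf b0) (negPf c0).
Qed.

(** A complex reflection is detected in the abstract group by its centralizer.
    It is the identity on the orthogonal of its eigenvector [w], so it
    commutes with the orthogonal symmetries of vectors of this plane. Two of
    them do not commute with each other when their vectors [v1], [v2] are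
    anisotropic and neither proportional nor orthogonal. *)
Lemma reflection_centralizer (g : unitary_group H) : is_complex_reflection g ->
  exists k1 k2 : unitary_group H, [/\ commute k1 g, commute k2 g & (k1 * k2 <> k2 * k1)%g].
Proof.
set M := mx_of g => -[_ _ rk1 [eta [eta1 _ /eigenvalueP[w /[dup] /eigenspaceP wM wMe w0] pos]]].
have ww : h w w != 0 by rewrite gt_eqF // pos //; apply/eigenspaceP.
have hM u v : h (u *m M) (v *m M) = h u v.
  by rewrite /hform ctrM -{2}(mx_of_iso g) !mulmxA.
have fixP u : (h u w = 0) -> u *m M = u.
  move=> uw; suff /eigenspaceP : (u <= eigenspace M 1)%MS by rewrite scale1r.
  apply: (hyperplane_sub (rk1 : \rank (eigenspace M 1) = 2%N) (c := H *m ctr w)).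
  - by apply: contraNneq ww => e; rewrite /hform -mulmxA e mulmx0 mxE.
  - apply/row_matrixP => i; rewrite row_mul row0.
    have /eigenspaceP := row_sub i (eigenspace M 1); rewrite scale1r.
    move: (row i _) => x xM; rewrite mulmxA hformE; suff -> : h x w = 0 by rewrite raddf0.
    have : h x w = Num.conj eta * h x w by rewrite -hformZr -{1}(hM x w) xM wMe.
    move/eqP; rewrite -subr_eq0 -{1}[h x w]mul1r -mulrBl mulf_eq0 subr_eq0 => /orP[|/eqP //].
    by rewrite eq_sym -(inj_eq (can_inj conjCK)) conjCK conjC1 (negPf eta1).
  - by rewrite mulmxA hformE uw raddf0.
have [v1 v1w v11] : exists2 u, h u w = 0 & h u u != 0.
  apply: anisotropic_vector.
  - by move=> c u v uw vw; rewrite hformDl hformZl uw vw mulr0 addr0.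
  - move=> y; exists (y - (h y w / h w w) *: w).
      by rewrite hformBZl (divfK ww) subrr.
    by move=> u uw; rewrite hformBZr uw mulr0 subr0.
  - have [|u uk u0] := left_null_vector (A := H *m ctr w).
      exact: leq_ltn_trans (rank_leq_col _) _.
    exists u => //.
    by rewrite /hform -mulmxA uk mxE.
have [u2 [u2w u21] u22] : exists2 u, h u w = 0 /\ h u v1 = 0 & h u u != 0.
  have wv1 : h w v1 = 0 by rewrite -(hform_conj Hsym) v1w conjC0.
  apply: anisotropic_vector.
  - move=> c u v [uw uv] [vw vv].
    by split; rewrite hformDl hformZl ?uw ?vw ?uv ?vv mulr0 addr0.
  - move=> y; exists (y - (h y w / h w w) *: w - (h y v1 / h v1 v1) *: v1).
      split; rewrite !hformBZl.
        by rewrite (divfK ww) v1w; exact: (@cancel_outer C).1.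
      by rewrite (divfK v11) wv1; exact: (@cancel_outer C).2.
    by move=> u [uw uv]; rewrite !hformBZr uw uv !mulr0 !subr0.
  - have [|u uk u0] := left_null_vector (A := row_mx (H *m ctr w) (H *m ctr v1)).
      exact: leq_ltn_trans (rank_leq_col _) _.
    exists u => //.
    move: uk; rewrite mul_mx_row -row_mx0 => /eq_row_mx[e1 e2].
    by rewrite /hform -!mulmxA e1 e2 !mxE.
(* The vector u2 + s v1 is not orthogonal to v1 nor to u2; it is anisotropic
   for s = 1 or for s = 2. *)
have [k k2] := shift_nonzero (h u2 u2) v11; pose s : C := k.+1%:R.
have sr : Num.conj s = s by rewrite /s conjC_nat.
have s0 : s != 0 by rewrite /s pnatr_eq0.
have u12 : h v1 u2 = 0 by rewrite -(hform_conj Hsym) u21 conjC0.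
have [v2 [v22 v12 v2w v2u]] : exists v2, [/\ h v2 v2 != 0, h v1 v2 != 0, h v2 w = 0 & h v2 u2 != 0].
  have hu x : h (u2 + s *: v1) x = h u2 x + s * h v1 x by rewrite hformDl hformZl.
  have hv x : h x (u2 + s *: v1) = h x u2 + s * h x v1 by rewrite hformDr hformZr sr.
  exists (u2 + s *: v1); rewrite !hu !hv u12 u21 u2w v1w; split.
  - by move: k2; rewrite -/s; exact: (@sum_nonzero C).1.
  - by rewrite add0r mulf_neq0.
  - exact: (@sum_nonzero C).2.1.
  - exact: (@sum_nonzero C).2.2.
have comm v (vv : h v v != 0) : h v w = 0 -> commute (mk_unitary (rank1_reflection vv)) g.
  move=> /fixP vM; apply: mx_of_inj; rewrite !mx_ofM mk_unitaryE -/M.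
  rewrite mulmxBl mulmxBr mul1mx mulmx1 -scalemxAl -scalemxAr.
  have NM : rank1_form v *m M = rank1_form v by rewrite /rank1_form -(mulmxA (H *m ctr v) v M) vM.
  have MN : M *m rank1_form v = rank1_form v.
    rewrite /rank1_form !mulmxA; congr (_ *m _).
    by rewrite -{1}vM ctrM (mulmxA (M *m H)) mx_of_iso.
  by rewrite NM MN.
exists (mk_unitary (rank1_reflection v11)), (mk_unitary (rank1_reflection v22)).
split; [exact: comm|exact: comm|].
move=> /(congr1 (fun x : unitary_group H => mx_of x)); rewrite !mx_ofM !mk_unitaryE.
exact: (reflections_noncommute v11 v22 v12 u12 v2u).
Qed.

End ReflectionCentralizer.

(** * Complex reflections in arithmetic lattices defined over the rationals *)

Section RationalBase.
Variables (R : realType) (F : fieldExtType rat) (E : fieldExtType F).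
Local Notation C := (CC R).
Variables (eps : {rmorphism E -> C}) (iota : F -> R).
Hypothesis epsF : forall a : F, eps a%:A = creal (iota a).
Hypothesis Eim : totally_imaginary R E.

Lemma real_in_base (q : E) : quadratic_extension E -> eps q \is Num.real ->
  exists a : F, q = a%:A.
Proof.
move=> Equad qr; have [/vlineP[a ->]|q1] := boolP (q \in 1%VS); first by exists a.
case: (Eim (sigma := eps)) => x; have [a [b ->]] := quadratic_basis Equad q1 x.
have crr (t : R) : creal t \is Num.real by rewrite CrealE conj_creal.
rewrite rmorphD -(mulr_algl b q) rmorphM /= !epsF.
exact: realD (crr _) (realM (crr _) qr).
Qed.

Lemma rational_in_base (q : E) : quadratic_extension E -> \dim {: F} = 1%N ->
  eps q \is Num.real -> exists p : rat, eps q = ratr p.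
Proof.
move=> Equad dF qr; have [a ->] := real_in_base Equad qr.
have : a \in (1%VS : {vspace F}).
  have /eqP -> : (1 == {: F})%VS by rewrite -(geq_leqif (dimv_leqif_eq (subvf _))) dF dim_vline oner_neq0.
  exact: memvf.
move=> /vlineP[p ->]; exists p.
exact: (fmorph_eq_rat (eps \o in_alg E \o in_alg F) p).
Qed.

End RationalBase.

Section OrderIsometries.
Variables (R : realType) (F : fieldExtType rat) (E : fieldExtType F) (D : falgType E).
Local Notation C := (CC R).
Variables (tau : D -> D) (r : nat) (K : 'M[D]_r) (iota : F -> R) (m : unitary_model tau r iota).
Variable O : set D.
Hypothesis Oorder : is_order O.
Local Notation J := (model_form K m).

Lemma order0 : O 0.
Proof. by have [one_in OB _ _] := Oorder; have [h _] := OB _ _ one_in one_in; rewrite subrr in h. Qed.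

Lemma orderD x y : O x -> O y -> O (x + y).
Proof.
have [one_in OB _ _] := Oorder => Ox Oy; have [Ny _] := OB _ _ order0 Oy.
by have [h _] := OB _ _ Ox Ny; rewrite sub0r opprK in h.
Qed.

Lemma order_mulmx (X Y : 'M[D]_r) : (forall i j, O (X i j)) -> (forall i j, O (Y i j)) ->
  forall i j, O ((X *m Y) i j).
Proof.
have [one_in OB _ _] := Oorder => OX OY i j; rewrite mxE.
by elim/big_ind: _ => [|x y|k _]; [exact: order0|exact: orderD|exact: (OB _ _ _ _).2].
Qed.

Lemma order_isometriesP X :
  order_isometries O tau K X <-> order_GL O X /\ rho m X *m J *m ctr (rho m X) = J.
Proof.
have tw := twist_unit m; split => -[gl].
  by move=> [_ XK]; split => //; rewrite -rho_form XK.
move=> XJ; split => //; split; first by have [Y [XY YX _]] := gl; exists Y.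
have := rho_form K m X X; rewrite XJ => /(congr1 (fun M => M *m invmx (twist m))).
rewrite /model_form !mulmxK // => e.
apply/eqP; rewrite -subr_eq0; apply/eqP/(rho_inj (u := m)).
have rhoN Z : rho m (- Z) = - rho m Z.
  by apply/eqP; rewrite -addr_eq0 -rhoD addNr; apply/eqP/(addrI (rho m 0)); rewrite -rhoD !addr0.
by rewrite rhoD rhoN e subrr.
Qed.

Lemma order_isometriesM X Y : order_isometries O tau K X -> order_isometries O tau K Y ->
  order_isometries O tau K (X *m Y).
Proof.
move=> /order_isometriesP[[X' [XX X'X OX]] eX] /order_isometriesP[[Y' [YY Y'Y OY]] eY].
apply/order_isometriesP; split.
  exists (Y' *m X'); split.
  - by rewrite mulmxA -(mulmxA X) YY mulmx1.
  - by rewrite mulmxA -(mulmxA Y') X'X mulmx1.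
  - by move=> i j; split; apply: order_mulmx => k l; [case: (OX k l)|case: (OY k l)|case: (OY k l)|case: (OX k l)].
rewrite rhoM ctrM; move: (model_form K m) (rho m X) (rho m Y) eX eY => J' A B eX eY.
by rewrite !mulmxA -(mulmxA A) -(mulmxA A) eY.
Qed.

End OrderIsometries.

Section RationalCase.
Variables (R : realType) (F : fieldExtType rat) (E : fieldExtType F) (D : falgType E).
Local Notation C := (CC R).
Variables (tau : D -> D) (r : nat) (iota : F -> R) (m : unitary_model tau r iota).
Hypotheses (Equad : quadratic_extension E) (Eim : totally_imaginary R E).
Hypothesis dimA : (r * r * \dim {: D} = 3 * 3)%N.
Variables (H J : 'M[C]_3).
Hypotheses (Hsym : ctr H = H) (Hu : H \in unitmx) (Jsym : ctr J = J) (Ju : J \in unitmx).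
Variables (vH v : 'rV[C]_3).
Hypotheses (vH0 : vH != 0) (vHi : hform H vH vH = 0).
Hypotheses (v0 : v != 0) (vi : hform J v v = 0).
Variable Gamma : groupClosed (unitary_group H).
Hypothesis Gmu : has_finite_invariant_measure Gamma.
Variables (f : unitary_group J -> unitary_group H) (g : unitary_group H -> unitary_group J).
Hypotheses (fM : {morph f : x y / (x * y)%g}) (fK : cancel f g) (gK : cancel g f).
Hypotheses (gc : continuous g).
Variable e : nat.
Hypothesis alg : forall c, c \in Gamma ->
  exists s Y, mx_of (g (c ^+ e.+1)%g) = s *: rho m Y.

(** The centralizer of [x] is noncommutative, and so is that of its transport.
    So [tr g tr g^-1] is [5 + 2 (z + z^-1)] for a root of unity [z]; it is
    real and lies in [E], hence it is rational. This bounds the order of [z].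
    If [z ^+ k = 1], the [k]-th power of the transport is scalar, so [x ^+ k]
    is central, hence scalar, and it fixes an eigenvector of [x]. *)
Lemma reflection_order (x : unitary_group H) n : \dim {: F} = 1%N -> x \in Gamma ->
  is_complex_reflection x -> has_order x n -> exists2 k, k \in [:: 1; 2; 3; 4; 6]%N & (x ^+ k = 1)%g.
Proof.
move=> dF xG xr [n0 xn _]; have gM := group_morph_can fM fK gK.
have [k1 [k2 [k1x k2x k12]]] := reflection_centralizer Hsym Hu xr.
have gcomm a b : commute a b -> mx_of (g a) *m mx_of (g b) = mx_of (g b) *m mx_of (g a).
  by move=> ab; rewrite -!mx_ofM -!gM ab.
have gn : mx_of (g x) ^+ n = 1.
  by rewrite -mx_of_exp -(group_morphX gM) xn (group_morph1 gM).
have [z [zn trz zk]] : exists z, [/\ z ^+ n = 1,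
    \tr (mx_of (g x)) * \tr (invmx (mx_of (g x))) = 5 + 2 * (z + z^-1) &
    forall k, z ^+ k = 1 -> is_scalar_mx (mx_of (g x) ^+ k)].
  apply: (double_eigenvalue n0 gn (gcomm _ _ k1x) (gcomm _ _ k2x)) => e12; apply: k12.
  by apply: (can_inj gK); apply: mx_of_inj; rewrite !gM.
have [q qE] := adjoint_trace dimA Hu Jsym Ju Gmu fM fK gK gc v0 vi alg xG.
have zV : z^-1 = Num.conj z.
  have z0 : z != 0 by apply: contra_eq_neq zn => ->; rewrite expr0n gtn_eqF // eq_sym oner_eq0.
  have nz : `|z| = 1 by apply/eqP; rewrite -(@pexpr_eq1 _ _ n) // -normrX zn normr1.
  by apply: (mulfI z0); rewrite mulfV // -normCK nz expr1n.
have zr : z + z^-1 \is Num.real by rewrite zV CrealE rmorphD /= conjCK addrC.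
have qr : eps m q \is Num.real.
  by rewrite -qE trz; apply: realD; [exact: realn|apply: realM; [exact: realn|]].
have [p pE] := rational_in_base (@eps_base _ _ _ _ _ _ _ m) Eim Equad dF qr.
have zp : z + z^-1 = ratr ((p - 5) / 2).
  rewrite fmorph_div rmorphB /= !rmorph_nat -pE -qE trz.
  by move: (z + z^-1) => t; field.
have [k kin zk1] := rational_cosine_order n0 zn zp; exists k => //.
have gxk : is_scalar_mx (mx_of (g (x ^+ k)%g)) by rewrite (group_morphX gM) mx_of_exp; exact: zk.
have xc y : commute (x ^+ k)%g y.
  apply: (can_inj gK); rewrite !gM; exact/esym/scalar_unitaryC.
have /is_scalar_mxP[c cE] := conj_commute_scalar Hsym Hu vH0 vHi (fun y => xc _).
have [_ _ rk _] := xr.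
have [u /eigenspaceP uM u0] : exists2 u : 'rV_3, (u <= eigenspace (mx_of x) 1)%MS & u != 0.
  by apply/rowV0Pn; rewrite -mxrank_eq0 rk.
have uk j : u *m mx_of x ^+ j = u.
  elim: j => [|j IH]; first by rewrite expr0 mulmx1.
  by rewrite exprS (mulmxA u (mx_of x)) uM scale1r.
apply: mx_of_inj; rewrite cE mx_of1; congr (_%:M).
have := uk k; rewrite -mx_of_exp cE mul_mx_scalar => /eqP.
by rewrite -subr_eq0 -{2}[u]scale1r -scalerBl scaler_eq0 (negPf u0) orbF subr_eq0 => /eqP.
Qed.

Lemma rational_case (x : unitary_group H) n : \dim {: F} = 1%N -> x \in Gamma ->
  is_complex_reflection x -> has_order x n -> n = 5%N \/ (7 <= n)%N -> False.
Proof.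
move=> dF xG xr xo n57; have [k kin xk] := reflection_order dF xG xr xo.
have [n0 xn xmin] := xo.
have km0 : (k %% n = 0)%N.
  apply/eqP; rewrite -leqn0 leqNgt; apply/negP => km; apply: (xmin (k %% n)%N).
    by rewrite km ltn_pmod.
  by move: xk; rewrite {1}(divn_eq k n) expgnDr mulnC expgnA xn expg1n mul1g.
move: kin n57 km0; rewrite !inE => /or4P[/eqP->|/eqP->|/eqP->|/orP[]/eqP->] [->//|n7].
all: by rewrite modn_small // (leq_trans _ n7).
Qed.

End RationalCase.

(** * Commensurability with the arithmetic subgroup *)

Section ArithmeticSubgroup.
Variables (R : realType) (F : fieldExtType rat) (E : fieldExtType F) (D : falgType E).
Local Notation C := (CC R).
Variables (tau : D -> D) (r : nat) (K : 'M[D]_r) (iota : F -> R) (m : unitary_model tau r iota).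
Variables (O : set D) (H : 'M[C]_3).
Local Notation J := (model_form K m).
Hypothesis Oorder : is_order O.
Variable Gamma : groupClosed (unitary_group H).
Variables (f : unitary_group J -> unitary_group H) (g : unitary_group H -> unitary_group J).
Hypotheses (fM : {morph f : x y / (x * y)%g}) (fK : cancel f g) (gK : cancel g f).

Definition arithmetic_isometry : set (unitary_group J) :=
  [set x | exists2 Y, order_isometries O tau K Y & mx_of x = rho m Y].

Lemma arithmetic_isometryM x y : arithmetic_isometry x -> arithmetic_isometry y ->
  arithmetic_isometry (x * y)%g.
Proof.
move=> [X OX xX] [Y OY yY]; exists (X *m Y); first exact: (order_isometriesM m Oorder OX OY).
by rewrite mx_ofM xX yY -rhoM.
Qed.

Lemma arithmetic_isometry1 : arithmetic_isometry 1%g.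
Proof.
exists 1%:M; last by rewrite rho1.
apply/(order_isometriesP K m); rewrite rho1 ctr1 mulmx1 mul1mx; split => //.
have O01 (b : bool) : O b%:R by case: b; [case: Oorder|exact: order0].
by exists 1%:M; rewrite mulmx1; split => // i j; rewrite mxE; split; exact: O01.
Qed.

Let A : set (projective_unitary_group H) := [set to_projective x | x in [set` Gamma]].
Let B : set (projective_unitary_group H) := [set to_projective (f x) | x in arithmetic_isometry].

(** Commensurability in the projective group gives a common exponent [e.+1]
    for which the powers of the elements of [Gamma] are arithmetic up to a
    scalar. The transport of a scalar isometry is central, hence scalar. *)
Lemma arithmetic_power : J \in unitmx -> ctr J = J ->
  (exists2 v : 'rV[C]_3, v != 0 & hform J v v = 0) -> commensurable A B ->
  exists e, forall c, c \in Gamma -> exists s Y, mx_of (g (c ^+ e.+1)%g) = s *: rho m Y.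
Proof.
move=> Ju Jsym [v v0 vi] [fAB _]; have gM := group_morph_can fM fK gK.
have pX (x : unitary_group H) k : (to_projective x ^+ k)%g = to_projective (x ^+ k)%g.
  by elim: k => [|k IH]; rewrite ?expg0 // !expgS to_projectiveM IH.
have [||||e eAB] := finite_index_exponent fAB _ _ _ _.
- by exists 1%g => //; exact: gpred1.
- by exists 1%g; [exact: arithmetic_isometry1|rewrite (group_morph1 fM)].
- move=> _ _ [x xG <-] [y yG <-]; exists (x * y)%g; [exact: gpredM|exact: to_projectiveM].
- move=> _ _ [x xG <-] [y yG <-]; exists (x * y)%g; [exact: arithmetic_isometryM|].
  by rewrite fM; exact: to_projectiveM.
exists e => c cG; have [x [Y OY xY]] : B (to_projective c ^+ e.+1)%g by apply: eAB; exists c.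
rewrite pX => /esym /to_projectiveP; set z := (_ * f x)%g => zs.
have zE : (c ^+ e.+1 = f x * z^-1)%g by rewrite /z invgM invgK mulgA mulgV mul1g.
have zc y : commute (z^-1)%g y by apply/esym/scalar_unitaryC; exact: scalar_unitaryV.
have /is_scalar_mxP[s sE] : is_scalar_mx (mx_of (g (z^-1)%g)).
  apply: (conj_commute_scalar Jsym Ju v0 vi) => k.
  by rewrite /commute -[(k * _ * _)%g](fK) -!gM; congr g; exact: zc.
exists s, Y; rewrite zE gM mx_ofM fK xY sE mul_mx_scalar //.
Qed.

Lemma arithmetic_cosets : commensurable A B -> exists l : seq (unitary_group J),
  forall x, arithmetic_isometry x -> exists y c z, [/\ y \in l, c \in Gamma, is_scalar_mx (mx_of z) &
    f x = (f y * c * z)%g].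
Proof.
move=> [_ /finite_seqP[s sE]].
have /boolp.choice[rep repP] : forall S : set (projective_unitary_group H), exists y : unitary_group J,
    (exists2 y, arithmetic_isometry y & S (to_projective (f y))) -> S (to_projective (f y)).
  move=> S; have [[y _ Sy]|n] := pselect (exists2 y, arithmetic_isometry y & S (to_projective (f y))).
    by exists y.
  by exists 1%g.
exists (map rep s) => x xa.
pose S := [set (to_projective (f x) * b)%g | b in A `&` B].
have Ss : S \in s.
  have : [set [set (a * b)%g | b in A `&` B] | a in B] S.
    by exists (to_projective (f x)) => //; exists x.
  by rewrite sE.
have [] := repP S.
  exists x => //; exists 1%g; last by rewrite mulg1.
  split; first by exists 1%g => //; exact: gpred1.
  by exists 1%g; [exact: arithmetic_isometry1|rewrite (group_morph1 fM)].
move=> _ [[c cG <-] _] xc; have : to_projective (f (rep S)) = to_projective (f x * c)%g.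
  by rewrite to_projectiveM -xc.
move=> /to_projectiveP zs.
exists (rep S), (c^-1)%g, ((f (rep S))^-1 * (f x * c))%g; split => //.
- by apply: map_f.
- by rewrite gpredV.
- have zc := scalar_unitaryC (c^-1)%g zs; rewrite -mulgA zc.
  by rewrite !mulgA mulgV mul1g mulgK.
Qed.

End ArithmeticSubgroup.

(** * Embeddings of the base field *)

Lemma additive_rat_scale (K : numFieldType) (U : lmodType rat) (V : lmodType K) (S : U -> V) :
  {morph S : a b / a + b} -> forall c x, S (c *: x) = ratr c *: S x.
Proof.
move=> SD c x.
have S0 : S 0 = 0 := additive0 SD.
have SN y : S (- y) = - S y by apply: (addrI (S y)); rewrite -SD !subrr.
have Sn y k : S (y *+ k) = S y *+ k.
  by elim: k => [|k IH]; rewrite ?mulr0n // !mulrS SD IH.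
have Sz y k : S (y *~ k) = S y *~ k.
  by case: k => k; rewrite ?NegzE ?mulrNz ?SN -!pmulrn Sn.
have d0 : (denq c)%:~R != 0 :> K by rewrite intr_eq0 denq_neq0.
apply: (scalerI d0); rewrite scalerA scaler_int -Sz -scaler_int scalerA.
rewrite [X in S (X *: _)]mulrC -numqE scaler_int Sz -scaler_int; congr (_ *: _).
by rewrite mulrC /ratr divfK.
Qed.

Section PrimitiveElement.
Variable F : fieldExtType rat.
Local Notation ev := (map_poly (in_alg F)).

Lemma primitive_element : exists (z : F) (p : {poly rat}),
  [/\ size p = (\dim {: F}).+1, separable_poly p, (ev p).[z] = 0, forall a, exists u, a = (ev u).[z] &
      forall u, (ev u).[z] = 0 -> p %| u].
Proof.
have sep (x : F) : separable_element 1 x.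
  apply: pcharf0_separable => l; rewrite !inE; apply/andP => -[lp /eqP l0].
  have : (l%:R : rat) != 0 by rewrite pnatr_eq0 -lt0n prime_gt0.
  by rewrite -(fmorph_eq0 (in_alg F)) rmorph_nat l0 eqxx.
have sepF : separable 1 {: F} by apply/separableP => y _; exact: sep.
have gen := eq_adjoin_separable_generator sepF (sub1v _).
set z := separable_generator 1 {: F} in gen.
have /polyOver1P[p pE] := minPolyOver 1 z.
have zall (a : F) : a \in <<1; z>>%VS by rewrite -gen memvf.
exists z, p; split.
- by rewrite -(size_map_poly (in_alg F)) -pE size_minPoly adjoin_degreeE -gen dimv1 divn1.
- by rewrite -(separable_map (in_alg F)) -pE; exact: sep.
- by rewrite -pE minPolyxx.
- by move=> a; have /Fadjoin1_polyP := zall a.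
- move=> u uz; rewrite -(dvdp_map (in_alg F)) -pE; apply: minPoly_dvdp; last exact/rootP.
  exact: alg_polyOver.
Qed.

End PrimitiveElement.

Section Embeddings.
Variables (R : realType) (F : fieldExtType rat) (iota : {rmorphism F -> R}).
Local Notation ev := (map_poly (in_alg F)).

Lemma embedding_eval (K : fieldType) (s : {rmorphism F -> K}) (u : {poly rat}) z :
  s (ev u).[z] = (map_poly (ratr : rat -> K) u).[s z].
Proof.
rewrite -horner_map -map_poly_comp; congr (_.[_]); apply: eq_map_poly => a /=.
exact: (fmorph_eq_rat (s \o in_alg F) a).
Qed.

(** The minimal polynomial of a primitive element [z] is separable of degree
    [\dim {: F}], so it has a complex root other than [iota z]. The embedding
    that it defines is real because [F] is totally real. *)
Lemma second_embedding : totally_real R F -> \dim {: F} <> 1%N ->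
  exists iota1 : {rmorphism F -> R}, ~ iota1 =1 iota.
Proof.
move=> Fr dF; have [z [p [szp sepp pz gen dvd]]] := primitive_element F.
pose pC := map_poly (ratr : rat -> CC R) p.
have pC0 : pC != 0 by rewrite map_poly_eq0 -size_poly_eq0 szp.
have [rs rsE] := closed_field_poly_normal pC.
have lc0 : lead_coef pC != 0 by rewrite lead_coef_eq0.
have urs : uniq rs.
  rewrite -separable_prod_XsubC -(eqp_separable (eqp_scale _ lc0)) -rsE.
  by rewrite separable_map.
have szrs : size rs = \dim {: F}.
  by apply: succn_inj; rewrite -szp -(size_map_poly (ratr : {rmorphism rat -> CC R})) -/pC rsE size_scale // size_prod_XsubC.
have [w wrs wz] : exists2 w, w \in rs & w != creal (iota z).
  apply: contrapT => nex; have sub : {subset rs <= [:: creal (iota z)]}.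
    by move=> w wrs; rewrite inE; apply/negPn/negP => wz; apply: nex; exists w.
  have := uniq_leq_size urs sub; rewrite szrs /= => le1; apply: dF.
  by apply/eqP; rewrite eqn_leq le1 adim_gt0.
have pw : pC.[w] = 0.
  by apply/rootP; rewrite rsE rootZ // root_prod_XsubC.
pose evC (u : {poly rat}) := (map_poly (ratr : rat -> CC R) u).[w].
have key u v : (ev u).[z] = (ev v).[z] -> evC u = evC v.
  move=> e; apply/eqP; rewrite -subr_eq0 -hornerN -hornerD -rmorphB /=.
  have /dvd/dvdpP[q ->] : (ev (u - v)).[z] = 0 by rewrite rmorphB /= hornerD hornerN e subrr.
  by rewrite rmorphM /= hornerM -/pC pw mulr0.
have [phi [phiB phiM1 phiz]] : exists phi : F -> CC R,
    [/\ forall a b, phi (a - b) = phi a - phi b, monoid_morphism phi & phi z = w].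
  have [u uE] := boolp.choice gen; exists (fun a => evC (u a)); split.
  - move=> a b; rewrite -(key (u a - u b)); first by rewrite /evC rmorphB /= hornerD hornerN.
    by rewrite -uE rmorphB /= hornerD hornerN -!uE.
  - split; first by rewrite -(key 1) ?rmorph1 -?uE /evC ?rmorph1 ?hornerC.
    move=> a b; rewrite -(key (u a * u b)); first by rewrite /evC rmorphM /= hornerM.
    by rewrite -uE rmorphM /= hornerM -!uE.
  - by rewrite -(key 'X) ?/evC ?map_polyX ?hornerX // -uE.
pose phiA := GRing.isZmodMorphism.Build _ _ phi phiB.
pose phiMM := GRing.isMonoidMorphism.Build _ _ phi phiM1.
pose phi' : {rmorphism F -> CC R} := HB.pack phi phiA phiMM.
pose i1 a := rpart (phi a).
have i1E a : creal (i1 a) = phi a.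
  exact: (RRe_real (Fr phi' a)).
have crB (a b : R) : creal (a - b) = creal a - creal b by exact: rmorphB.
have crM (a b : R) : creal (a * b) = creal a * creal b by exact: rmorphM.
have i1B a b : i1 (a - b) = i1 a - i1 b by apply: creal_inj; rewrite crB !i1E phiB.
have i1M : monoid_morphism i1.
  split; first by apply: creal_inj; rewrite i1E rmorph1 phiM1.1.
  by move=> a b; apply: creal_inj; rewrite crM !i1E phiM1.2.
pose i1A := GRing.isZmodMorphism.Build _ _ i1 i1B.
pose i1MM := GRing.isMonoidMorphism.Build _ _ i1 i1M.
pose i1' : {rmorphism F -> R} := HB.pack i1 i1A i1MM.
by exists i1' => e; move: wz; rewrite -(e z) /= i1E phiz eqxx.
Qed.

(** Let [p] be the minimal polynomial of a primitive element [z], and [p = (X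
    - c) q] over the reals with [c = iota z]. In [F (x) R = R[X] / (p)] the
    component of [iota] is cut out by the idempotent [q(z) / q(c)]. It is
    given here as a sum of real multiples of powers of [z], acting on additive
    maps from [F] to real vector spaces in place of the tensor product. *)
Lemma embedding_idempotent : exists s : seq (R * F), \sum_(p <- s) p.1 * iota p.2 = 1 /\
    forall (V : lmodType R) (S : F -> V), {morph S : a b / a + b} ->
    forall a, \sum_(p <- s) p.1 *: S (a * p.2) = iota a *: \sum_(p <- s) p.1 *: S p.2.
Proof.
have [z [p [szp sepp pz gen dvd]]] := primitive_element F.
pose pR := map_poly (ratr : rat -> R) p; pose c := iota z.
have /factor_theorem[q qE] : root pR c.
  by apply/rootP; rewrite /pR /c -embedding_eval pz rmorph0.
have qc : q.[c] != 0.
  have : separable_poly pR by rewrite separable_map.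
  by rewrite qE separable_mul => /and3P[_ _]; rewrite coprimep_XsubC.
pose N := size pR; pose s := [seq (q`_(k : 'I_N) / q.[c], z ^+ k) | k <- enum 'I_N].
have q0 : q != 0 by apply: contraNneq qc => ->; rewrite horner0.
have szN : N = (size q).+1.
  by rewrite /N qE size_Mmonic ?monicXsubC // size_XsubC addn2.
have sumE (V : lmodType R) (G : R -> F -> V) :
    \sum_(x <- s) G x.1 x.2 = \sum_(k < (size q).+1) G (q`_k / q.[c]) (z ^+ k).
  by rewrite -szN big_map big_enum.
exists s; split.
  rewrite (sumE R^o (fun a b => a * iota b)) big_ord_recr /= nth_default // !mul0r addr0.
  rewrite -[RHS](divff qc) {2}horner_coef mulr_suml; apply: eq_bigr => k _.
  by rewrite rmorphXn mulrAC.
move=> V S SD a; rewrite (sumE V (fun t b => t *: S (a * b))) (sumE V (fun t b => t *: S b)).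
pose T b := \sum_(k < (size q).+1) (q`_k / q.[c]) *: S (b * z ^+ k).
have TD : {morph T : b b' / b + b'}.
  by move=> b b'; rewrite /T -big_split; apply: eq_bigr => k _; rewrite mulrDl SD scalerDr.
have T0 : T 0 = 0 := additive0 TD.
have S0 : S 0 = 0 := additive0 SD.
have pS b : \sum_(k < (size q).+1) pR`_k *: S (b * z ^+ k) = 0.
  transitivity (S (b * (ev p).[z])); last by rewrite pz mulr0.
  rewrite -szN /N horner_coef !size_map_poly mulr_sumr (big_morph S SD S0).
  apply: eq_bigr => k _; rewrite !coef_map /= -(additive_rat_scale SD).
  by rewrite mulr_algl scalerAr.
have TX b : T (b * z) = c *: T b.
  apply/eqP; rewrite -subr_eq0; apply/eqP.
  have <- : q.[c]^-1 *: (\sum_(k < (size q).+1) pR`_k *: S (b * z ^+ k)) = 0 by rewrite pS scaler0.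
  rewrite /T scaler_sumr.
  rewrite [in RHS]scaler_sumr.
  have pRk k : pR`_k = (if k is k'.+1 then q`_k' else 0) - q`_k * c.
    by rewrite qE mulrBr coefB coefMX coefMC; case: k.
  under [RHS]eq_bigr => k _ do rewrite scalerA pRk mulrBr scalerBl.
  rewrite sumrB; congr (_ - _); last first.
    by apply: eq_bigr => k _; rewrite scalerA; congr (_ *: _); rewrite mulrC [RHS]mulrA (mulrC _^-1).
  rewrite big_ord_recr /= nth_default // mul0r scale0r addr0.
  rewrite big_ord_recl /= mulr0 scale0r add0r; apply: eq_bigr => k _.
  by rewrite mulrC exprS mulrA.
have Tz k : T (z ^+ k) = c ^+ k *: T 1.
  by elim: k => [|k IH]; rewrite ?expr0 ?scale1r // exprSr TX IH scalerA -exprS.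
have [u uE] := gen a; transitivity (T a) => //.
rewrite (_ : \sum_(k < _) _ = T 1); last by apply: eq_bigr => k _; rewrite mul1r.
rewrite {1}uE horner_coef size_map_poly (big_morph T TD T0).
rewrite [in RHS]uE embedding_eval horner_coef size_map_poly scaler_suml; apply: eq_bigr => k _.
by rewrite !coef_map /= mulr_algl (additive_rat_scale TD) Tz scalerA.
Qed.

End Embeddings.

(** * Rational and integral coordinates *)

Section RationalCoordinates.
Variables (F : fieldExtType rat) (E : fieldExtType F) (D : falgType E) (r : nat).
Local Notation V := 'M[D]_r.
Local Notation escl a := (map_mx (fun x : D => (a%:A : E) *: x)).

Lemma base_coordinates : exists h : V -> 'rV[F]_(r * r * \dim {: D} * \dim {: E}),
  [/\ {morph h : x y / x + y}, bijective h & forall (a : F) X, h (escl a X) = a *: h X].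
Proof.
have [H [HD Hb HZ]] := @matrix_coordinates E D r.
have [h [hD hb hZ]] := @vector_coordinates F E.
have [G [GD Gb GZ]] := flatten_rows (r * r * \dim {: D}) hD hb.
exists (fun X => G (H X)); split.
- by move=> X Y; rewrite HD GD.
- exact: bij_comp.
- by move=> a X; apply: GZ => i; rewrite HZ mxE mulr_algl hZ.
Qed.

Lemma rational_coordinates : exists n (h : V -> 'rV[rat]_n), {morph h : x y / x + y} /\ bijective h.
Proof.
have [H [HD Hb _]] := base_coordinates.
have [h [hD hb _]] := @vector_coordinates rat F.
have [G [GD Gb _]] := flatten_rows (r * r * \dim {: D} * \dim {: E}) hD hb.
by exists _, (fun X => G (H X)); split; [move=> X Y; rewrite HD GD|exact: bij_comp].
Qed.

Variable O : set D.
Hypothesis Oorder : is_order O.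

Lemma order_mulrn x k : O x -> O (x *+ k).
Proof.
by move=> Ox; elim: k => [|k IH]; rewrite ?mulr0n ?mulrS; [exact: order0|exact: orderD].
Qed.

Lemma order_mulrz x k : O x -> O (x *~ k).
Proof.
have [one_in OB _ _] := Oorder.
move=> Ox; case: k => k; first exact: order_mulrn.
rewrite NegzE mulrNz -pmulrn; have [h _] := OB _ _ (order0 Oorder) (order_mulrn k.+1 Ox).
by rewrite sub0r in h.
Qed.

Lemma order_denominator (I : finType) (x : I -> D) :
  exists2 n, (0 < n)%N & forall i, O (x i *+ n).
Proof.
have [_ _ _ den] := Oorder.
have /boolp.choice[n nP] : forall i, exists n, (0 < n)%N /\ O (x i *+ n).
  by move=> i; have [n n0 On] := den (x i); exists n.
exists (\prod_i n i)%N; first by apply: prodn_gt0 => i; case: (nP i).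
move=> i; rewrite (bigD1 i) //= mulrnA; apply: order_mulrn; exact: (nP i).2.
Qed.

(** The identity matrix is completed to a basis over the rationals, and the
    other vectors of the basis are multiplied by a common denominator [N] that
    brings their entries into the order. *)
Lemma integral_coordinates : (1%:M : V) != 0 ->
  exists n (h : V -> 'rV[rat]_n), [/\ {morph h : x y / x + y}, bijective h,
    exists k : 'rV[int]_n, h 1%:M = map_mx intr k &
    forall X (k : 'rV[int]_n), h X = map_mx intr k -> forall i j, O (X i j)].
Proof.
move=> one0; have [n [h [hD [h' hK h'K]]]] := rational_coordinates.
have h0 : h 0 = 0 := additive0 hD.
set v := h 1%:M; have v0 : v != 0 by apply: contra_neq one0 => e; rewrite -[LHS]hK -/v e -h0 hK.
have rv : \rank v = 1%N by apply/eqP; rewrite eqn_leq rank_leq_row lt0n mxrank_eq0.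
pose c := col_ebase v 0 0.
have c0 : c != 0.
  by have := col_ebase_unit v; rewrite [col_ebase v]mx11_scalar -/c unitmxE det_scalar1 unitfE.
pose A := c^-1 *: invmx (row_ebase v).
have Au : A \in unitmx by rewrite unitmxZ ?unitmx_inv ?row_ebase_unit ?unitfE ?invr_eq0.
have vA : v *m A = pid_mx 1.
  rewrite /A -scalemxAr -{1}[v]mulmx_ebase rv mulmxK ?row_ebase_unit //.
  by rewrite [col_ebase v]mx11_scalar -/c mul_scalar_mx scalerA mulVf // scale1r.
pose b (j : 'I_n) := h' (delta_mx 0 j *m invmx A).
have [N N0 NO] := order_denominator (fun p : 'I_n * ('I_r * 'I_r) => b p.1 p.2.1 p.2.2).
have Nr0 : N%:R != 0 :> rat by rewrite pnatr_eq0 -lt0n.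
pose d : 'rV[rat]_n := \row_j (if (j == 0 :> nat)%N then 1 else N%:R^-1).
have du : diag_mx d \in unitmx.
  rewrite unitmxE det_diag unitfE; apply/prodf_neq0 => j _; rewrite mxE.
  by case: ifP => _; rewrite ?oner_neq0 ?invr_eq0.
pose k X := h X *m A *m diag_mx d.
have kD : {morph k : x y / x + y} by move=> X Y; rewrite /k hD !mulmxDl.
have kB : bijective k.
  exists (fun y => h' (y *m invmx (diag_mx d) *m invmx A)) => [X|y].
    by rewrite /k !mulmxK.
  by rewrite /k h'K !mulmxKV.
have k1 : k 1%:M = pid_mx 1.
  rewrite /k -/v vA; apply/rowP => j; rewrite mul_mx_diag !mxE.
  by case: (j : nat) => [|q] /=; rewrite ?mulr1 ?mul0r.
have k0 : k 0 = 0 := additive0 kD.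
have [k' kK k'K] := kB.
have bO j : forall i l, O (k' (delta_mx 0 j) i l).
  have [j0|j0] := eqVneq (j : nat) 0%N.
    have -> : k' (delta_mx 0 j) = 1%:M.
      rewrite -[RHS]kK k1; congr k'; apply/rowP => l; rewrite !mxE eqxx /=.
      have -> : (l == j) = (l == 0 :> nat)%N by rewrite -val_eqE /= j0.
      by rewrite eq_sym andbT.
    move=> i l; rewrite mxE; case: Oorder => one_in _ _ _; case: (i == l) => //.
    exact: order0.
  have -> : k' (delta_mx 0 j) = b j *+ N.
    rewrite -[RHS]kK; congr k'.
    have -> : k (b j *+ N) = k (b j) *+ N by elim: (N) => [|p IH]; rewrite ?mulr0n // !mulrS kD IH.
    have -> : k (b j) = N%:R^-1 *: delta_mx 0 j.
      rewrite /k /b h'K mulmxKV //; apply/rowP => l; rewrite mul_mx_diag !mxE eqxx /=.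
      by case: eqP => [->|_]; rewrite ?mul0r ?mulr0 // (negPf j0) mul1r mulr1.
    by rewrite -scaler_nat scalerA mulfV // scale1r.
  by move=> i l; rewrite mulmxnE; exact: (NO (j, (i, l))).
exists n, k; split => //.
- by exists (pid_mx 1); rewrite k1 map_pid_mx.
- move=> X z Xz i l; have -> : X = \sum_j k' (delta_mx 0 j) *~ z 0 j.
    have kz Y p : k (Y *~ p) = k Y *~ p.
      have kN U : k (- U) = - k U by apply: (addrI (k U)); rewrite -kD !subrr.
      have kn U q : k (U *+ q) = k U *+ q by elim: q => [|q IH]; rewrite ?mulr0n // !mulrS kD IH.
      by case: p => p; rewrite ?NegzE ?mulrNz ?kN -!pmulrn kn.
    apply: (can_inj kK); rewrite (big_morph k kD k0) Xz [LHS]row_sum_delta; apply: eq_bigr => j _.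
    by rewrite kz k'K mxE scaler_int.
  rewrite summxE; elim/big_ind: _ => [|x y|j _]; [exact: order0|exact: orderD|].
  have zl (U : 'M[D]_r) p : (U *~ p) i l = U i l *~ p.
    by case: p => p; rewrite ?NegzE ?mulrNz -!pmulrn ?mxE mulmxnE.
  by rewrite zl; apply: order_mulrz.
Qed.

End RationalCoordinates.

(** * Extension of scalars to the real numbers *)

Section RealExtension.
Variables (R : realType) (V : zmodType) (n : nat) (h : V -> 'rV[rat]_n) (h' : 'rV[rat]_n -> V).
Hypotheses (hD : {morph h : x y / x + y}) (hK : cancel h h') (h'K : cancel h' h).

Definition basis_vector (j : 'I_n) : V := h' (delta_mx 0 j).
(** The space [V (x) R] is represented by the real rows of length [n], with
    this map for the inclusion of [V]. *)
Definition real_coord (x : V) : 'rV[R]_n := map_mx ratr (h x).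
Local Notation bas := basis_vector.
Local Notation hR := real_coord.

Lemma coord_additive : {morph h' : x y / x + y}.
Proof. by move=> x y; apply: (can_inj hK); rewrite hD !h'K. Qed.

Lemma additive_coord (K : numFieldType) (U : lmodType K) (S : V -> U) :
  {morph S : x y / x + y} -> forall x, S x = \sum_j ratr (h x 0 j) *: S (bas j).
Proof.
move=> SD x; have ShD : {morph (S \o h') : y z / y + z} by move=> y z /=; rewrite coord_additive SD.
have Sh0 : (S \o h') 0 = 0 by apply: (addrI ((S \o h') 0)); rewrite -ShD !addr0.
rewrite -{1}[x]hK -[S _]/((S \o h') (h x)) {1}[h x]row_sum_delta (big_morph _ ShD Sh0).
by apply: eq_bigr => j _; rewrite (additive_rat_scale ShD).
Qed.

Lemma real_coordD : {morph hR : x y / x + y}.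
Proof. by move=> x y; rewrite /hR hD map_mxD. Qed.

Lemma real_coord_basis j : hR (bas j) = delta_mx 0 j.
Proof. by rewrite /hR /bas h'K map_delta_mx. Qed.

Lemma real_coord_inj : injective hR.
Proof. by move=> x y /map_mx_inj /(can_inj hK). Qed.

Lemma real_ext (U : zmodType) (f g : 'rV[R]_n -> U) :
  {morph f : v w / v + w} -> {morph g : v w / v + w} ->
  (forall t x, f (t *: hR x) = g (t *: hR x)) -> f =1 g.
Proof.
move=> fD gD fg v.
have f0 : f 0 = 0 := additive0 fD.
have g0 : g 0 = 0 := additive0 gD.
rewrite [v]row_sum_delta (big_morph f fD f0) (big_morph g gD g0); apply: eq_bigr => j _.
by rewrite -real_coord_basis.
Qed.

Definition real_op (T : V -> V) : 'M[R]_n := \matrix_j hR (T (bas j)).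

Lemma real_opE T : {morph T : x y / x + y} -> forall x, hR x *m real_op T = hR (T x).
Proof.
move=> TD x; have TD' : {morph (hR \o T) : y z / y + z}.
  by move=> y z /=; rewrite TD real_coordD.
rewrite -[RHS]/((hR \o T) x) (additive_coord TD') mulmx_sum_row.
by apply: eq_bigr => j _; rewrite rowK mxE.
Qed.

Lemma real_mx_ext k (M N : 'M[R]_(n, k)) : (forall x, hR x *m M = hR x *m N) -> M = N.
Proof.
by move=> MN; apply/row_matrixP => j; rewrite !rowE -real_coord_basis.
Qed.

Variable b : V -> V -> V.
Hypotheses (bDl : forall y, {morph b^~ y : x x' / x + x'}) (bDr : forall x, {morph b x : y y' / y + y'}).

Definition real_form (v w : 'rV[R]_n) : 'rV[R]_n :=
  \sum_i \sum_j (v 0 i * w 0 j) *: hR (b (bas i) (bas j)).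

Lemma real_formDl w : {morph real_form^~ w : v v' / v + v'}.
Proof.
move=> v v'; rewrite /real_form -big_split; apply: eq_bigr => i _ /=; rewrite -big_split.
by apply: eq_bigr => j _; rewrite mxE mulrDl scalerDl.
Qed.

Lemma real_formDr v : {morph real_form v : w w' / w + w'}.
Proof.
move=> w w'; rewrite /real_form -big_split; apply: eq_bigr => i _ /=; rewrite -big_split.
by apply: eq_bigr => j _; rewrite mxE mulrDr scalerDl.
Qed.

Lemma real_formZl t v w : real_form (t *: v) w = t *: real_form v w.
Proof.
rewrite /real_form scaler_sumr; apply: eq_bigr => i _; rewrite scaler_sumr.
by apply: eq_bigr => j _; rewrite mxE scalerA mulrA.
Qed.

Lemma real_formZr t v w : real_form v (t *: w) = t *: real_form v w.
Proof.
rewrite /real_form scaler_sumr; apply: eq_bigr => i _; rewrite scaler_sumr.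
by apply: eq_bigr => j _; rewrite mxE scalerA mulrCA.
Qed.

Lemma real_form_coord x y : real_form (hR x) (hR y) = hR (b x y).
Proof.
have bl : {morph (fun x => hR (b x y)) : z z' / z + z'}.
  by move=> z z'; rewrite bDl real_coordD.
rewrite (additive_coord bl); apply: eq_bigr => i _.
have br : {morph (fun y => hR (b (bas i) y)) : z z' / z + z'}.
  by move=> z z'; rewrite bDr real_coordD.
rewrite (additive_coord br) scaler_sumr; apply: eq_bigr => j _.
by rewrite scalerA !mxE.
Qed.

End RealExtension.

Section ModelExtension.
Variables (R : realType) (F : fieldExtType rat) (E : fieldExtType F) (D : falgType E).
Local Notation C := (CC R).
Variables (tau : D -> D) (r : nat) (K : 'M[D]_r) (iota : {rmorphism F -> R}).
Variable m : unitary_model tau r iota.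
Local Notation V := 'M[D]_r.
Local Notation J := (model_form K m).
Hypothesis tau_inv : involution_over_galois tau.
Hypothesis dimV : (r * r * \dim {: D} * \dim {: E} = 3 * 3 + 3 * 3)%N.
Variables (n : nat) (h : V -> 'rV[rat]_n) (h' : 'rV[rat]_n -> V).
Hypotheses (hD : {morph h : x y / x + y}) (hK : cancel h h') (h'K : cancel h' h).

Local Notation bas := (basis_vector h').
Local Notation hR := (real_coord R h).

Definition base_scale (a : F) (X : V) : V := escale (a%:A : E) X.
Definition sesqui (X Y : V) : V := X *m K *m (map_mx tau Y)^T.
Local Notation beta := (real_form h h' sesqui).

Lemma base_scaleD a : {morph base_scale a : X Y / X + Y}.
Proof. by move=> X Y; apply/matrixP => i j; rewrite !mxE scalerDr. Qed.

Lemma base_scaleDl X : {morph base_scale^~ X : a b / a + b}.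
Proof. by move=> a b; apply/matrixP => i j; rewrite !mxE scalerDl scalerDl. Qed.

Lemma base_scaleA a b X : base_scale (a * b) X = base_scale b (base_scale a X).
Proof. by apply/matrixP => i j; rewrite !mxE scalerA -scalerAl mul1r scalerA mulrC. Qed.

Lemma base_scaleMl a X Y : base_scale a (X *m Y) = base_scale a X *m Y.
Proof.
apply/matrixP => i j; rewrite !mxE scaler_sumr; apply: eq_bigr => k _.
by rewrite mxE scalerAl.
Qed.

Lemma base_scaleMr a X Y : base_scale a (X *m Y) = X *m base_scale a Y.
Proof.
apply/matrixP => i j; rewrite !mxE scaler_sumr; apply: eq_bigr => k _.
by rewrite mxE scalerAr.
Qed.

Lemma tau_base_scale a (X : V) : (map_mx tau (base_scale a X))^T = base_scale a (map_mx tau X)^T.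
Proof.
have [_ tM _ [c _ tc]] := tau_inv; apply/matrixP => i j; rewrite !mxE.
rewrite -[_ *: X j i]mulr_algl tM tc linearZ /= rmorph1.
by rewrite mulr_algr.
Qed.

Lemma sesquiDl Y : {morph sesqui^~ Y : X X' / X + X'}.
Proof. by move=> X X'; rewrite /sesqui !mulmxDl. Qed.

Lemma sesquiDr X : {morph sesqui X : Y Y' / Y + Y'}.
Proof.
have [tD _ _ _] := tau_inv => Y Y'; rewrite /sesqui -mulmxDr; congr (_ *m _).
by apply/matrixP => i j; rewrite !mxE tD.
Qed.

Lemma sesqui_base_l a X Y : sesqui (base_scale a X) Y = base_scale a (sesqui X Y).
Proof. by rewrite /sesqui !base_scaleMl. Qed.

Lemma sesqui_base_r a X Y : sesqui X (base_scale a Y) = base_scale a (sesqui X Y).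
Proof. by rewrite /sesqui tau_base_scale base_scaleMr. Qed.

Lemma rho_base_scale a X : rho m (base_scale a X) = creal (iota a) *: rho m X.
Proof. by rewrite rhoZ eps_base. Qed.

Definition real_rho (v : 'rV[R]_n) : 'M[C]_3 := \sum_j creal (v 0 j) *: rho m (bas j).

Lemma real_rhoD : {morph real_rho : v w / v + w}.
Proof.
move=> v w; rewrite /real_rho -big_split; apply: eq_bigr => j _.
by rewrite mxE (rmorphD (@creal R)) scalerDl.
Qed.

Lemma real_rhoZ t v : real_rho (t *: v) = creal t *: real_rho v.
Proof.
rewrite /real_rho scaler_sumr; apply: eq_bigr => j _.
by rewrite mxE (rmorphM (@creal R)) scalerA.
Qed.

Lemma real_rho_coord X : real_rho (hR X) = rho m X.
Proof.
rewrite (additive_coord hD hK h'K (@rhoD _ _ _ _ _ _ _ m)); apply: eq_bigr => j _.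
by rewrite mxE fmorph_rat.
Qed.

Definition realify (M : 'M[C]_3) : 'rV[R]_(3 * 3 + 3 * 3) :=
  row_mx (mxvec (map_mx (@rpart R) M)) (mxvec (map_mx (@ipart R) M)).

Lemma realifyD : {morph realify : M N / M + N}.
Proof.
move=> M N; rewrite /realify add_row_mx -!linearD /=; congr row_mx; congr mxvec;
  apply/matrixP => i j; rewrite !mxE; by case: (M i j) (N i j) => [a b] [c d].
Qed.

Lemma realifyZ t M : realify (creal t *: M) = t *: realify M.
Proof.
rewrite /realify scale_row_mx -!linearZ /=; congr row_mx; congr mxvec;
  apply/matrixP => i j; rewrite !mxE; case: (M i j) => [a b] /=.
  by rewrite /rpart /= mul0r subr0.
by rewrite /ipart /= mul0r addr0.
Qed.

Lemma realify_surj w : exists M, realify M = w.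
Proof.
pose A := vec_mx (lsubmx w); pose B := vec_mx (rsubmx w).
exists (\matrix_(i, j) (creal (A i j) + ci R * creal (B i j))).
rewrite -[RHS]hsubmxK /realify -[lsubmx w]vec_mxK -[rsubmx w]vec_mxK -/A -/B.
congr row_mx; congr mxvec; apply/matrixP => i j; rewrite !mxE; [exact: rpart_rect|exact: ipart_rect].
Qed.

Lemma realify0 : realify 0 = 0.
Proof. exact: additive0 realifyD. Qed.

Definition base_op a := real_op R h h' (base_scale a).
(** The projection of [V (x) R] onto the component on which [F] acts through
    [iota]. *)
Definition idem (s : seq (R * F)) : 'M[R]_n := \sum_(p <- s) p.1 *: base_op p.2.

Lemma base_opD : {morph base_op : a b / a + b}.
Proof.
move=> a b; apply: (real_mx_ext h'K) => X; rewrite mulmxDr !(real_opE R hD hK h'K (base_scaleD _)).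
by rewrite base_scaleDl real_coordD.
Qed.

Lemma base_opM a b : base_op (a * b) = base_op a *m base_op b.
Proof.
apply: (real_mx_ext h'K) => X; rewrite mulmxA !(real_opE R hD hK h'K (base_scaleD _)).
by rewrite base_scaleA.
Qed.

Variable s : seq (R * F).
Hypothesis s1 : \sum_(p <- s) p.1 * iota p.2 = 1.
Hypothesis s2 : forall (V : lmodType R) (S : F -> V), {morph S : a b / a + b} ->
    forall a, \sum_(p <- s) p.1 *: S (a * p.2) = iota a *: \sum_(p <- s) p.1 *: S p.2.
Local Notation Eps := (idem s).

Lemma idem_eigen a : base_op a *m Eps = iota a *: Eps.
Proof.
rewrite -(s2 base_opD) mulmx_sumr; apply: eq_bigr => p _.
by rewrite -scalemxAr base_opM.
Qed.

Lemma idem_absorb k (N : 'M[R]_(n, k)) :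
  (forall a, base_op a *m N = iota a *: N) -> Eps *m N = N.
Proof.
move=> aN; rewrite /idem mulmx_suml -[RHS]scale1r -s1 scaler_suml; apply: eq_bigr => p _.
by rewrite -scalemxAl aN scalerA.
Qed.

Lemma idem_idem : Eps *m Eps = Eps.
Proof. exact/idem_absorb/idem_eigen. Qed.

(** On the component of [iota], elements of [F] act by real scalars, so the
    rank is at most the dimension of [V] over [F]. *)
Lemma idem_rank : (\rank Eps <= 3 * 3 + 3 * 3)%N.
Proof.
rewrite -dimV; have [H [HD [H' HK H'K] HZ]] := @base_coordinates F E D r.
pose A := \matrix_j map_mx iota (H (bas j)).
pose Y := \matrix_l (hR (H' (delta_mx 0 l)) *m Eps).
suff -> : Eps = A *m Y by exact: leq_trans (mxrankM_maxl _ _) (rank_leq_col _).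
apply/row_matrixP => j; rewrite row_mul rowK rowE -(real_coord_basis R h'K).
have H'D : {morph H' : x y / x + y} by move=> x y; apply: (can_inj HK); rewrite HD !H'K.
have H'0 : H' 0 = 0 by apply: (addrI (H' 0)); rewrite -H'D !addr0.
rewrite -{1}[bas j]HK {1}[H (bas j)]row_sum_delta (big_morph H' H'D H'0).
have hR0 : hR 0 = 0 := additive0 (real_coordD R hD).
rewrite (big_morph (fun x => hR x) (real_coordD R hD) hR0) mulmx_suml mulmx_sum_row.
apply: eq_bigr => l _; rewrite rowK !mxE.
have H'Z a y : H' (a *: y) = base_scale a (H' y).
  by apply: (can_inj HK); rewrite H'K HZ H'K.
by rewrite H'Z -(real_opE R hD hK h'K (base_scaleD _)) -mulmxA idem_eigen -scalemxAr.
Qed.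

Definition real_rho_mx : 'M[R]_(n, 3 * 3 + 3 * 3) := \matrix_j realify (rho m (bas j)).

Lemma real_rho_mxE v : v *m real_rho_mx = realify (real_rho v).
Proof.
rewrite mulmx_sum_row /real_rho (big_morph realify realifyD realify0).
by apply: eq_bigr => j _; rewrite rowK realifyZ.
Qed.

Lemma idem_real_rho v : real_rho (v *m Eps) = real_rho v.
Proof.
move: v; apply: (real_ext h'K).
- by move=> x y; rewrite mulmxDl real_rhoD.
- exact: real_rhoD.
- move=> t x; rewrite -scalemxAl !real_rhoZ; congr (_ *: _).
  rewrite /idem mulmx_sumr.
  have rr0 : real_rho 0 = 0 := additive0 real_rhoD.
  rewrite (big_morph real_rho real_rhoD rr0) -[RHS]scale1r -(rmorph1 (@creal R)) -s1.
  rewrite (rmorph_sum (@creal R)) scaler_suml; apply: eq_bigr => p _.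
  rewrite -scalemxAr real_rhoZ (real_opE R hD hK h'K (base_scaleD _)) !real_rho_coord.
  by rewrite rho_base_scale scalerA -(rmorphM (@creal R)).
Qed.

(** The map [real_rho] factors through the projection [Eps], and it is onto a
    space of real dimension 18. As the rank of [Eps] is at most 18, the two
    kernels agree. *)
Lemma real_rho_ker w : real_rho w = 0 -> w *m Eps = 0.
Proof.
move=> w0; have PP : Eps *m real_rho_mx = real_rho_mx.
  apply: (real_mx_ext h'K) => x; rewrite mulmxA !real_rho_mxE.
  by rewrite idem_real_rho.
have Pr : \rank real_rho_mx = (3 * 3 + 3 * 3)%N.
  apply/eqP; rewrite -[_ == _]/(row_full real_rho_mx) -sub1mx; apply/row_subP => i.
  have [M <-] := realify_surj (row i 1%:M); have [l ->] := rho_span m M.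
  rewrite (_ : realify _ = (\sum_(p <- l) p.1 *: hR p.2) *m real_rho_mx); first exact: submxMl.
  rewrite (big_morph realify realifyD realify0) mulmx_suml; apply: eq_bigr => p _.
  by rewrite realifyZ -scalemxAl real_rho_mxE real_rho_coord.
have sub : (kermx Eps <= kermx real_rho_mx)%MS.
  by apply/sub_kermxP; rewrite -PP mulmxA mulmx_ker mul0mx.
have : (kermx Eps == kermx real_rho_mx)%MS.
  have [le <-] := mxrank_leqif_eq sub; move: le; rewrite !mxrank_ker Pr => le.
  rewrite eqn_leq le /=; apply: leq_sub2l; exact: idem_rank.
by move=> /eqmxP e; apply/sub_kermxP; rewrite e; apply/sub_kermxP; rewrite real_rho_mxE w0 realify0.
Qed.

Lemma real_form_base_l a v w : beta (v *m base_op a) w = beta v w *m base_op a.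
Proof.
move: v; apply: (real_ext h'K).
- by move=> x y; rewrite mulmxDl real_formDl.
- by move=> x y; rewrite real_formDl mulmxDl.
move=> t x; rewrite -scalemxAl !real_formZl -scalemxAl; congr (_ *: _).
move: w; apply: (real_ext h'K).
- by move=> z y; rewrite real_formDr.
- by move=> z y; rewrite real_formDr mulmxDl.
move=> u y; rewrite !real_formZr -scalemxAl; congr (_ *: _).
rewrite !(real_opE R hD hK h'K (base_scaleD _)).
rewrite !(real_form_coord R hD hK h'K sesquiDl sesquiDr).
by rewrite (real_opE R hD hK h'K (base_scaleD _)) sesqui_base_l.
Qed.

Lemma real_form_base_r a v w : beta v (w *m base_op a) = beta v w *m base_op a.
Proof.
move: v; apply: (real_ext h'K).
- by move=> x y; rewrite real_formDl.
- by move=> x y; rewrite real_formDl mulmxDl.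
move=> t x; rewrite !real_formZl -scalemxAl; congr (_ *: _).
move: w; apply: (real_ext h'K).
- by move=> z y; rewrite mulmxDl real_formDr.
- by move=> z y; rewrite real_formDr mulmxDl.
move=> u y; rewrite -scalemxAl !real_formZr -scalemxAl; congr (_ *: _).
rewrite !(real_opE R hD hK h'K (base_scaleD _)).
rewrite !(real_form_coord R hD hK h'K sesquiDl sesquiDr).
by rewrite (real_opE R hD hK h'K (base_scaleD _)) sesqui_base_r.
Qed.

Lemma real_form0l (w : 'rV[R]_n) : beta 0 w = 0.
Proof. exact: additive0 (real_formDl h h' sesqui w). Qed.

Lemma real_form0r (v : 'rV[R]_n) : beta v 0 = 0.
Proof. exact: additive0 (real_formDr h h' sesqui v). Qed.

Lemma real_form_idem_l v w : beta (v *m Eps) w = beta v w *m Eps.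
Proof.
rewrite /idem !mulmx_sumr (big_morph (beta^~ w) (real_formDl h h' sesqui w) (real_form0l w)).
by apply: eq_bigr => p _; rewrite -!scalemxAr real_formZl real_form_base_l.
Qed.

Lemma real_form_idem_r v w : beta v (w *m Eps) = beta v w *m Eps.
Proof.
rewrite /idem !mulmx_sumr (big_morph (beta v) (real_formDr h h' sesqui v) (real_form0r v)).
by apply: eq_bigr => p _; rewrite -!scalemxAr real_formZr real_form_base_r.
Qed.

Lemma real_rho_form v w :
  real_rho (beta v w) *m twist m = real_rho v *m J *m ctr (real_rho w).
Proof.
move: v; apply: (real_ext h'K).
- by move=> x y; rewrite real_formDl real_rhoD mulmxDl.
- by move=> x y; rewrite real_rhoD !mulmxDl.
move=> t x; rewrite real_formZl !real_rhoZ -!scalemxAl; congr (_ *: _).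
move: w; apply: (real_ext h'K).
- by move=> z y; rewrite real_formDr real_rhoD mulmxDl.
- by move=> z y; rewrite real_rhoD ctrD mulmxDr.
move=> u y; rewrite real_formZr !real_rhoZ ctrZ -scalemxAl -scalemxAr conj_creal; congr (_ *: _).
by rewrite (real_form_coord R hD hK h'K sesquiDl sesquiDr) !real_rho_coord rho_form.
Qed.

(** The operator is right multiplication by [x] on the component of [iota] and
    the identity on the others. Right multiplication by [x] is a real
    combination [W] of right multiplications by elements of [V], because these
    span the complex matrices over the reals. *)
Lemma extension_operator (x : 'M[C]_3) : x *m J *m ctr x = J -> exists Xt : 'M[R]_n,
  (forall v, real_rho (v *m Xt) = real_rho v *m x) /\
  (forall v w, beta (v *m Xt) (w *m Xt) = beta v w).
Proof.
move=> xJ; have [l xE] := rho_span m x.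
pose W := \sum_(p <- l) p.1 *: real_op R h h' (fun X => X *m p.2).
have rr0 : real_rho 0 = 0 := additive0 real_rhoD.
have rW v : real_rho (v *m W) = real_rho v *m x.
  move: v; apply: (real_ext h'K).
  - by move=> y z; rewrite mulmxDl real_rhoD.
  - by move=> y z; rewrite real_rhoD mulmxDl.
  move=> t y; rewrite -scalemxAl !real_rhoZ -scalemxAl; congr (_ *: _).
  rewrite /W mulmx_sumr (big_morph real_rho real_rhoD rr0) xE mulmx_sumr; apply: eq_bigr => p _.
  have pD : {morph (fun X : V => X *m p.2) : X Y / X + Y} by move=> X Y; exact: mulmxDl.
  by rewrite -scalemxAr real_rhoZ (real_opE R hD hK h'K pD) !real_rho_coord rhoM -scalemxAr.
pose Q : 'M[R]_n := 1%:M - Eps.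
have vQ v : v *m Q + v *m Eps = v by rewrite -mulmxDr subrK mulmx1.
have QE : Q *m Eps = 0 by rewrite mulmxBl mul1mx idem_idem subrr.
have EQ : Eps *m Q = 0 by rewrite mulmxBr mulmx1 idem_idem subrr.
have QQ : Q *m Q = Q by rewrite {2}/Q mulmxBr mulmx1 QE subr0.
have rQ v : real_rho (v *m Q) = 0.
  by apply: (addIr (real_rho (v *m Eps))); rewrite -real_rhoD vQ idem_real_rho add0r.
have bQl v w : beta (v *m Q) w = beta v w *m Q.
  by apply: (addIr (beta (v *m Eps) w)); rewrite -real_formDl vQ real_form_idem_l vQ.
have bQr v w : beta v (w *m Q) = beta v w *m Q.
  by apply: (addIr (beta v (w *m Eps))); rewrite -real_formDr vQ real_form_idem_r vQ.
clearbody Q W; exists (Q + W *m Eps); split => [v|v w].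
  by rewrite mulmxDr real_rhoD rQ add0r mulmxA idem_real_rho rW.
rewrite !mulmxDr !mulmxA !(real_formDl, real_formDr) !(bQl, bQr, real_form_idem_l, real_form_idem_r).
rewrite -!mulmxA QQ EQ !idem_idem !mulmx0 addr0 add0r.
have -> : beta (v *m W) (w *m W) *m Eps = beta v w *m Eps; last exact: vQ.
apply/eqP; rewrite -subr_eq0 -mulmxBl; apply/eqP/real_rho_ker.
have tu := twist_unit m.
have rN y : real_rho (- y) = - real_rho y by apply: (addrI (real_rho y)); rewrite -real_rhoD !subrr.
rewrite real_rhoD rN; apply: (can_inj (mulmxK tu)).
rewrite mul0mx mulmxBl !real_rho_form !rW ctrM; move: (model_form K m) xJ => J' xJ.
by rewrite !mulmxA -(mulmxA _ x J') -(mulmxA _ (x *m J')) xJ subrr.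
Qed.

End ModelExtension.

(** * Reduction theory of anisotropic forms *)

Lemma common_denominator (I : finType) (x : I -> rat) :
  exists2 N, (0 < N)%N & exists z : I -> int, forall i, N%:R * x i = (z i)%:~R.
Proof.
pose d i := `|denq (x i)|%N; exists (\prod_i d i)%N.
  by apply: prodn_gt0 => i; rewrite absz_gt0 denq_neq0.
exists (fun i => (\prod_(j | j != i) d j)%:Z * numq (x i)) => i.
have e : (denq (x i))%:~R = (d i)%:R :> rat.
  by rewrite /d -[RHS]/((`|denq (x i)|%N : int)%:~R) gez0_abs // ltW // denq_gt0.
rewrite (bigD1 i) //= natrM intrM numqE e.
by move: (\prod_(j | _) _)%N (d i) => p q; rewrite -[p%:~R]/(p%:R); ring.
Qed.

Lemma bounded_representatives (G : Type) (I : finType) (P : G -> Prop) (M : nat) (f : G -> I -> int) :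
  (forall g, P g -> forall i, (`|f g i| <= M)%N) ->
  exists N (r : 'I_N -> G), forall g, P g -> exists2 k, P (r k) & f (r k) =1 f g.
Proof.
move=> fM; pose code g : {ffun I -> 'I_(M + M).+1} := [ffun i => inord (absz (f g i + M%:Z))].
have codeE g g' : P g -> P g' -> code g = code g' -> f g =1 f g'.
  move=> Pg Pg' /ffunP e i; have := e i; rewrite !ffunE => /(congr1 val).
  have b1 := fM _ Pg i; have b2 := fM _ Pg' i.
  rewrite /= !inordK; [|lia|lia]; lia.
have [[g0 Pg0]|nP] := pselect (exists g, P g); last first.
  by exists 0, (fun k : 'I_0 => match k with Ordinal _ h => False_rect G (notF h) end) => g Pg; case: nP; exists g.
have /boolp.choice[r rP] : forall c, exists g, P g /\ ((exists2 g', P g' & code g' = c) -> code g = c).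
  move=> c; have [[g' Pg' gc]|n] := pselect (exists2 g', P g' & code g' = c).
    by exists g'.
  by exists g0.
exists #|{: {ffun I -> 'I_(M + M).+1}}|, (fun k => r (enum_val k)) => g Pg.
exists (enum_rank (code g)); rewrite enum_rankK; have [Pr cr] := rP (code g) => //.
by apply: codeE => //; apply: cr; exists g.
Qed.

Section AbstractReduction.
Variables (R : realType) (V : zmodType) (n : nat) (h : V -> 'rV[rat]_n) (h' : 'rV[rat]_n -> V).
Hypotheses (hD : {morph h : x y / x + y}) (hK : cancel h h') (h'K : cancel h' h).
Variable b : V -> V -> V.
Hypotheses (bDl : forall y, {morph b^~ y : x x' / x + x'}) (bDr : forall x, {morph b x : y y' / y + y'}).
Hypothesis b_aniso : forall x, b x x = 0 -> x = 0.
Variable lam : V -> rat.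
Hypotheses (lamD : {morph lam : x y / x + y}) (lam_nondeg : forall x, (forall y, lam (b x y) = 0) -> x = 0).

Local Notation bas := (basis_vector h').
Local Notation hR := (real_coord R h).
Local Notation beta := (real_form h h' b).

Definition preserves_form (X : 'M[R]_n) := forall v w : 'rV[R]_n, beta (v *m X) (w *m X) = beta v w.

(** The functional [lam] turns [b] into a nondegenerate bilinear form; its
    matrix [B] satisfies [X *m B *m X^T = B]. *)
Lemma preserves_form_det X : preserves_form X -> \det X ^+ 2 = 1.
Proof.
move=> Xb; pose Bq : 'M[rat]_n := \matrix_(i, j) lam (b (bas i) (bas j)).
pose B := map_mx (ratr : rat -> R) Bq.
pose ell : 'cV[R]_n := \col_j ratr (lam (bas j)).
have ellE x : hR x *m ell = (ratr (lam x))%:M.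
  rewrite [LHS]mx11_scalar mxE; congr (_%:M).
  have lD : {morph (fun x => (ratr (lam x) : R^o)) : x y / x + y} by move=> u v; rewrite lamD rmorphD.
  by rewrite (additive_coord hD hK h'K lD); apply: eq_bigr => j _; rewrite !mxE.
have BE v w : v *m B *m w^T = beta v w *m ell.
  rewrite /real_form mulmx_suml [LHS]mx11_scalar [RHS]mx11_scalar; congr (_%:M).
  rewrite summxE mxE; under eq_bigr => j _ do rewrite mxE mulr_suml.
  rewrite exchange_big /=; apply: eq_bigr => i _; rewrite mulmx_suml summxE.
  apply: eq_bigr => j _; rewrite -scalemxAl ellE !mxE eqxx mulr1n.
  by rewrite mulrAC.
have Bu : B \in unitmx.
  rewrite map_unitmx -row_free_unit -kermx_eq0; apply/eqP/row_matrixP => i; rewrite row0.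
  have /sub_kermxP := row_sub i (kermx Bq); move: (row i _) => u uB.
  rewrite -[u]h'K; have -> : h' u = 0.
    apply: lam_nondeg => y.
    have := BE (hR (h' u)) (hR y); rewrite (real_form_coord R hD hK h'K bDl bDr) ellE.
    rewrite /real_coord h'K -map_mxM uB map_mx0 mul0mx => /(congr1 (fun M : 'M[R]_1 => M 0 0)).
    by rewrite !mxE eqxx mulr1n => /esym/eqP; rewrite fmorph_eq0 => /eqP.
  exact: additive0 hD.
have XB : X *m B *m X^T = B.
  apply/matrixP => i j.
  have e (M : 'M[R]_n) : M i j = ((delta_mx 0 i : 'rV[R]_n) *m M *m (delta_mx 0 j : 'rV[R]_n)^T) 0 0.
    by rewrite -rowE trmx_delta -colE !mxE.
  rewrite e [RHS]e BE -Xb -BE; congr (fun_of_matrix _ 0 0).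
  by rewrite trmx_mul !mulmxA.
have Bd : \det B != 0 by rewrite -unitfE -unitmxE.
apply: (mulIf Bd); rewrite mul1r -[RHS](congr1 determinant XB) !det_mulmx det_tr.
by rewrite expr2 mulrAC.
Qed.

Definition form_coef (p : 'I_n * ('I_n * 'I_n)) : rat := h (b (bas p.1) (bas p.2.1)) 0 p.2.2.

Lemma form_entry (v w : 'rV[R]_n) l :
  beta v w 0 l = \sum_i \sum_j v 0 i * w 0 j * ratr (form_coef (i, (j, l))).
Proof.
rewrite /real_form summxE; apply: eq_bigr => i _; rewrite summxE; apply: eq_bigr => j _.
by rewrite mxE; congr (_ * _); rewrite mxE.
Qed.

Lemma form_bound : exists2 M : R, 0 < M & forall (v w : 'rV[R]_n) (q : R) l,
  (forall i j, `|v 0 i * w 0 j| <= q) -> 0 <= q -> `|beta v w 0 l| <= M * q.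
Proof.
pose c p : R := `|ratr (form_coef p)|.
have c0 p : 0 <= c p by exact: normr_ge0.
exists (1 + \sum_i \sum_j \sum_l c (i, (j, l))).
  by rewrite ltr_wpDr // !sumr_ge0 // => i _; rewrite !sumr_ge0 // => j _; rewrite sumr_ge0.
move=> v w q l vw q0; rewrite form_entry.
apply: le_trans (_ : (\sum_i \sum_j \sum_l c (i, (j, l))) * q <= _); last by rewrite ler_wpM2r // lerDr.
rewrite mulr_suml; apply: le_trans (ler_norm_sum _ _ _) _; apply: ler_sum => i _.
rewrite mulr_suml; apply: le_trans (ler_norm_sum _ _ _) _; apply: ler_sum => j _.
rewrite normrM mulrC ler_pM //.
by rewrite (bigD1 l) //= lerDl sumr_ge0.
Qed.

Definition lattice_vector (k : 'rV[int]_n) : V := h' (map_mx intr k).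

Lemma real_coord_lattice k : hR (lattice_vector k) = map_mx intr k.
Proof. by rewrite /real_coord h'K; apply/rowP => j; rewrite !mxE ratr_int. Qed.

Lemma lattice_form : exists2 N, (0 < N)%N & exists z : 'rV[int]_n -> 'rV[int]_n -> 'I_n -> int,
  forall k k' l, N%:R * beta (map_mx intr k) (map_mx intr k') 0 l = (z k k' l)%:~R :> R.
Proof.
have [N N0 [z zE]] := common_denominator form_coef; exists N => //.
exists (fun k k' l => \sum_i \sum_j k 0 i * k' 0 j * z (i, (j, l))) => k k' l.
rewrite form_entry mulr_sumr (rmorph_sum (intr : int -> R)); apply: eq_bigr => i _.
rewrite mulr_sumr (rmorph_sum (intr : int -> R)); apply: eq_bigr => j _.
rewrite !rmorphM /= !mxE -(ratr_int R (z _)) -zE rmorphM /= ratr_nat.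
by rewrite mulrCA.
Qed.

Lemma row_sqr (v : 'rV[R]_n) : (v *m v^T) 0 0 = \sum_i v 0 i ^+ 2.
Proof. by rewrite mxE; apply: eq_bigr => i _; rewrite mxE expr2. Qed.

Lemma row_sqr_bound (v : 'rV[R]_n) i j : `|v 0 i * v 0 j| <= (v *m v^T) 0 0.
Proof.
have le l : v 0 l ^+ 2 <= \sum_i v 0 i ^+ 2.
  by rewrite (bigD1 l) //= lerDl sumr_ge0 // => *; exact: sqr_ge0.
rewrite row_sqr; have := le i; have := le j; move: (\sum_i _) (v 0 i) (v 0 j) => S x y hy hx.
by rewrite ler_norml; apply/andP; split; nra.
Qed.

Lemma qform_sqr (X : 'M[R]_n) (a : 'rV[R]_n) : qform (X *m X^T) a = ((a *m X) *m (a *m X)^T) 0 0.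
Proof. by rewrite /qform trmx_mul !mulmxA. Qed.

(** If [v] is the image of an integer vector [k] under [X], then [beta v v =
    beta k k] is not zero and has a bounded denominator. So some coordinate of
    it is bounded below, and [v] cannot be too short. *)
Lemma preserves_form_lower : exists2 d : R, 0 < d & forall X, preserves_form X ->
  forall k : 'rV[int]_n, k != 0 -> d <= qform (X *m X^T) (map_mx intr k).
Proof.
have [M M0 Mb] := form_bound; have [N N0 [z zE]] := lattice_form.
exists ((N%:R * M)^-1); first by rewrite invr_gt0 mulr_gt0 // ltr0n.
move=> X Xb k k0; rewrite qform_sqr; set v : 'rV[R]_n := _ *m X.
have [l l0] : exists l, beta v v 0 l != 0.
  apply: contrapT => nl; move: k0; apply/negP; rewrite negbK; apply/eqP.
  have : lattice_vector k = 0.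
    apply: b_aniso; apply: (real_coord_inj (R := R) hK).
    rewrite -(real_form_coord R hD hK h'K bDl bDr) real_coord_lattice -Xb -/v.
    have -> : hR 0 = 0 := additive0 (real_coordD R hD).
    by apply/rowP => l; rewrite [RHS]mxE; apply/eqP/negPn/negP => ?; apply: nl; exists l.
  move=> /(congr1 hR); rewrite real_coord_lattice.
  have -> : hR 0 = 0 := additive0 (real_coordD R hD).
  move=> e; apply/rowP => j; have := congr1 (fun M : 'rV[R]_n => M 0 j) e.
  by rewrite !mxE => /eqP; rewrite intr_eq0 => /eqP.
have vq := Mb v v _ l (row_sqr_bound v).
have q0 : 0 <= (v *m v^T) 0 0 by rewrite row_sqr sumr_ge0 // => *; exact: sqr_ge0.
have := vq q0 => le.
have le1 : 1 <= N%:R * `|beta v v 0 l|.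
  have e : N%:R * beta v v 0 l = (z k k l)%:~R by rewrite Xb zE.
  rewrite -[N%:R](ger0_norm (ler0n _ _)) -normrM e -intr_norm ler1z.
  have : z k k l != 0.
    by rewrite -(intr_eq0 R) -e mulf_neq0 // pnatr_eq0 -lt0n.
  lia.
rewrite -[_^-1]mul1r ler_pdivrMr ?mulr_gt0 ?ltr0n //; apply: le_trans le1 _.
by rewrite (mulrC (_ 0 0)) -mulrA ler_wpM2l // ler0n.
Qed.

Lemma preserves_form_unit X : preserves_form X -> X \in unitmx.
Proof.
move=> /preserves_form_det d2; rewrite unitmxE unitfE; apply: contra_eq_neq d2 => ->.
by rewrite expr0n eq_sym oner_neq0.
Qed.

(** Hermite reduction applies to the forms of matrix [X *m X^T], of
    determinant 1. The values of [b] on a reduced basis have bounded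
    numerators and denominators, so finitely many matrices [r k] represent all
    the tables of values. *)
Lemma preserves_form_reduction : exists (c : R) N (r : 'I_N -> 'M[int]_n),
  forall X, preserves_form X -> exists k g, [/\ r k \in unitmx, g \in unitmx,
    forall i j, b (lattice_vector (row i (r k))) (lattice_vector (row j (r k))) =
                b (lattice_vector (row i g)) (lattice_vector (row j g)) &
    forall i j, `|(map_mx intr g *m X) i j| <= c].
Proof.
have [d d0 dX] := preserves_form_lower; have [C CX] := hermite_reduction n 1 d0.
have [M M0 Mb] := form_bound; have [N N0 [z zE]] := lattice_form.
pose P g := g \in unitmx /\ exists2 X, preserves_form X &
  forall i, qform (X *m X^T) (map_mx intr (row i g)) <= C.
pose f (g : 'M[int]_n) (p : 'I_n * ('I_n * 'I_n)) := z (row p.1 g) (row p.2.1 g) p.2.2.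
have fM g : P g -> forall p, (`|f g p| <= Num.bound (N%:R * (M * C)))%N.
  move=> [_ [X Xb Xg]] [i [j l]] /=; rewrite /f /=.
  have C0 : 0 <= C.
    by apply: le_trans (Xg i); rewrite qform_sqr row_sqr sumr_ge0 // => *; exact: sqr_ge0.
  rewrite -(ler_nat R) -[X in X <= _]/(((`|z (row i g) (row j g) l|%N : int))%:~R) abszE intr_norm.
  rewrite -zE -Xb normrM ger0_norm ?ler0n //.
  apply: le_trans (ltW (archi_boundP _)); last by rewrite !mulr_ge0 ?ler0n // ltW.
  rewrite ler_wpM2l ?ler0n //; apply: Mb => // a e.
  have := Xg i; have := Xg j; rewrite !qform_sqr !row_sqr.
  move: (_ *m X) (_ *m X) => v w.
  have le (u : 'rV[R]_n) q : u 0 q ^+ 2 <= \sum_i u 0 i ^+ 2.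
    by rewrite (bigD1 q) //= lerDl sumr_ge0 // => *; exact: sqr_ge0.
  have := le v a; have := le w e; move: (v 0 a) (w 0 e) => s t h1 h2 h3 h4.
  have : s ^+ 2 <= C by exact: le_trans h2 _.
  have : t ^+ 2 <= C by exact: le_trans h1 _.
  by move=> ht hs; rewrite ler_norml; apply/andP; split; nra.
have [L [r rP]] := bounded_representatives fM.
(* The entries have squares at most C, so they are at most C + 1. *)
exists (C + 1), L, r => X Xb.
have [||||g gu gC] := CX (X *m X^T).
- by rewrite trmx_mul trmxK.
- move=> a a0; rewrite qform_sqr row_sqr.
  have : a *m X != 0.
    by apply: contra_neq a0 => e; rewrite -[a](mulmxK (preserves_form_unit Xb)) e mul0mx.
  case/rV0Pn => j vj; rewrite (bigD1 j) //= ltr_pwDl ?sumr_ge0 // => [|i _]; last exact: sqr_ge0.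
  by rewrite exprn_even_gt0.
- by rewrite det_mulmx det_tr -expr2 preserves_form_det.
- exact: dX.
have [k [rku _] fk] := rP g (conj gu (ex_intro2 _ _ X Xb gC)).
exists k, g; split => // i j.
  apply: (real_coord_inj (R := R) hK); rewrite -!(real_form_coord R hD hK h'K bDl bDr) !real_coord_lattice.
  apply/rowP => l; apply: (@mulfI _ (N%:R : R)); first by rewrite pnatr_eq0 -lt0n.
  by rewrite !zE; congr (_%:~R); exact: (fk (i, (j, l))).
have := gC i; rewrite qform_sqr row_sqr (bigD1 j) //=.
have -> : (map_mx intr (row i g) *m X) 0 j = (map_mx intr g *m X) i j.
  by rewrite map_row -row_mul mxE.
have : 0 <= \sum_(l | l != j) (map_mx intr (row i g) *m X) 0 l ^+ 2.
  by rewrite sumr_ge0 // => *; exact: sqr_ge0.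
move: (\sum_(_ | _) _) ((_ *m _) i j) => S x S0 le.
by rewrite ler_norml; apply/andP; split; nra.
Qed.

End AbstractReduction.

(** * Boundedness modulo the order isometries *)

Section UniformReduction.
Variables (R : realType) (F : fieldExtType rat) (E : fieldExtType F) (D : falgType E).
Local Notation C := (CC R).
Variables (tau : D -> D) (r : nat) (K : 'M[D]_r) (iota : {rmorphism F -> R}).
Variable m : unitary_model tau r iota.
Local Notation V := 'M[D]_r.
Local Notation J := (model_form K m).
Hypothesis tau_inv : involution_over_galois tau.
Hypothesis dimV : (r * r * \dim {: D} * \dim {: E} = 3 * 3 + 3 * 3)%N.
Hypothesis Dunit : forall x : D, x != 0 -> x \is a GRing.unit.
Hypothesis one0 : (1%:M : V) != 0.
Local Notation form := (sesqui tau K).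
Hypothesis aniso : forall X : V, form X X = 0 -> X = 0.
Variable O : set D.
Hypothesis Oorder : is_order O.

Lemma sesqui_mull Z X Y : form (Z *m X) Y = Z *m form X Y.
Proof. by rewrite /form -!mulmxA. Qed.

(** The functional sums over the diagonal a functional of [D] that does not
    vanish at 1. For [x <> 0] the matrix [form x x] is not zero, and since [D]
    is a division algebra some product [form x x *m z] has a single nonzero
    diagonal entry, equal to 1. Such a product is again a value [form x y]. *)
Lemma nondegenerate_functional : exists lam : V -> rat, {morph lam : x y / x + y} /\
  forall x, (forall y, lam (form x y) = 0) -> x = 0.
Proof.
have [n [h [hD [h' hK h'K]]]] := @rational_coordinates F E D r.
have h0 : h 0 = 0 := additive0 hD.
have /rV0Pn[j j1] : h 1%:M != 0 by apply: contra_neq one0 => e; rewrite -[LHS]hK e -h0 hK.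
pose lam0 (d : D) := h d%:M 0 j.
have lam0D : {morph lam0 : x y / x + y} by move=> x y; rewrite /lam0 raddfD hD mxE.
have lam00 : lam0 0 = 0 by rewrite /lam0 raddf0 h0 mxE.
pose lam (X : V) := \sum_i lam0 (X i i).
exists lam; split.
  by move=> X Y; rewrite /lam -big_split; apply: eq_bigr => i _; rewrite mxE lam0D.
have nd (a : V) : (forall y, lam (a *m y) = 0) -> a = 0.
  move=> a0; apply/matrixP => i l; rewrite mxE; apply/eqP/negPn/negP => ail.
  pose y : V := \matrix_(k, q) (if (k == l) && (q == i) then (a i l)^-1 else 0).
  have := a0 y; rewrite /lam (bigD1 i) //= big1 => [|k ki].
    rewrite addr0 mxE (bigD1 l) //= big1 => [|k kl].
      rewrite addr0 mxE !eqxx /= mulrV ?Dunit // /lam0 => e.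
      by move: j1; rewrite e eqxx.
    by rewrite mxE (negPf kl) mulr0.
  rewrite mxE big1 ?lam00 // => q _; by rewrite mxE (negPf ki) andbF mulr0.
move=> x xy; apply: aniso; apply: nd => z.
have [_ _ tK _] := tau_inv.
have := xy (map_mx tau ((map_mx tau x)^T *m z))^T; rewrite /sesqui => <-; congr lam.
have e (M : V) : (map_mx tau (map_mx tau M)^T)^T = M by apply/matrixP => i l; rewrite !mxE tK.
by rewrite e mulmxA.
Qed.

Lemma real_rho_bound n (h' : 'rV[rat]_n -> V) : exists2 B : R, 0 <= B & forall (v : 'rV[R]_n) (c : R),
  (forall j, `|v 0 j| <= c) -> mx_bounded (c * B) (real_rho m h' v).
Proof.
have /boolp.choice[p pP] : forall j, exists p : R, 0 <= p /\ mx_bounded p (rho m (basis_vector h' j)).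
  move=> j; have [B Bb] := ex_mx_bounded (rho m (basis_vector h' j)); exists `|B|; split => // a e.
  by apply: le_trans (Bb a e) _; rewrite creal_le ler_norm.
exists (\sum_j p j); first by rewrite sumr_ge0 // => j _; case: (pP j).
move=> v c vc a e; rewrite summxE; apply: le_trans (ler_norm_sum _ _ _) _.
rewrite mulr_sumr (rmorph_sum (@creal R)); apply: ler_sum => j _.
rewrite mxE normrM normc_creal (rmorphM (@creal R)) ler_pM //.
- by rewrite -(rmorph0 (@creal R)) creal_le.
- by rewrite creal_le.
- exact: (pP j).2.
Qed.

(** Let [g] be the reduced basis of the extension of [x], and [rep k] the
    basis with the same table of values of the form. The integral operator [t]
    that carries the second to the first preserves the form. It commutes with
    left multiplications: for [w = t (z a) - z t(a)] one finds [form w w = 0],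
    because [form] is left linear. So [t] is right multiplication by [u =
    t(1)]. Both [t] and its inverse are integral, so [u] is an order isometry;
    and the coordinates of [u] in the basis [g] are those of 1 in the basis
    [rep k], of which there are finitely many. *)
Lemma uniform_reduction : exists B : R, forall x : 'M[C]_3, x *m J *m ctr x = J ->
  exists2 u, order_isometries O tau K u & mx_bounded B (rho m u *m x).
Proof.
have [n [h [hD [h' hK h'K] [k1 k1E] hO]]] := integral_coordinates Oorder one0.
have [lam [lamD lam_nd]] := nondegenerate_functional.
have [s [s1 s2]] := embedding_idempotent iota.
have bDl := sesquiDl tau K; have bDr := sesquiDr K tau_inv.
have [c [N [rep repP]]] := preserves_form_reduction R hD hK h'K bDl bDr aniso lamD lam_nd.
have [B B0 BP] := real_rho_bound h'.
pose q k : 'rV[R]_n := map_mx intr k1 *m invmx (map_mx intr (rep k)).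
exists ((\sum_k \sum_i `|q k 0 i|) * c * B) => x xJ.
have [Xt [Xr Xb]] := extension_operator tau_inv dimV hD hK h'K s1 s2 xJ.
have [k [g [ru gu rg gX]]] := repP Xt Xb.
pose t := invmx (rep k) *m g; pose t' := invmx g *m rep k.
have tt' : t *m t' = 1%:M by rewrite /t /t' mulmxA mulmxK ?mulVmx.
have t't : t' *m t = 1%:M by rewrite /t /t' mulmxA mulmxK ?mulVmx.
pose op (M : 'M[int]_n) (y : V) := h' (h y *m map_mx intr M).
have opD M : {morph op M : y z / y + z}.
  by move=> y z; rewrite /op hD mulmxDl (coord_additive hD hK h'K).
have opM M M' y : op M (op M' y) = op (M' *m M) y by rewrite /op h'K map_mxM mulmxA.
have op1 y : op 1%:M y = y by rewrite /op map_mx1 mulmx1 hK.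
have op_basis M j : op M (basis_vector h' j) = lattice_vector h' (row j M).
  by rewrite /op /basis_vector h'K -rowE /lattice_vector map_row.
have same y z : form (op g y) (op g z) = form (op (rep k) y) (op (rep k) z).
  apply: (real_coord_inj (R := R) hK).
  have add M z' : {morph (fun y => real_coord R h (form (op M y) z')) : y1 y2 / y1 + y2}.
    by move=> y1 y2; rewrite opD bDl (real_coordD R hD).
  have addr M y' : {morph (fun z => real_coord R h (form y' (op M z))) : y1 y2 / y1 + y2}.
    by move=> y1 y2; rewrite opD bDr (real_coordD R hD).
  rewrite (additive_coord hD hK h'K (add g _)) (additive_coord hD hK h'K (add (rep k) _)).
  apply: eq_bigr => i _; congr (_ *: _).
  rewrite (additive_coord hD hK h'K (addr g _)) (additive_coord hD hK h'K (addr (rep k) _)).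
  by apply: eq_bigr => j _; congr (_ *: real_coord R h _); rewrite !op_basis rg.
have Tb a e : form (op t a) (op t e) = form a e.
  have r1 y : op (rep k) (op (invmx (rep k)) y) = y by rewrite opM mulVmx // op1.
  by rewrite -{2}[a]r1 -{2}[e]r1 -same !opM.
have TL z a : op t (z *m a) = z *m op t a.
  apply/eqP; rewrite -subr_eq0; apply/eqP/aniso.
  set w := _ - _; have wE : w = op t (op t' w) by rewrite opM t't op1.
  rewrite {1}/w.
  have bN X Y : form (- X) Y = - form X Y by rewrite /sesqui !mulNmx.
  by rewrite bDl bN sesqui_mull wE !Tb sesqui_mull subrr.
pose u := op t 1%:M; pose u' := op t' 1%:M.
have opu a : op t a = a *m u by rewrite -TL mulmx1.
have u'u : u' *m u = 1%:M by rewrite -opu opM t't op1.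
have uu' : u *m u' = 1%:M.
  have T_inj y z : op t y = op t z -> y = z.
    by move=> /(congr1 (op t')); rewrite !opM tt' !op1.
  by apply: T_inj; rewrite opu -mulmxA u'u mulmx1.
have opO M i j : O (op M 1%:M i j).
  by apply: (hO _ (k1 *m M)); rewrite /op h'K k1E map_mxM.
exists u.
  apply/(order_isometriesP K m); split.
    by exists u'; split => // i j; split; exact: opO.
  have := rho_form K m u u; rewrite -[u *m K *m _]/(form u u) Tb rho_form !rho1.
  by rewrite ctr1 mulmx1 mul1mx => <-.
have -> : rho m u *m x = real_rho m h' (real_coord R h u *m Xt).
  by rewrite Xr (real_rho_coord m hD hK h'K).
have qE : real_coord R h u *m Xt = q k *m (map_mx intr g *m Xt).
  rewrite /q mulmxA; congr (_ *m _); rewrite /real_coord /u /op h'K k1E -map_mxM.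
  have -> : map_mx (ratr : rat -> R) (map_mx intr (k1 *m t)) = map_mx intr (k1 *m t).
    by apply/rowP => j; rewrite !mxE ratr_int.
  have inv1 : map_mx intr (rep k) *m map_mx intr (invmx (rep k)) = 1%:M :> 'M[R]_n.
    by rewrite -map_mxM mulmxV // map_mx1.
  have [ruR _] := mulmx1_unit inv1.
  rewrite /t mulmxA !map_mxM; congr (_ *m _ *m _).
  by rewrite -[LHS](mulKmx ruR) inv1 mulmx1.
apply: BP => j; rewrite qE mxE; apply: le_trans (ler_norm_sum _ _ _) _.
rewrite mulr_suml (bigD1 k) //= -[X in X <= _]addr0; apply: lerD.
  by rewrite mulr_suml; apply: ler_sum => i _; rewrite normrM ler_pM.
have c0 : 0 <= c by apply: le_trans (gX j j).
by rewrite sumr_ge0 // => l _; rewrite mulr_ge0 // sumr_ge0.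
Qed.

End UniformReduction.

(** * Cocompactness *)

Section Cocompact.
Variables (R : realType) (F : fieldExtType rat) (E : fieldExtType F) (D : falgType E).
Local Notation C := (CC R).
Variables (tau : D -> D) (r : nat) (K : 'M[D]_r) (iota : F -> R) (m : unitary_model tau r iota).
Variables (O : set D) (H : 'M[C]_3).
Local Notation J := (model_form K m).
Hypotheses (Hu : H \in unitmx) (Ju : J \in unitmx).
Variable Gamma : groupClosed (unitary_group H).
Variables (f : unitary_group J -> unitary_group H) (g : unitary_group H -> unitary_group J).
Hypotheses (fM : {morph f : x y / (x * y)%g}) (gK : cancel g f).
Hypothesis fc : continuous f.

Lemma scalar_unitary_norm (z : unitary_group H) a : mx_of z = a%:M -> `|a| = 1.
Proof.
move=> za; have := mx_of_iso z; rewrite za mul_scalar_mx /ctr map_scalar_mx tr_scalar_mx.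
rewrite mul_mx_scalar scalerA => /eqP.
rewrite -subr_eq0 -{2}[H]scale1r -scalerBl scaler_eq0 => /orP[|/eqP H0]; last first.
  by move: Hu; rewrite H0 unitmxE det0 unitr0.
rewrite subr_eq0 mulrC -normCK => /eqP a2.
by apply/eqP; rewrite -(@pexpr_eq1 _ _ 2) // a2.
Qed.

(** Let [y] be an arithmetic isometry such that [w = y (g h)^-1] is bounded,
    and let [f y = f y_i * c * z] with [y_i] in the finite list. Then [h = f
    (w^-1 y_i) z c], so the coset of [h] is represented in a compact set. *)
Lemma cocompact_of_reduction (B : R) (l : seq (unitary_group J)) :
  (forall x, arithmetic_isometry O x -> exists y c z, [/\ y \in l, c \in Gamma,
     is_scalar_mx (mx_of z) & f x = (f y * c * z)%g]) ->
  (forall x : unitary_group J, exists2 y, arithmetic_isometry O y & mx_bounded B (mx_of (y * x)%g)) ->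
  is_cocompact Gamma.
Proof.
move=> cosets red.
have f1 := group_morph1 fM; have fV := group_morphV fM.
have [KJ KJc KJP] := bounded_unitary_compact B Ju.
have /boolp.choice[bd bdP] : forall y, exists b : R, forall w, KJ w -> mx_bounded b (mx_of (f (w^-1 * y)%g)).
  move=> y; have cy : continuous (fun w : unitary_group J => (w^-1 * y)%g).
    apply: (unitary_mul_ctns (f := fun w : unitary_group J => (w^-1)%g) (g := fun=> y)).
      by apply: (unitary_inv_ctns (f := id)) => // w; exact: cvg_id.
    exact: cst_continuous.
  have cw : continuous (fun w : unitary_group J => mx_of (f (w^-1 * y)%g)).
    exact: (comp_ctns (comp_ctns cy fc) (@mx_of_ctns R 3 H)).
  by have [bd bdP] := compact_mx_bounded cw KJc; exists bd.
have [KH KHc KHP] := bounded_unitary_compact (\sum_(y <- l) `|bd y|) Hu.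
have img : [set: homogeneous_space Gamma] = (fun h : unitary_group H => (\pi_(homogeneous_space Gamma) h)%qT) @` KH.
  apply/seteqP; split => // q _; rewrite -[q]reprK; move: (repr q) => h.
  have [y ya yb] := red (g h^-1%g).
  set w := (y * g h^-1)%g in yb.
  have [yi [c [z [yil cG /is_scalar_mxP[a za] fy]]]] := cosets y ya.
  have hE : (h = f (w^-1 * yi) * z * c)%g.
    have zc : (z * c = c * z)%g.
      by apply/esym/scalar_unitaryC; apply/is_scalar_mxP; exists a.
    rewrite -mulgA zc fM -mulgA [(_ * (c * z))%g]mulgA -fy.
    by rewrite /w invgM fM !fV gK invgK -mulgA mulVg mulg1.
  exists (f (w^-1 * yi) * z)%g.
    apply: KHP => i j; rewrite mx_ofM za mul_mx_scalar mxE normrM (scalar_unitary_norm za) mul1r.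
    apply: le_trans (bdP yi w (KJP _ yb) i j) _; rewrite creal_le.
    by rewrite (big_rem yi) //= (le_trans (ler_norm _)) // lerDl sumr_ge0.
  by apply/pi_eqP; rewrite {1}hE mulKg.
rewrite /is_cocompact img; apply: continuous_compact KHc.
apply: continuous_subspaceT => x; exact: pi_continuous.
Qed.

End Cocompact.

Section Signature.
Variables (R : realType) (H : 'M[CC R]_3).

Lemma signature_isotropic : signature_2_1 H ->
  [/\ ctr H = H, H \in unitmx & exists2 v, v != 0 & hform H v v = 0].
Proof.
move=> [Hsym [P Pu PH]]; split => //.
  have : P *m H *m ctr P \in unitmx.
    rewrite /ctr PH unitmxE det_diag unitfE; apply/prodf_neq0 => i _; rewrite mxE.
    by case: ifP; rewrite ?oppr_eq0 oner_neq0.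
  by rewrite !unitmx_mul => /andP[/andP[]].
pose e : 'rV[CC R]_3 := delta_mx 0 o0 + delta_mx 0 o2; exists (e *m P).
  apply/eqP => eP; have : e = 0 by rewrite -[e](mulmxK Pu) eP mul0mx.
  move=> /rowP/(_ o0); rewrite !mxE /= => /eqP; rewrite addr0 oner_eq0 //.
have -> : hform H (e *m P) (e *m P) = (e *m (P *m H *m ctr P) *m ctr e) 0 0.
  by rewrite /hform ctrM !mulmxA.
have ec : ctr e = delta_mx o0 0 + delta_mx o2 0.
  by rewrite /e ctrD /ctr !map_delta_mx !trmx_delta.
rewrite /ctr PH -/(ctr e) ec mulmxDr -!colE /e mulmxDl -!rowE !mxE /=.
by rewrite !mulr1n !mulr0n addr0 add0r subrr.
Qed.

End Signature.

Section AnisotropicForm.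
Variables (R : realType) (F : fieldExtType rat) (E : fieldExtType F) (D : falgType E).
Variables (tau : D -> D) (r : nat) (K : 'M[D]_r) (iota : F -> R) (m : unitary_model tau r iota).
Local Notation J := (model_form K m).

Lemma anisotropic_sesqui : (forall v : 'rV[CC R]_3, v != 0 -> hform J v v != 0) ->
  forall X, sesqui tau K X X = 0 -> X = 0.
Proof.
move=> Ja X X0; apply: (rho_inj (u := m)).
have rho0 : rho m 0 = 0 by exact: additive0 (rhoD m).
have := rho_form K m X X; rewrite -/(sesqui tau K X X) X0 rho0 mul0mx => e.
apply/row_matrixP => i; rewrite row0; apply/eqP/negPn/negP => /Ja /eqP; apply.
have := congr1 (fun M : 'M[CC R]_3 => M i i) e; rewrite /= mxE => ->.
move: (model_form K m) (rho m X) => J' Y.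
rewrite /hform (_ : ctr (row i Y) = col i (ctr Y)); last by apply/colP => j; rewrite !mxE.
by rewrite -row_mul [LHS]mxE [RHS]mxE; apply: eq_bigr => j _; rewrite !mxE.
Qed.

End AnisotropicForm.

Theorem corollary1p2 (R : realType) (H : 'M[CC R]_3)
  (Gamma : groupClosed (unitary_group H)) :
  signature_2_1 H ->
  is_lattice Gamma ->
  ~ is_cocompact Gamma ->
  (exists (g : unitary_group H) (n : nat),
     [/\ g \in Gamma, is_complex_reflection g, has_order g n
       & n = 5%N \/ (7 <= n)%N]) ->
  ~ is_arithmetic Gamma.
Proof.
move=> sigH [_ Gmu] ncG [g [n [gG gr go n57]]].
move=> [F [E [D [d [tau [K [ ord [iota [phi [tau' [f [[Fr Equad Eim]]]]]]]]]]]]].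
move=> [[d13 [Dunit _ dimD] tau_inv Kherm Oorder] [[comp ncA other [fM fc fiso]] comm]].
have [Hsym Hu [vH vH0 vHi]] := signature_isotropic sigH.
have [m [psi [psii [[psiK psiiK psic psiic] [psiM rhoE AJ]]]]] :=
  model_exists d13 Equad Eim Dunit tau_inv comp Kherm.
have Jsym := model_form_herm m Kherm.
have [v v0 vi] := noncompact_isotropic psiK psiiK psiic AJ Jsym ncA.
have [fU [gU [[fUM fUK gUK fUc gUc] fgE]]] :=
  unitary_transport psiK psiiK psic psiic psiM AJ fM fc fiso.
have Ju := transported_form_unit Jsym Hsym Hu vH0 vHi fUM fUK gUK gUc.
have commJ : commensurable [set to_projective g | g in [set` Gamma]]
    [set to_projective (fU x) | x in arithmetic_isometry (K := K) (m := m) ord].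
  move: comm; rewrite (_ : [set to_projective (f X) | X in _] =
    [set to_projective (fU x) | x in arithmetic_isometry (K := K) (m := m) ord]) //.
  have fE X : fU (gU (f X)) = f X by exact: gUK.
  apply/seteqP; split => [_ [X [Y OY XY] <-]|_ [x [Y OY xY] <-]].
    by exists (gU (f X)); rewrite ?fE //; exists Y; rewrite // fgE XY rhoE.
  have [f' [_ fK f'K]] := fiso; exists (f' (fU x)); last by rewrite f'K.
  exists Y => //; apply: (can_inj psiK).
  by rewrite -fgE f'K fUK xY rhoE.
have dimA : ((3 %/ d) * (3 %/ d) * \dim {: D} = 3 * 3)%N.
  by rewrite dimD; case: d13 => ->.
(* Over the rationals the order of a reflection is 1, 2, 3, 4 or 6. *)
have [dF|/eqP dF] := eqVneq (\dim {: F}) 1%N.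
  have [e alg] := arithmetic_power Oorder fUM fUK gUK Ju Jsym (ex_intro2 _ _ v v0 vi) commJ.
  by have := rational_case Equad Eim dimA Hsym Hu Jsym Ju vH0 vHi v0 vi Gmu fUM fUK gUK gUc alg dF gG gr go n57.
(* Otherwise the form is anisotropic, and the lattice is cocompact. *)
have [iota1 i1] := second_embedding iota Fr dF.
have [phi1 [tau1 [comp1 cA1]]] := other iota1 i1.
have [m1 [psi1 [psii1 [[psiK1 psiiK1 psic1 psiic1] [psiM1 rhoE1 AJ1]]]]] :=
  model_exists d13 Equad Eim Dunit tau_inv comp1 Kherm.
have Ja := compact_anisotropic psiiK1 psic1 AJ1 (model_form_herm m1 Kherm) cA1.
have aniso := anisotropic_sesqui Ja.
have dimV : ((3 %/ d) * (3 %/ d) * \dim {: D} * \dim {: E} = 3 * 3 + 3 * 3)%N.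
  by rewrite dimA Equad.
have one0 : (1%:M : 'M[D]_(3 %/ d)) != 0.
  by case: d13 => ->; apply/eqP => /matrixP/(_ ord0 ord0); rewrite !mxE /= => /eqP; rewrite oner_eq0.
have [B BP] := uniform_reduction m tau_inv dimV Dunit one0 aniso Oorder.
have [l cosets] := arithmetic_cosets Oorder fUM commJ.
apply: ncG; apply: (cocompact_of_reduction Hu Ju fUM gUK fUc cosets (B := B)) => x.
have [u Ou uB] := BP _ (mx_of_iso x).
have uJ : isometry_group Num.conj (model_form K m) (rho m u).
  by have [_ uJ] := (order_isometriesP K m ord u).1 Ou; exact: isometry_unit Ju uJ.
by exists (mk_unitary uJ); [exists u|].
Qed.
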